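(* Fix $\beta>0$. (1) Let $q_\star\in(0,1]$ and set $q_o=\alpha q_\star$ with $|\alpha|\le1$. The collection of all stationary dynamics of the form $\mathsf U^{\rm sp}_{q_\star}(\vec V)$, $\vec V=(E,E_\star,G_\star,q_o)$, consists of $r(\tau)=-2c'(\tau)$ and $c(\tau)=c_{\gamma_\star}(\tau)$, the twice continuously differentiable, strictly decreasing, unique solution of the FDT equation given in the context, for $|\alpha|<1$ and $$\gamma=\gamma_\star(q_\star,\alpha):=\frac1{2(1-\alpha^2)}-2\beta^2\frac{\nu'(\alpha q_\star)^2}{\nu'(q_\star^2)} .$$ Moreover $c_{\gamma_\star}(\infty)\ge\alpha^2$, with equality if and only if $g_\beta'(x)<g_\beta'(\alpha^2)$ whenever $x\in(\alpha^2,1]$ and either the mixture $\nu$ is pure $p$-spins or $\alpha=q_\star$. (When $\nu$ is even or odd, taking instead $\alpha=-q_\star$ has no effect on $\gamma_\star$ or $c_{\gamma_\star}(\cdot)$.) (2) With $\psi(r)=r\nu''(r)+\nu'(r)$ and $b_\alpha:=\nu'(\alpha q_\star)/\nu'(q_\star^2)$, such stationary dynamics appears (i.e. $\mathsf U^{\rm sp}_{q_\star}(\vec V)$ is stationary) if and only if $|\alpha|<1$ and $$\begin{bmatrix}E-2\beta(\nu(1)-(1-\alpha^2)\nu'(\alpha q_\star)b_\alpha)\\ E_\star-2\beta\nu(\alpha q_\star)\\ q_\star G_\star-2\beta\alpha\nu'(\alpha q_\star)\\ \frac{\alpha}{2\beta(1-\alpha^2)}-2\beta b_\alpha[\alpha\psi(\alpha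 q_\star)-q_\star\nu''(\alpha q_\star)]\end{bmatrix}\in\mathrm{Image}\begin{bmatrix}\nu(\alpha q_\star)&\alpha q_\star\nu'(\alpha q_\star)\\ \nu(q_\star^2)&q_\star^2\nu'(q_\star^2)\\ q_\star\nu'(q_\star^2)&q_\star\psi(q_\star^2)\\ q_\star\nu'(\alpha q_\star)&q_\star\psi(\alpha q_\star)\end{bmatrix}.$$ In particular, for $\alpha=q_\star$ (and, if $\nu$ is even, also for $\alpha=-q_\star$, which does not change the functions $(C,\chi,H)$ in $\mathsf U^{\rm sp}_{q_\star}$) this constraint amounts to $$G_\star=\frac1{2\beta(1-q_\star^2)}+2\beta(1-q_\star^2)\nu''(q_\star^2),\qquad E-E_\star=2\beta[\nu(1)-(1-q_\star^2)\nu'(q_\star^2)-\nu(q_\star^2)] .$$ (3) Similarly, the only stationary dynamics of the form $\mathsf U^{\rm sp}_0(E)$ is $r(\tau)=-2c'(\tau)$ and $c(\tau)=c_{1/2}(\tau)$, which occurs if and only if $E=2\beta\nu(1)$.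
   Context: **Mixture.** $\nu(r)=\sum_{p\ge2}b_p^2r^p$, $b_p\ge0$ not all zero, $\limsup_{p\to\infty}\frac1p\log b_p\le-\log\bar r$ for some $\bar r\in(1,\infty]$. $\nu$ is pure $p$-spins if only one $b_p\neq0$. **Allowed parameters.** $\vec V=(E,E_\star,G_\star,q_o)$ is allowed for $q_\star\in(0,1]$ if $|q_o|\le q_\star$, $|q_o|<1$, and for pure $p$-spins $G_\star=pE_\star/q_\star^2$, and further $E_\star=q_o^pE$ if $q_\star=|q_o|$. Only allowed $\vec V$ are considered. **Spherical dynamics, $q_\star>0$.** With $\psi(r)=r\nu''(r)+\nu'(r)$ let $\underline w=(w_1,\dots,w_4)$ solve $(E,E_\star,G_\star,0)^\top=\Sigma_\nu(q_o)\underline w$, $$\Sigma_\nu(q_o)=\begin{bmatrix}\nu(1)&\nu(q_o)&q_oq_\star^{-2}\nu'(q_o)&q_\star^{-2}\sqrt{q_\star^2-q_o^2}\,\nu'(q_o)\\ \nu(q_o)&\nu(q_\star^2)&\nu'(q_\star^2)&0\\ q_oq_\star^{-2}\nu'(q_o)&\nu'(q_\star^2)&q_\star^{-2}\psi(q_\star^2)&0\\ q_\star^{-2}\sqrt{q_\star^2-q_o^2}\,\nu'(q_o)&0&0&q_\star^{-2}\nu'(q_\star^2)\end{bmatrix},$$ $\mathsf v(x,y)=w_1\nu(y)+w_2\nu(x)+w_3q_\star^{-2}x\nu'(x)+w_4z\nu'(x)$, $z=(y-q_oq_\star^{-2}x)/\sqrt{q_\star^2-q_o^2}$. If $|q_o|=q_\star$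 then $w_4=0$ and $z:=0$. For pure $p$-spins set $w_3=0$ and solve the reduced system if $|q_o|<q_\star$, while $\mathsf v(x,y)=Ey^p$ if $|q_o|=q_\star$. Subscripts $x,y$ denote partial derivatives. $\mathsf U^{\rm sp}_{q_\star}(\vec V)$ consists of $C(s,t)=C(t,s)$, $\chi(s,t)=\int_0^tR(s,u)du$, $q$, $H$, with $R(s,t)=0$ for $t>s$, $R(s,s)\equiv1$, $q(0)=q_o$, $C(s,s)\equiv1$, and for $s>t$ the bounded continuous $C,R,q,H$ are the unique, continuously differentiable in $s$, solution of (with $C_o(s):=C(s,0)$) $$\partial_sR(s,t)=-\mu(s)R(s,t)+\beta^2\int_t^sR(u,t)R(s,u)\nu''(C(s,u))\,du,$$ $$\partial_sC(s,t)=-\mu(s)C(s,t)+\beta\hat{\mathsf A}_C(s,t),\qquad \partial_sq(s)=-\mu(s)q(s)+\beta\hat{\mathsf A}_q(s),$$ $$H(s)=\beta\int_0^sR(s,u)\nu'(C(s,u))\,du-\beta\nu'(q(s))L(s)+\mathsf v(q(s),C_o(s)),\qquad \mu(s)=\tfrac12+\beta\hat{\mathsf A}_C(s,s),$$ $$\hat{\mathsf A}_C(s,t)=\beta\int_0^sR(s,u)\nu''(C(s,u))C(u,t)\,du+\beta\int_0^tR(t,u)\nu'(C(s,u))\,du-\beta q(t)\nu''(q(s))L(s)-\beta\nu'(q(s))L(t)+q(t)\mathsf v_x(q(s),C_o(s))+C_o(t)\mathsf v_y(q(s),C_o(s)),$$ $$\hat{\mathsf A}_q(s)=\beta\int_0^sR(s,u)q(u)\nu''(C(s,u))\,du-\beta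 q_\star^2\nu''(q(s))L(s)+q_\star^2\mathsf v_x(q(s),C_o(s))+q_o\mathsf v_y(q(s),C_o(s)),$$ $$L(s)=\frac1{\nu'(q_\star^2)}\int_0^sR(s,u)\nu'(q(u))\,du.$$ **Spherical dynamics, $q_\star=0$.** $\mathsf U^{\rm sp}_0(E)$ is defined likewise with $q\equiv0$, $L\equiv0$, $\mathsf v(y)=E\nu(y)/\nu(1)$, $\hat{\mathsf A}_C(s,t)=\beta\int_0^sR(s,u)\nu''(C(s,u))C(u,t)\,du+\beta\int_0^tR(t,u)\nu'(C(s,u))\,du+C_o(t)\mathsf v'(C_o(s))$ and $H(s)=\beta\int_0^sR(s,u)\nu'(C(s,u))\,du+\mathsf v(C_o(s))$. **Stationary.** A dynamics is stationary if $C(s,t)=c(s-t)$, $R(s,t)=r(s-t)$ (for $s\ge t\ge0$), $q(s)=q(0)$ and $H(s)=H(0)$ for all $s\ge0$. **FDT equation.** $g_\beta(x)=2\beta^2\nu(x)+\frac x2+\frac12\log(1-x)$ (with $g'_\beta(1)=-\infty$), $\phi_\gamma(x)=\gamma+2\beta^2\nu'(x)$ and $c_\gamma(\infty)=\sup\{x\in[0,1]:g_\beta'(x)\ge\frac12-\gamma\}$, for $\gamma$ large enough that such $x$ exists. For such $\gamma$, $c_\gamma(\cdot)$ is the unique $[0,1]$-valued, strictly decreasing, continuously differentiable solution of $$c'(\tau)=-\int_0^\tau\phi_\gamma(c(v))c'(\tau-v)\,dv-\tfrac12,\qquad c(0)=1,$$ and $c_\gamma(\tau)\to c_\gamma(\infty)$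 as $\tau\to\infty$ (known facts).
   Formalization: In (1), equality c(∞)=α² is also allowed for α=0 and for α=−q⋆ with ν even or odd, since the stated condition fails there; existence of a stationary dynamics for given |α|<1 is not claimed when α≠0 and ν'(αq⋆)=ψ(αq⋆)=0, where (2) rules it out. *)

(* Defs.v *)
From Stdlib Require Import Reals.
From Coquelicot Require Import Coquelicot.
Open Scope R_scope.

(** * Mixtures *)

Definition Rbar_ln (x : Rbar) : Rbar :=
  match x with
  | Finite r => if Rle_dec r 0 then m_infty else Finite (ln r)
  | p_infty => p_infty
  | m_infty => m_infty
  end.

(* Coquelicot's [LimSup_seq] only takes real sequences, and [log b_p] is -oo
   when [b_p = 0]. *)
Definition Rbar_LimSup_seq (u : nat -> Rbar) : Rbar :=
  Inf_seq (fun m => Sup_seq (fun n => u (n + m)%nat)).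

(* The coefficients are indexed by all of [nat], with b_0 = b_1 = 0. *)
Definition mixture (b : nat -> R) : Prop :=
  b 0%nat = 0 /\ b 1%nat = 0 /\
  (forall p, 0 <= b p) /\
  (exists p, b p <> 0) /\
  (exists rbar : Rbar, Rbar_lt (Finite 1) rbar /\
     Rbar_le
       (Rbar_LimSup_seq
          (fun p => Rbar_mult (Finite (/ INR p)) (Rbar_ln (Finite (b p)))))
       (Rbar_opp (Rbar_ln rbar))).

Definition nu (b : nat -> R) : R -> R := PSeries (fun p => b p ^ 2).
Definition nu1 (b : nat -> R) : R -> R := Derive (nu b).
Definition nu2 (b : nat -> R) : R -> R := Derive_n (nu b) 2.
Definition psi (b : nat -> R) (r : R) : R := r * nu2 b r + nu1 b r.

Definition pure_spins (b : nat -> R) (p : nat) : Prop :=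
  b p <> 0 /\ forall k, k <> p -> b k = 0.
Definition pure (b : nat -> R) : Prop := exists p, pure_spins b p.

Definition nu_even (b : nat -> R) : Prop := forall r, nu b (- r) = nu b r.
Definition nu_odd (b : nat -> R) : Prop := forall r, nu b (- r) = - nu b r.

(** * Parameters *)

Record params := Params { pE : R; pEs : R; pGs : R; pqo : R }.

Definition allowed (b : nat -> R) (qs : R) (V : params) : Prop :=
  Rabs (pqo V) <= qs /\ Rabs (pqo V) < 1 /\
  (forall p, pure_spins b p ->
     pGs V = INR p * pEs V / qs ^ 2 /\
     (qs = Rabs (pqo V) -> pEs V = pqo V ^ p * pE V)).

(** * The function v(x,y) *)

Definition Sigma (b : nat -> R) (qs qo : R) : matrix 4 4 :=
  [ [ nu b 1, nu b qo, qo / qs ^ 2 * nu1 b qo,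
      sqrt (qs ^ 2 - qo ^ 2) / qs ^ 2 * nu1 b qo ],
    [ nu b qo, nu b (qs ^ 2), nu1 b (qs ^ 2), 0 ],
    [ qo / qs ^ 2 * nu1 b qo, nu1 b (qs ^ 2), psi b (qs ^ 2) / qs ^ 2, 0 ],
    [ sqrt (qs ^ 2 - qo ^ 2) / qs ^ 2 * nu1 b qo, 0, 0,
      nu1 b (qs ^ 2) / qs ^ 2 ] ].

(* [Sigma] without its third row and column. *)
Definition Sigma_pure (b : nat -> R) (qs qo : R) : matrix 3 3 :=
  [ [ nu b 1, nu b qo, sqrt (qs ^ 2 - qo ^ 2) / qs ^ 2 * nu1 b qo ],
    [ nu b qo, nu b (qs ^ 2), 0 ],
    [ sqrt (qs ^ 2 - qo ^ 2) / qs ^ 2 * nu1 b qo, 0,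
      nu1 b (qs ^ 2) / qs ^ 2 ] ].

Definition zvar (qs qo x y : R) : R :=
  if Rlt_dec (Rabs qo) qs
  then (y - qo / qs ^ 2 * x) / sqrt (qs ^ 2 - qo ^ 2)
  else 0.

Definition v_of (b : nat -> R) (qs qo w1 w2 w3 w4 x y : R) : R :=
  w1 * nu b y + w2 * nu b x + w3 * (x * nu1 b x / qs ^ 2)
  + w4 * (zvar qs qo x y * nu1 b x).

(* For |q_o| = q_star the last row of the system reads
   q_star^-2 nu'(q_star^2) w4 = 0, so w4 = 0 need not be imposed.  In that case,
   w is not always unique (e.g. when only two of the b_p are nonzero), which is
   why [v] enters through a relation. *)
Definition is_v (b : nat -> R) (qs : R) (V : params) (v : R -> R -> R) : Prop :=
  (exists p, pure_spins b p /\ Rabs (pqo V) = qs /\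
     forall x y, v x y = pE V * y ^ p)
  \/
  (pure b /\ Rabs (pqo V) < qs /\
     exists w1 w2 w4,
       Mmult (Sigma_pure b qs (pqo V)) ([ [w1], [w2], [w4] ] : matrix 3 1)
         = [ [pE V], [pEs V], [0] ] /\
       forall x y, v x y = v_of b qs (pqo V) w1 w2 0 w4 x y)
  \/
  (~ pure b /\
     exists w1 w2 w3 w4,
       Mmult (Sigma b qs (pqo V)) ([ [w1], [w2], [w3], [w4] ] : matrix 4 1)
         = [ [pE V], [pEs V], [pGs V], [0] ] /\
       forall x y, v x y = v_of b qs (pqo V) w1 w2 w3 w4 x y).

(** * The dynamics *)

(* Only the values at nonnegative times are meaningful. *)
Record dynamics := Dynamics {
  dC : R -> R -> R; dR : R -> R -> R; dchi : R -> R -> R;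
  dq : R -> R; dH : R -> R }.

Definition eq_dynamics (D D' : dynamics) : Prop :=
  (forall s t, 0 <= s -> 0 <= t ->
     dC D s t = dC D' s t /\ dR D s t = dR D' s t /\ dchi D s t = dchi D' s t) /\
  (forall s, 0 <= s -> dq D s = dq D' s /\ dH D s = dH D' s).

Definition C1_after (t : R) (f : R -> R) : Prop :=
  forall s, t < s -> ex_derive f s /\ continuous (Derive f) s.

(* R jumps across the diagonal, so it is continuous on {t <= s} only.  The
   bounds by the radius of convergence say that nu, nu' and nu'' are evaluated
   where the series defining nu converges: outside, [PSeries] and [Derive]
   return arbitrary values. *)
Definition regular (b : nat -> R) (D : dynamics) : Prop :=
  continuous_on (fun p : R * R => 0 <= fst p /\ 0 <= snd p)
    (fun p => dC D (fst p) (snd p)) /\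
  continuous_on (fun p : R * R => 0 <= snd p <= fst p)
    (fun p => dR D (fst p) (snd p)) /\
  continuous_on (fun s => 0 <= s) (dq D) /\
  continuous_on (fun s => 0 <= s) (dH D) /\
  (exists M, forall s t, 0 <= s -> 0 <= t ->
     Rabs (dC D s t) <= M /\ Rabs (dR D s t) <= M /\
     Rabs (dq D s) <= M /\ Rabs (dH D s) <= M) /\
  (forall s t, 0 <= s -> 0 <= t ->
     Rbar_lt (Finite (Rabs (dC D s t))) (CV_radius (fun p => b p ^ 2)) /\
     Rbar_lt (Finite (Rabs (dq D s))) (CV_radius (fun p => b p ^ 2))) /\
  (forall t, 0 <= t ->
     C1_after t (fun s => dC D s t) /\ C1_after t (fun s => dR D s t)) /\
  C1_after 0 (dq D) /\ C1_after 0 (dH D).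

(* The part of the system shared by q_star > 0 and q_star = 0; [A] stands for
   the function \hat A_C. *)
Definition CR_system (beta : R) (b : nat -> R) (A : R -> R -> R)
    (D : dynamics) : Prop :=
  let C := dC D in let R := dR D in
  let mu s := 1 / 2 + beta * A s s in
  regular b D /\
  (forall s t, 0 <= s -> 0 <= t -> C s t = C t s) /\
  (forall s, 0 <= s -> C s s = 1) /\
  (forall s, 0 <= s -> R s s = 1) /\
  (forall s t, 0 <= s < t -> R s t = 0) /\
  (forall s t, 0 <= s -> 0 <= t -> dchi D s t = RInt (fun u => R s u) 0 t) /\
  (forall s t, 0 <= t < s ->
     is_derive (fun s' => R s' t) s
       (- mu s * R s t
        + beta ^ 2 * RInt (fun u => R u t * R s u * nu2 b (C s u)) t s)) /\
  (forall s t, 0 <= t < s ->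
     is_derive (fun s' => C s' t) s (- mu s * C s t + beta * A s t)).

Definition dL (b : nat -> R) (qs : R) (D : dynamics) (s : R) : R :=
  / nu1 b (qs ^ 2) * RInt (fun u => dR D s u * nu1 b (dq D u)) 0 s.

Definition v_x (v : R -> R -> R) (x y : R) : R := Derive (fun x' => v x' y) x.
Definition v_y (v : R -> R -> R) (x y : R) : R := Derive (fun y' => v x y') y.

Definition A_C (beta : R) (b : nat -> R) (qs : R) (v : R -> R -> R)
    (D : dynamics) (s t : R) : R :=
  let C := dC D in let R := dR D in let q := dq D in let L := dL b qs D in
  beta * RInt (fun u => R s u * nu2 b (C s u) * C u t) 0 s
  + beta * RInt (fun u => R t u * nu1 b (C s u)) 0 t
  - beta * (q t * nu2 b (q s) * L s) - beta * (nu1 b (q s) * L t)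
  + q t * v_x v (q s) (C s 0) + C t 0 * v_y v (q s) (C s 0).

Definition A_q (beta : R) (b : nat -> R) (qs qo : R) (v : R -> R -> R)
    (D : dynamics) (s : R) : R :=
  let C := dC D in let R := dR D in let q := dq D in let L := dL b qs D in
  beta * RInt (fun u => R s u * q u * nu2 b (C s u)) 0 s
  - beta * qs ^ 2 * nu2 b (q s) * L s
  + qs ^ 2 * v_x v (q s) (C s 0) + qo * v_y v (q s) (C s 0).

Definition solves_sp (beta : R) (b : nat -> R) (qs : R) (V : params)
    (D : dynamics) : Prop :=
  exists v, is_v b qs V v /\
  let A := A_C beta b qs v D in
  let mu s := 1 / 2 + beta * A s s in
  CR_system beta b A D /\
  dq D 0 = pqo V /\
  (forall s, 0 < s ->
     is_derive (dq D) s
       (- mu s * dq D s + beta * A_q beta b qs (pqo V) v D s)) /\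
  (forall s, 0 <= s ->
     dH D s = beta * RInt (fun u => dR D s u * nu1 b (dC D s u)) 0 s
              - beta * nu1 b (dq D s) * dL b qs D s + v (dq D s) (dC D s 0)).

(* [D] is the dynamics U^sp_{q_star}(V). *)
Definition is_Usp (beta : R) (b : nat -> R) (qs : R) (V : params)
    (D : dynamics) : Prop :=
  solves_sp beta b qs V D /\
  forall D', solves_sp beta b qs V D' -> eq_dynamics D' D.

Definition A_C0 (beta : R) (b : nat -> R) (v : R -> R)
    (D : dynamics) (s t : R) : R :=
  let C := dC D in let R := dR D in
  beta * RInt (fun u => R s u * nu2 b (C s u) * C u t) 0 s
  + beta * RInt (fun u => R t u * nu1 b (C s u)) 0 t
  + C t 0 * Derive v (C s 0).

Definition solves_sp0 (beta : R) (b : nat -> R) (E : R) (D : dynamics) : Prop :=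
  let v y := E * nu b y / nu b 1 in
  CR_system beta b (A_C0 beta b v D) D /\
  (forall s, 0 <= s -> dq D s = 0) /\
  (forall s, 0 <= s ->
     dH D s = beta * RInt (fun u => dR D s u * nu1 b (dC D s u)) 0 s
              + v (dC D s 0)).

(* [D] is the dynamics U^sp_0(E). *)
Definition is_Usp0 (beta : R) (b : nat -> R) (E : R) (D : dynamics) : Prop :=
  solves_sp0 beta b E D /\
  forall D', solves_sp0 beta b E D' -> eq_dynamics D' D.

Definition has_profile (D : dynamics) (c r : R -> R) : Prop :=
  forall s t, 0 <= t <= s -> dC D s t = c (s - t) /\ dR D s t = r (s - t).

Definition stationary (D : dynamics) : Prop :=
  (exists c r, has_profile D c r) /\
  (forall s, 0 <= s -> dq D s = dq D 0 /\ dH D s = dH D 0).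

(** * The FDT equation *)

Definition g_beta (beta : R) (b : nat -> R) (x : R) : R :=
  2 * beta ^ 2 * nu b x + x / 2 + ln (1 - x) / 2.

Definition dg_beta (beta : R) (b : nat -> R) (x : R) : Rbar :=
  if Req_EM_T x 1 then m_infty else Finite (Derive (g_beta beta b) x).

Definition phi (gamma beta : R) (b : nat -> R) (x : R) : R :=
  gamma + 2 * beta ^ 2 * nu1 b x.

Definition c_inf_set (beta : R) (b : nat -> R) (gamma x : R) : Prop :=
  0 <= x <= 1 /\ Rbar_le (Finite (1 / 2 - gamma)) (dg_beta beta b x).

(* "gamma is large enough". *)
Definition gamma_ok (beta : R) (b : nat -> R) (gamma : R) : Prop :=
  exists x, c_inf_set beta b gamma x.

Definition c_inf (beta : R) (b : nat -> R) (gamma : R) : R :=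
  real (Lub_Rbar (c_inf_set beta b gamma)).

(* One-sided derivative at 0. *)
Definition derivative_on_halfline (f f' : R -> R) : Prop :=
  forall x, 0 <= x ->
    filterlim (fun y => (f y - f x) / (y - x))
      (within (fun y => 0 <= y) (locally' x)) (locally (f' x)).

Definition C1_on_halfline (f f' : R -> R) : Prop :=
  derivative_on_halfline f f' /\ continuous_on (fun x => 0 <= x) f'.

Definition FDT_solution (beta : R) (b : nat -> R) (gamma : R)
    (c c' : R -> R) : Prop :=
  (forall tau, 0 <= tau -> 0 <= c tau <= 1) /\
  (forall x y, 0 <= x < y -> c y < c x) /\
  C1_on_halfline c c' /\
  c 0 = 1 /\
  (forall tau, 0 <= tau ->
     c' tau
     = - RInt (fun v => phi gamma beta b (c v) * c' (tau - v)) 0 tau - 1 / 2).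

(* [c] is c_gamma, with derivative [c']. *)
Definition is_c_gamma (beta : R) (b : nat -> R) (gamma : R)
    (c c' : R -> R) : Prop :=
  FDT_solution beta b gamma c c' /\
  forall d d', FDT_solution beta b gamma d d' ->
    forall tau, 0 <= tau -> d tau = c tau.

Definition gamma_star (beta : R) (b : nat -> R) (qs alpha : R) : R :=
  1 / (2 * (1 - alpha ^ 2))
  - 2 * beta ^ 2 * (nu1 b (alpha * qs) ^ 2 / nu1 b (qs ^ 2)).

(** * The constraint on the parameters *)

Definition b_alpha (b : nat -> R) (qs alpha : R) : R :=
  nu1 b (alpha * qs) / nu1 b (qs ^ 2).

Definition stat_vector (beta : R) (b : nat -> R) (qs alpha : R) (V : params)
    : matrix 4 1 :=
  [ [ pE V - 2 * beta *
        (nu b 1 - (1 - alpha ^ 2) * nu1 b (alpha * qs) * b_alpha b qs alpha) ],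
    [ pEs V - 2 * beta * nu b (alpha * qs) ],
    [ qs * pGs V - 2 * beta * alpha * nu1 b (alpha * qs) ],
    [ alpha / (2 * beta * (1 - alpha ^ 2))
      - 2 * beta * b_alpha b qs alpha *
        (alpha * psi b (alpha * qs) - qs * nu2 b (alpha * qs)) ] ].

Definition stat_matrix (b : nat -> R) (qs alpha : R) : matrix 4 2 :=
  [ [ nu b (alpha * qs), alpha * qs * nu1 b (alpha * qs) ],
    [ nu b (qs ^ 2), qs ^ 2 * nu1 b (qs ^ 2) ],
    [ qs * nu1 b (qs ^ 2), qs * psi b (qs ^ 2) ],
    [ qs * nu1 b (alpha * qs), qs * psi b (alpha * qs) ] ].

Definition in_image {m n : nat} (M : matrix m n) (y : matrix m 1) : Prop :=
  exists x : matrix n 1, Mmult (T := R_Ring) M x = y.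

(* Main.v *)
Require Import Defs.
From Stdlib Require Import Reals Lra Lia Psatz.
From Stdlib Require Import Classical FunctionalExtensionality IndefiniteDescription.
From Coquelicot Require Import Coquelicot.
Open Scope R_scope.

(** The proof writes [r = -2 c'] as [2 h] with [h = - c'].

    Sufficiency.  For [C (s, t) = c (s - t)] and [R (s, t) = 2 h (s - t)], the
    fluctuation-dissipation relation [R = -2 C'] turns every time integral of the system
    into an exact derivative ([int_nuc], [I2_eq]), up to the single convolution that
    occurs in the FDT equation ([I3_eq]).  So [A_C (s, t)] is explicit.  Its terms that
    do not depend on [s - t] alone cancel against [v] and [L] when
    [v = 2 beta nu (y) + ...], the coefficient of [(y - q_o x / q_star^2) nu' (x)] is
    [- 2 beta b_alpha] and [gamma = gamma_star] ([D_A]).  In terms of the linear system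
    that defines [v], the first condition together with a prescribed value of
    [v_x (q_o, 1)], needed for q to be constant, is exactly membership in the image of
    [stat_matrix] ([image_of_sys], [sys_of_image], [construct]).

    Necessity.  Only times near 0 are used.  If q and H are constant, the equation for q
    gives [v_x (q_o, 1)] in the limit [s -> 0] ([nec_q]); in the equation for H, divided
    by [s], the limit involves the slope [- 1/2] of [C (s, 0)] and shows that
    [w1 = 2 beta] ([nec_H]), because [nu' (alpha q_star)^2 / nu' (q_star^2)] is at most
    [nu' (alpha^2)] by Cauchy-Schwarz ([cs_nu1]) and [nu' (alpha^2) < nu' (1)].  For
    [|alpha| = 1] the limit of the equation for q is contradictory.

    The dynamics with given parameters is unique: the difference of two solutions
    contracts in a norm with weight [exp (L s)] on every bounded time interval
    ([near_contract]), and [v] itself is determined by the parameters when [|alpha| < 1],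
    as the quadratic form of Sigma is a sum of nonnegative terms over the mixture
    ([hom_zero]).  Hence a stationary dynamics must be the explicit one.

    The FDT equation is a Volterra equation for [h], solved by Picard iteration
    ([volt_exists]).  Monotonicity of [nu'] makes [h] positive ([volt_pos]), and a value
    [x0] with [phi x0 * (1 - x0) >= 1/2] is never reached by [c] ([relaxation_exists]).
    Cauchy-Schwarz says that [alpha^2] is such a value for [gamma_star]; equality there
    decides when [c_inf = alpha^2] ([cs_equality], [c_inf_eq]).

    Two symmetries finish the proof: for even mixtures, [q -> - q] exchanges the dynamics
    with [q_o] and with [- q_o] ([flip_Usp]); and the case [q_star = 0] is the case
    [q_star = 1], [q_o = 0] ([sp0_sp], [sp_sp0]). *)

(** * Calculus on the real line *)

(* Statements about normed modules, applied to real functions, leave goals whose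
   carrier is the module structure of R; [ring] wants the carrier R itself. *)
Ltac in_R := match goal with |- @eq _ ?a ?b =>
  let H := fresh in enough (H : @eq R a b) by exact H end.
Ltac rring := in_R; ring.

Lemma cont_plus {U : UniformSpace} (f g : U -> R) (x : U) :
  continuous f x -> continuous g x -> continuous (fun y => f y + g y) x.
Proof. apply (continuous_plus (V := R_NormedModule)). Qed.

Lemma cont_minus {U : UniformSpace} (f g : U -> R) (x : U) :
  continuous f x -> continuous g x -> continuous (fun y => f y - g y) x.
Proof. apply (continuous_minus (V := R_NormedModule)). Qed.

Lemma cont_opp {U : UniformSpace} (f : U -> R) (x : U) :
  continuous f x -> continuous (fun y => - f y) x.
Proof. apply (continuous_opp (V := R_NormedModule)). Qed.

Lemma cont_mult {U : UniformSpace} (f g : U -> R) (x : U) :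
  continuous f x -> continuous g x -> continuous (fun y => f y * g y) x.
Proof. apply (continuous_mult (K := R_AbsRing)). Qed.

Lemma cont_refl (f : R -> R) (t x : R) :
  (forall x, continuous f x) -> continuous (fun v => f (t - v)) x.
Proof.
intros H; apply (continuous_comp (fun v => t - v) f); auto.
apply cont_minus; [apply continuous_const|apply continuous_id].
Qed.

Lemma cont_shift (f : R -> R) (t x : R) :
  (forall x, continuous f x) -> continuous (fun u => f (u - t)) x.
Proof.
intros H; apply (continuous_comp (fun u => u - t) f); auto.
apply cont_minus; [apply continuous_id|apply continuous_const].
Qed.

Ltac cont := lazymatch goal with
  | |- continuous (fun _ => ?k) _ => apply continuous_const
  | |- continuous (fun x => x) _ => apply continuous_id
  | |- continuous (fun x => fst x) _ => apply continuous_fst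
  | |- continuous (fun x => snd x) _ => apply continuous_snd
  | |- continuous (fun x => @?f x + @?g x) _ => apply (cont_plus f g); cont
  | |- continuous (fun x => @?f x - @?g x) _ => apply (cont_minus f g); cont
  | |- continuous (fun x => @?f x * @?g x) _ => apply (cont_mult f g); cont
  | |- continuous (fun x => - @?f x) _ => apply (cont_opp f); cont
  | |- continuous (fun x => ?f (?t - x)) _ => apply (cont_refl f t); solve [auto]
  | |- continuous (fun x => ?f (x - ?t)) _ => apply (cont_shift f t); solve [auto]
  | |- _ => try solve [auto]
  end.

Lemma derive_cont (f : R -> R) (x l : R) : is_derive f x l -> continuous f x.
Proof.
intros H; apply (ex_derive_continuous (K := R_AbsRing) (V := R_NormedModule)); eexists; apply H.
Qed.

Lemma deriv_plus (f g : R -> R) (x df dg : R) :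
  is_derive f x df -> is_derive g x dg -> is_derive (fun y => f y + g y) x (df + dg).
Proof. apply (is_derive_plus (K := R_AbsRing) (V := R_NormedModule)). Qed.

Lemma deriv_minus (f g : R -> R) (x df dg : R) :
  is_derive f x df -> is_derive g x dg -> is_derive (fun y => f y - g y) x (df - dg).
Proof. apply (is_derive_minus (K := R_AbsRing) (V := R_NormedModule)). Qed.

Lemma deriv_opp (f : R -> R) (x df : R) : is_derive f x df -> is_derive (fun y => - f y) x (- df).
Proof. apply (is_derive_opp (K := R_AbsRing) (V := R_NormedModule)). Qed.

Lemma deriv_mult (f g : R -> R) (x df dg : R) : is_derive f x df -> is_derive g x dg ->
  is_derive (fun y => f y * g y) x (df * g x + f x * dg).
Proof.
intros Hf Hg; apply (is_derive_mult (K := R_AbsRing) f g x df dg Hf Hg); intros; apply Rmult_comm.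
Qed.

Lemma deriv_comp (f g : R -> R) (x df dg : R) :
  is_derive f (g x) df -> is_derive g x dg -> is_derive (fun y => f (g y)) x (dg * df).
Proof. apply (is_derive_comp (K := R_AbsRing) (V := R_NormedModule)). Qed.

Lemma ex_RInt_cont (f : R -> R) (a b : R) : (forall x, continuous f x) -> ex_RInt f a b.
Proof. intros H; apply (ex_RInt_continuous (V := R_CompleteNormedModule)); auto. Qed.

Lemma ex_RInt_closed (f : R -> R) (a b : R) : a <= b ->
  (forall x, a <= x <= b -> continuous f x) -> ex_RInt f a b.
Proof.
intros ab Hc. apply (ex_RInt_continuous (V := R_CompleteNormedModule)); intros x;
 rewrite Rmin_left, Rmax_right by auto; auto.
Qed.

Lemma RInt_Rplus (f g : R -> R) (a b : R) : ex_RInt f a b -> ex_RInt g a b ->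
  RInt (fun x => f x + g x) a b = RInt f a b + RInt g a b.
Proof. apply (RInt_plus (V := R_CompleteNormedModule)). Qed.

Lemma RInt_Rminus (f g : R -> R) (a b : R) : ex_RInt f a b -> ex_RInt g a b ->
  RInt (fun x => f x - g x) a b = RInt f a b - RInt g a b.
Proof. apply (RInt_minus (V := R_CompleteNormedModule)). Qed.

Lemma ex_RInt_Rminus (f g : R -> R) (a b : R) : ex_RInt f a b -> ex_RInt g a b ->
  ex_RInt (fun x => f x - g x) a b.
Proof. apply (ex_RInt_minus (V := R_NormedModule)). Qed.

Lemma RInt_Ropp (f : R -> R) (a b : R) : ex_RInt f a b ->
  RInt (fun x => - f x) a b = - RInt f a b.
Proof. apply (RInt_opp (V := R_CompleteNormedModule)). Qed.

Lemma RInt_Rscal (k : R) (f : R -> R) (a b : R) : ex_RInt f a b ->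
  RInt (fun x => k * f x) a b = k * RInt f a b.
Proof. apply (RInt_scal (V := R_CompleteNormedModule)). Qed.

Lemma RInt_Rconst (k a b : R) : RInt (fun _ => k) a b = (b - a) * k.
Proof. exact (RInt_const (V := R_CompleteNormedModule) a b k). Qed.

Lemma RInt_pt (f : R -> R) (a : R) : RInt f a a = 0.
Proof. exact (RInt_point (V := R_CompleteNormedModule) a f). Qed.

Lemma RInt_split (f : R -> R) (a b c : R) : ex_RInt f a b -> ex_RInt f b c ->
  RInt f a b + RInt f b c = RInt f a c.
Proof. apply (RInt_Chasles (V := R_CompleteNormedModule)). Qed.

(** The derivative is required two-sidedly at the end points: every integrand
    below extends past the interval of integration. *)
Lemma ftc (f df : R -> R) (a b : R) : a <= b ->
  (forall x, a <= x <= b -> is_derive f x (df x)) ->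
  (forall x, a <= x <= b -> continuous df x) -> RInt df a b = f b - f a.
Proof.
intros ab Hd Hc. apply (is_RInt_unique (V := R_CompleteNormedModule)).
apply (is_RInt_derive (V := R_CompleteNormedModule)); intros x;
 rewrite Rmin_left, Rmax_right by auto; auto.
Qed.

Lemma ex_RInt_ext_le (f g : R -> R) (a b : R) :
  a <= b -> (forall x, a < x < b -> f x = g x) -> ex_RInt f a b -> ex_RInt g a b.
Proof. intros ab H; apply ex_RInt_ext; intros x; rewrite Rmin_left, Rmax_right; auto. Qed.

Lemma RInt_ext_le (f g : R -> R) (a b : R) :
  a <= b -> (forall x, a < x < b -> f x = g x) -> RInt f a b = RInt g a b.
Proof. intros ab H; apply RInt_ext; intros x; rewrite Rmin_left, Rmax_right; auto. Qed.

Lemma RInt_zero (f : R -> R) (a b : R) :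
  a <= b -> (forall x, a < x < b -> f x = 0) -> RInt f a b = 0.
Proof. intros ab H. rewrite (RInt_ext_le f (fun _ => 0)), RInt_Rconst by auto. rring. Qed.

Lemma abs_RInt_le_fun (f g : R -> R) (a b : R) :
  a <= b -> ex_RInt f a b -> ex_RInt g a b ->
  (forall x, a < x < b -> Rabs (f x) <= g x) -> Rabs (RInt f a b) <= RInt g a b.
Proof.
intros ab Hf Hg Hle.
assert (H : forall x, a < x < b -> - g x <= f x <= g x) by (intros; now apply Rabs_le_between, Hle).
apply Rabs_le; split; [rewrite <- RInt_Ropp by auto|]; apply RInt_le; auto; try (intros; now apply H).
now apply (ex_RInt_opp (V := R_NormedModule)).
Qed.

Lemma cont_pt (f : R -> R) (x : R) : continuous f x <-> continuity_pt f x.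
Proof. split; apply continuity_pt_filterlim. Qed.

Lemma ball_R (x e y : R) : ball x e y <-> Rabs (y - x) < e.
Proof. unfold ball; simpl; unfold AbsRing_ball, abs, minus, plus, opp; simpl; tauto. Qed.

Lemma ball_Rabs (x e y : R) : ball x e y -> Rabs (y - x) < e.
Proof. exact (proj1 (ball_R x e y)). Qed.

Lemma locally_gt (t s : R) : t < s -> locally s (fun u => t < u).
Proof.
intros H. assert (Hd : 0 < s - t) by lra. exists (mkposreal _ Hd). intros y Hy.
apply ball_Rabs, Rabs_lt_between in Hy; simpl in Hy; lra.
Qed.

Lemma lip_continuous (f : R -> R) (l : R) :
  (forall x y, Rabs (f x - f y) <= l * Rabs (x - y)) -> forall x, continuous f x.
Proof.
intros H x P [e He].
assert (Hl : 0 < Rabs l + 1) by (generalize (Rabs_pos l); lra).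
assert (Hd : 0 < e / (Rabs l + 1)) by (apply Rdiv_lt_0_compat; [apply cond_pos|auto]).
exists (mkposreal _ Hd); intros y Hy; apply He, (proj2 (ball_R _ _ _)).
apply ball_Rabs in Hy; simpl in Hy.
eapply Rle_lt_trans; [apply H|].
apply Rle_lt_trans with ((Rabs l + 1) * Rabs (y - x)).
- apply Rmult_le_compat_r; [apply Rabs_pos|]. generalize (Rle_abs l); lra.
- apply (Rmult_lt_compat_l (Rabs l + 1)) in Hy; auto.
  replace ((Rabs l + 1) * (e / (Rabs l + 1))) with (e : R) in Hy by (field; lra). auto.
Qed.

Lemma continuous_Rmax (a x : R) : continuous (fun y => Rmax a y) x.
Proof.
apply (lip_continuous _ 1); intros u v.
unfold Rmax; repeat destruct Rle_dec; unfold Rabs; repeat destruct Rcase_abs; lra.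
Qed.

Definition clamp (a b x : R) : R := Rmax a (Rmin b x).

Lemma clamp_in (a b x : R) : a <= b -> a <= clamp a b x <= b.
Proof. intros H; unfold clamp, Rmax, Rmin; repeat destruct Rle_dec; lra. Qed.

Lemma clamp_id (a b x : R) : a <= x <= b -> clamp a b x = x.
Proof. intros H; unfold clamp, Rmax, Rmin; repeat destruct Rle_dec; lra. Qed.

Lemma clamp_lip (a b x y : R) : Rabs (clamp a b x - clamp a b y) <= Rabs (x - y).
Proof.
unfold clamp, Rmax, Rmin; repeat destruct Rle_dec;
 unfold Rabs; repeat destruct Rcase_abs; lra.
Qed.

Lemma continuous_clamp (a b x : R) : continuous (clamp a b) x.
Proof. apply (lip_continuous _ 1); intros u v. rewrite Rmult_1_l. apply clamp_lip. Qed.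

Lemma clamp_mono (a b x y : R) : x <= y -> clamp a b x <= clamp a b y.
Proof. intros H; unfold clamp, Rmax, Rmin; repeat destruct Rle_dec; lra. Qed.

(** ** Continuity on a set *)

(** Composing with a retraction onto the set turns continuity on the set into
    plain continuity, to which the integration lemmas apply. *)
Lemma continuous_on_comp {T U V : UniformSpace} (D : U -> Prop) (g : T -> U) (f : U -> V) (x : T) :
  continuous_on D f -> (forall y, D (g y)) -> continuous g x ->
  continuous (fun y => f (g y)) x.
Proof.
intros Hf HD Hg P HP.
specialize (Hg _ (Hf (g x) (HD x) P HP)). unfold filtermap in *.
eapply filter_imp; [|apply Hg]; simpl; intros y Hy; apply Hy, HD.
Qed.

Lemma continuous_on_clamp (f : R -> R) (a b x : R) :
  a <= b -> continuous_on (fun u => a <= u <= b) f ->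
  continuous (fun u => f (clamp a b u)) x.
Proof.
intros ab Hf; apply (continuous_on_comp (fun u => a <= u <= b) (clamp a b) f); auto.
- intros y; now apply clamp_in.
- apply continuous_clamp.
Qed.

Lemma continuous_on_Rmax (f : R -> R) (x : R) :
  continuous_on (fun u => 0 <= u) f -> continuous (fun u => f (Rmax 0 u)) x.
Proof.
intros Hf; apply (continuous_on_comp (fun u => 0 <= u) (fun u => Rmax 0 u) f); auto.
- intros y; apply Rmax_l.
- apply continuous_Rmax.
Qed.

Lemma ex_RInt_on (f : R -> R) (a b : R) :
  a <= b -> continuous_on (fun u => a <= u <= b) f -> ex_RInt f a b.
Proof.
intros ab Hf.
apply (ex_RInt_ext_le (fun u => f (clamp a b u))); auto.
- intros x Hx; rewrite clamp_id; auto; lra.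
- apply ex_RInt_cont; intros x; now apply continuous_on_clamp.
Qed.

Lemma continuous_on_mult {T : UniformSpace} (D : T -> Prop) (f g : T -> R) :
  continuous_on D f -> continuous_on D g -> continuous_on D (fun x => f x * g x).
Proof.
intros Hf Hg x Dx.
apply (filterlim_comp_2 (G := locally (f x)) (H := locally (g x)) _ _ Rmult); auto.
apply (filterlim_mult (K := R_AbsRing)).
Qed.

Lemma continuous_on_plus {T : UniformSpace} (D : T -> Prop) (f g : T -> R) :
  continuous_on D f -> continuous_on D g -> continuous_on D (fun x => f x + g x).
Proof.
intros Hf Hg x Dx.
apply (filterlim_comp_2 (G := locally (f x)) (H := locally (g x)) _ _ Rplus); auto.
apply (filterlim_plus (K := R_AbsRing) (V := R_NormedModule)).
Qed.

Lemma continuous_on_const {T : UniformSpace} (D : T -> Prop) (k : R) :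
  continuous_on D (fun _ => k).
Proof. apply continuous_on_forall; intros; apply continuous_const. Qed.

Lemma continuous_on_opp {T : UniformSpace} (D : T -> Prop) (f : T -> R) :
  continuous_on D f -> continuous_on D (fun x => - f x).
Proof.
intros Hf. apply (continuous_on_ext _ (fun x => (-1) * f x)); [intros; rring|].
apply continuous_on_mult; [apply continuous_on_const|auto].
Qed.

Lemma continuous_on_minus {T : UniformSpace} (D : T -> Prop) (f g : T -> R) :
  continuous_on D f -> continuous_on D g -> continuous_on D (fun x => f x - g x).
Proof. intros Hf Hg. apply continuous_on_plus; auto. now apply continuous_on_opp. Qed.

Lemma continuous_on_comp_r {T : UniformSpace} (D : T -> Prop) (f : T -> R) (g : R -> R) :
  continuous_on D f -> (forall x, D x -> continuous g (f x)) ->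
  continuous_on D (fun x => g (f x)).
Proof.
intros Hf Hg x Dx.
eapply filterlim_comp; [apply Hf, Dx | apply (Hg x Dx)].
Qed.

Lemma continuous_on_comp_l {T U V : UniformSpace} (E : T -> Prop) (D : U -> Prop)
  (g : T -> U) (f : U -> V) :
  continuous_on D f -> (forall x, E x -> D (g x)) -> (forall x, continuous g x) ->
  continuous_on E (fun x => f (g x)).
Proof.
intros Hf HD Hg x Ex P HP.
specialize (Hf (g x) (HD x Ex) P HP).
unfold filtermap, within in *.
specialize (Hg x _ Hf). unfold filtermap in *.
eapply filter_imp; [|apply Hg]; simpl; intros y Hy Ey; apply Hy, HD, Ey.
Qed.

Lemma continuous_pair_l (t s : R) : continuous (fun u : R => (u, t)) s.
Proof.
intros P [e He]. exists e. intros y Hy. apply He. split; [exact Hy|apply ball_center].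
Qed.

Lemma continuous_pair_r (t s : R) : continuous (fun u : R => (t, u)) s.
Proof.
intros P [e He]. exists e. intros y Hy. apply He. split; [apply ball_center|exact Hy].
Qed.

Lemma bounded_on (f : R -> R) (a b : R) :
  a <= b -> continuous_on (fun t => a <= t <= b) f ->
  exists B, 0 <= B /\ forall t, a <= t <= b -> Rabs (f t) <= B.
Proof.
intros ab Hf.
destruct (continuity_ab_maj (fun t => Rabs (f (clamp a b t))) a b ab) as [m [Hm _]].
- intros c _; apply cont_pt.
  apply (continuous_comp (fun t => f (clamp a b t)) Rabs).
  + now apply continuous_on_clamp.
  + apply (continuous_abs (K := R_AbsRing)).
- eexists; split; [apply Rabs_pos|]. intros t Ht.
  eapply Rle_trans; [|apply (Hm t Ht)]. rewrite clamp_id; auto. lra.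
Qed.

(** ** Mean value inequalities *)

Lemma mvt_le (f : R -> R) (df : R -> R) (a b : R) :
  a <= b -> continuous_on (fun x => a <= x <= b) f ->
  (forall x, a < x < b -> is_derive f x (df x)) ->
  (forall x, a < x < b -> df x <= 0) -> f b <= f a.
Proof.
intros ab Hc Hd Hn.
destruct (Req_dec a b) as [->|ne]; [lra|].
destruct (MVT_gen (fun u => f (clamp a b u)) a b
   (fun x => Rmin 0 (df x))) as [c [Hc1 Hc2]].
- intros x; rewrite Rmin_left, Rmax_right by lra; intros Hx.
  rewrite Rmin_right by now apply Hn.
  eapply is_derive_ext_loc; [|apply (Hd x Hx)].
  assert (He : 0 < Rmin (x - a) (b - x)) by (apply Rmin_pos; lra).
  exists (mkposreal _ He); intros y Hy.
  rewrite clamp_id; auto.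
  apply ball_Rabs, Rabs_lt_between in Hy; simpl in Hy.
  generalize (Rmin_l (x-a) (b-x)) (Rmin_r (x-a) (b-x)); lra.
- intros x _; apply cont_pt, continuous_on_clamp; auto.
- rewrite !clamp_id in Hc2 by lra.
  generalize (Rmin_l 0 (df c)); nra.
Qed.

Lemma mvt_abs (f g : R -> R) (df dg : R -> R) (a b : R) :
  a <= b -> continuous_on (fun x => a <= x <= b) f ->
  continuous_on (fun x => a <= x <= b) g ->
  (forall x, a < x < b -> is_derive f x (df x)) ->
  (forall x, a < x < b -> is_derive g x (dg x)) ->
  (forall x, a < x < b -> Rabs (df x) <= dg x) ->
  Rabs (f b - f a) <= g b - g a.
Proof.
intros ab Hf Hg Hdf Hdg Hle.
assert (Hle' : forall x, a < x < b -> - dg x <= df x <= dg x) by (intros; now apply Rabs_le_between, Hle).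
assert (H1 : f b - g b <= f a - g a).
{ apply (mvt_le (fun x => f x - g x) (fun x => df x - dg x)); auto.
  - now apply continuous_on_minus.
  - intros; apply deriv_minus; auto.
  - intros x Hx; specialize (Hle' x Hx); lra. }
assert (H2 : - f b - g b <= - f a - g a).
{ apply (mvt_le (fun x => - f x - g x) (fun x => - df x - dg x)); auto.
  - apply continuous_on_minus; auto. now apply continuous_on_opp.
  - intros; apply deriv_minus; auto. apply deriv_opp; auto.
  - intros x Hx; specialize (Hle' x Hx); lra. }
apply Rabs_le; lra.
Qed.

Lemma lip_on (f f' : R -> R) (a b : R) :
  a <= b -> (forall x, a <= x <= b -> is_derive f x (f' x)) ->
  (forall x, a <= x <= b -> continuous f' x) ->
  exists l, 0 <= l /\ forall x y, a <= x <= b -> a <= y <= b ->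
    Rabs (f x - f y) <= l * Rabs (x - y).
Proof.
intros ab Hd Hc.
destruct (bounded_on f' a b ab) as [l [Hl Hb]]; [now apply continuous_on_forall|].
exists l; split; auto.
assert (W : forall x y, a <= x <= b -> a <= y <= b -> x <= y ->
  Rabs (f y - f x) <= l * Rabs (y - x)).
{ intros x y Hx Hy Hxy.
  replace (l * Rabs (y - x)) with (l * y - l * x) by (rewrite Rabs_right; lra).
  apply (mvt_abs f (fun z => l * z) f' (fun _ => l)); auto.
  - apply continuous_on_forall; intros z Hz. eapply derive_cont, Hd; lra.
  - apply continuous_on_forall; intros; cont.
  - intros z Hz; apply Hd; lra.
  - intros z Hz; auto_derive; auto; ring.
  - intros z Hz; apply Hb; lra. }
intros x y Hx Hy. destruct (Rle_dec x y).
- rewrite (Rabs_minus_sym (f x)), (Rabs_minus_sym x). now apply W.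
- apply W; auto; lra.
Qed.

(** ** Primitives and convolutions *)

Lemma is_derive_primitive (f : R -> R) (t : R) :
  (forall x, continuous f x) -> is_derive (fun t => RInt f 0 t) t (f t).
Proof.
intros Hf; apply (is_derive_RInt (V := R_NormedModule) f _ 0); auto.
exists (mkposreal 1 Rlt_0_1); intros y _.
apply (RInt_correct (V := R_CompleteNormedModule)); now apply ex_RInt_cont.
Qed.

Lemma continuous_primitive (f : R -> R) (t : R) :
  (forall x, continuous f x) -> continuous (fun t => RInt f 0 t) t.
Proof. intros Hf; eapply derive_cont, is_derive_primitive, Hf. Qed.

Lemma RInt_reflect (F : R -> R) (s t : R) : ex_RInt F 0 (s - t) ->
  RInt (fun u => F (s - u)) t s = RInt F 0 (s - t).
Proof.
intros HF. apply (is_RInt_unique (V := R_CompleteNormedModule)).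
apply (is_RInt_ext (fun y => - (scal (-1) (F (-1 * y + s))))).
{ intros x _. unfold scal; simpl; unfold mult; simpl.
  replace (-1 * x + s) with (s - x) by ring. ring. }
replace (RInt F 0 (s - t)) with (- RInt F (s - t) 0)
  by (apply (opp_RInt_swap (V := R_CompleteNormedModule)), ex_RInt_swap; auto).
apply (is_RInt_opp (V := R_NormedModule)), (is_RInt_comp_lin (V := R_NormedModule) F (-1) s t s).
replace (-1 * t + s) with (s - t) by ring. replace (-1 * s + s) with 0 by ring.
apply (RInt_correct (V := R_CompleteNormedModule)). now apply ex_RInt_swap.
Qed.

Definition conv (f g : R -> R) (t : R) : R := RInt (fun v => f v * g (t - v)) 0 t.

Lemma ex_RInt_conv (f g : R -> R) (t a b : R) :
  (forall x, continuous f x) -> (forall x, continuous g x) ->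
  ex_RInt (fun v => f v * g (t - v)) a b.
Proof. intros Hf Hg; apply ex_RInt_cont; intros; cont. Qed.

Lemma conv_comm (f g : R -> R) (t : R) :
  (forall x, continuous f x) -> (forall x, continuous g x) -> conv f g t = conv g f t.
Proof.
intros Hf Hg; unfold conv.
pose proof (RInt_reflect (fun v => f v * g (t - v)) t 0) as H.
rewrite Rminus_0_r in H. rewrite <- H by now apply ex_RInt_conv.
apply RInt_ext; intros x _. replace (t - (t - x)) with x by ring. rring.
Qed.

Lemma continuous_RInt_param (F : R -> R -> R) (x : R) :
  (forall y u, continuous (fun z : R * R => F (fst z) (snd z)) (y, u)) ->
  continuous (fun y => RInt (fun u => F y u) 0 1) x.
Proof.
intros HF.
assert (Hex : forall y, ex_RInt (fun u => F y u) 0 1).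
{ intros y; apply ex_RInt_cont; intros u.
  apply (continuous_comp (fun u => (y, u)) (fun z => F (fst z) (snd z))).
  apply continuous_pair_r. apply HF. }
intros P [e He].
assert (He2 : 0 < e / 2) by (generalize (cond_pos e); lra).
destruct (uniform_continuity_2d_1d' F 0 1 x
  (fun u _ => proj2 (continuity_2d_pt_filterlim F x u) (HF x u)) (mkposreal _ He2)) as [d Hd].
exists d; intros y Hy; apply He, (proj2 (ball_R _ _ _)). apply ball_Rabs in Hy.
rewrite <- RInt_Rminus by auto.
eapply Rle_lt_trans with ((1 - 0) * (e / 2)); [|generalize (cond_pos e); lra].
apply abs_RInt_le_const; [lra|now apply ex_RInt_Rminus|].
assert (Hdp := cond_pos d). apply Rabs_lt_between in Hy.
intros t Ht. apply Rlt_le, (Hd t x t y); auto; try lra.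
rewrite Rminus_diag, Rabs_R0; auto.
Qed.

(** Rescaling to a fixed interval reduces this to an integral with a parameter. *)
Lemma continuous_conv (f g : R -> R) (t : R) :
  (forall x, continuous f x) -> (forall x, continuous g x) ->
  continuous (conv f g) t.
Proof.
intros Hf Hg.
assert (E : forall s : R,
  RInt (fun u => s * (f (s * u) * g (s * (1 - u)))) 0 1 = conv f g s).
{ intros s; unfold conv.
  pose proof (RInt_comp_lin (V := R_CompleteNormedModule) (fun v => f v * g (s - v)) s 0 0 1) as H.
  replace (s * 0 + 0) with 0 in H by rring. replace (s * 1 + 0) with s in H by ring.
  rewrite <- H by now apply ex_RInt_conv.
  apply RInt_ext; intros x _; unfold scal; simpl; unfold mult; simpl.
  replace (s * x + 0) with (s * x) by ring.
  now replace (s - s * x) with (s * (1 - x)) by ring. }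
apply (continuous_ext _ _ _ E).
apply (continuous_RInt_param (fun t u => t * (f (t * u) * g (t * (1 - u))))).
intros y u.
change (continuous (fun z : R * R => fst z * (f (fst z * snd z) * g (fst z * (1 - snd z)))) (y, u)).
cont.
- apply (continuous_comp (fun z : R * R => fst z * snd z) f); [cont|auto].
- apply (continuous_comp (fun z : R * R => fst z * (1 - snd z)) g); [cont|auto].
Qed.

Lemma is_derive_conv (f f' g : R -> R) (t : R) :
  (forall x, is_derive f x (f' x)) -> (forall x, continuous f' x) ->
  (forall x, continuous g x) ->
  is_derive (conv g f) t (conv g f' t + g t * f 0).
Proof.
intros Hf Hf' Hg.
assert (Cf : forall x, continuous f x) by (intros; eapply derive_cont, Hf).
assert (HD : forall u v, is_derive (fun z => g v * f (z - v)) u (g v * f' (u - v))).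
{ intros u v. apply is_derive_scal.
  replace (f' (u - v)) with (1 * f' (u - v)) by ring.
  apply (deriv_comp f (fun z => z - v)); auto. auto_derive; auto. }
assert (HC : forall x y, continuity_2d_pt
   (fun u v => Derive (fun z => g v * f (z - v)) u) x y).
{ intros x y; apply continuity_2d_pt_filterlim.
  apply (continuous_ext (fun z : R * R => g (snd z) * f' (fst z - snd z))).
  { intros z; symmetry; apply is_derive_unique, HD. }
  apply cont_mult.
  - apply (continuous_comp (fun z : R * R => snd z) g); [cont|auto].
  - apply (continuous_comp (fun z : R * R => fst z - snd z) f'); [cont|auto]. }
assert (HL : forall P : R -> Prop, (forall x, P x) -> locally t P).
{ intros P HP; exists (mkposreal 1 Rlt_0_1); intros; apply HP. }
evar_last.
- unfold conv.
  apply (is_derive_RInt_param_bound_comp_aux3 (fun t v => g v * f (t - v)) 0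
     (fun t => t) t 1).
  + apply HL; intros x; now apply ex_RInt_conv.
  + exists (mkposreal 1 Rlt_0_1); apply HL; intros x; now apply ex_RInt_conv.
  + apply (is_derive_id (K := R_AbsRing)).
  + exists (mkposreal 1 Rlt_0_1); apply HL; intros x v _; eexists; apply HD.
  + intros v _; apply HC.
  + exists (mkposreal 1 Rlt_0_1); intros; apply HC.
  + apply cont_pt; cont.
- simpl. replace (t - t) with 0 by ring. unfold conv.
  rewrite Rmult_1_r. f_equal. apply RInt_ext; intros v _.
  apply is_derive_unique, HD.
Qed.

(** * A Volterra equation with a history-dependent kernel *)

Lemma exp_ge_1 (x : R) : 0 <= x -> 1 <= exp x.
Proof.
intros [H| <-]; [left|right; now rewrite exp_0].
rewrite <- exp_0; now apply exp_increasing.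
Qed.

Lemma exp_le (x y : R) : x <= y -> exp x <= exp y.
Proof. intros [H| ->]; [left; now apply exp_increasing|lra]. Qed.

Lemma continuous_exp_scal (a k x : R) : continuous (fun v => a * exp (k * v)) x.
Proof.
apply (ex_derive_continuous (K := R_AbsRing) (V := R_NormedModule)); auto_derive; auto.
Qed.

Lemma RInt_exp (a k t : R) : k <> 0 ->
  RInt (fun v => a * exp (k * v)) 0 t = a * ((exp (k * t) - 1) / k).
Proof.
intros Hk.
assert (H : is_RInt (fun v => a * exp (k * v)) 0 t
  (minus (a * (exp (k * t) / k)) (a * (exp (k * 0) / k)))).
{ apply (is_RInt_derive (V := R_CompleteNormedModule) (fun v => a * (exp (k * v) / k))).
  - intros x _; auto_derive; auto; now field.
  - intros x _; apply continuous_exp_scal. }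
apply (is_RInt_unique (V := R_CompleteNormedModule)) in H. rewrite H.
unfold minus, plus, opp; simpl; rewrite Rmult_0_r, exp_0; now field.
Qed.

Lemma le_geom_0 (x S : R) : (forall n, x <= S * (1 / 2) ^ n) -> x <= 0.
Proof.
intros H.
apply (is_lim_seq_le (fun _ => x) (fun n => S * (1 / 2) ^ n) x 0 H).
- apply is_lim_seq_const.
- replace (Finite 0) with (Rbar_mult S 0) by (simpl; now rewrite Rmult_0_r).
  apply is_lim_seq_scal_l, is_lim_seq_geom. rewrite Rabs_right; lra.
Qed.

Lemma eq_of_geom (x y S : R) : (forall n, Rabs (x - y) <= S * (1 / 2) ^ n) -> x = y.
Proof.
intros H. apply le_geom_0 in H. generalize (Rabs_pos (x - y)); intros.
apply Rminus_diag_uniq, Rabs_eq_0; lra.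
Qed.

Lemma pow_half_small (e : R) : 0 < e -> exists N, (1 / 2) ^ N < e.
Proof.
intros He. destruct (pow_lt_1_zero (1/2)) with (y := e) as [N HN]; auto.
{ rewrite Rabs_right; lra. }
exists N. specialize (HN N (Nat.le_refl _)). rewrite Rabs_right in HN; auto.
apply Rle_ge, pow_le; lra.
Qed.

Lemma pow_half_pos (n : nat) : 0 < (1 / 2) ^ n.
Proof. apply pow_lt; lra. Qed.

(** The FDT equation for [c] reads [h = volt Phi h] in terms of [h = - c'] and
    [c = 1 - RInt h 0], with [Phi] the coupling.  Times are cut at 0 so that
    iterates are continuous on the whole line. *)
Definition volt (Phi h : R -> R) (t : R) : R :=
  1 / 2 - conv (fun v => Phi (1 - RInt h 0 v)) h (Rmax 0 t).

Lemma continuous_kernel (Phi h : R -> R) (x : R) :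
  (forall x, continuous Phi x) -> (forall x, continuous h x) ->
  continuous (fun v => Phi (1 - RInt h 0 v)) x.
Proof.
intros HP Hh. apply (continuous_comp (fun v => 1 - RInt h 0 v) Phi); auto.
apply cont_minus; [apply continuous_const|now apply continuous_primitive].
Qed.

Lemma continuous_volt (Phi h : R -> R) (x : R) :
  (forall x, continuous Phi x) -> (forall x, continuous h x) ->
  continuous (volt Phi h) x.
Proof.
intros HP Hh. apply cont_minus; [apply continuous_const|].
apply (continuous_comp (fun t => Rmax 0 t) (conv (fun v => Phi (1 - RInt h 0 v)) h));
 [apply continuous_Rmax|].
apply continuous_conv; auto. intros; now apply continuous_kernel.
Qed.

(** [volt] contracts by 1/2 in the weighted norm [sup |h(t)| exp (- L t)]: each
    of the two terms of the difference carries a time integral of the weight,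
    hence a factor [1 / L]. *)
Lemma volt_contract (Phi h1 h2 : R -> R) (K Lam B L S T : R) :
  (forall x, Rabs (Phi x) <= K) ->
  (forall x y, Rabs (Phi x - Phi y) <= Lam * Rabs (x - y)) ->
  0 <= B -> 0 <= Lam -> 0 <= S -> 1 <= L -> 2 * (K + Lam * B) <= L ->
  (forall x, continuous h1 x) -> (forall x, continuous h2 x) ->
  (forall t, 0 <= t <= T -> Rabs (h2 t) <= B) ->
  (forall t, 0 <= t <= T -> Rabs (h1 t - h2 t) <= S * exp (L * t)) ->
  forall t, 0 <= t <= T ->
  Rabs (volt Phi h1 t - volt Phi h2 t) <= S / 2 * exp (L * t).
Proof.
intros HK HL HB HLam HS HL1 HL2 C1 C2 Hb Hd t Ht.
assert (K0 : 0 <= K) by (eapply Rle_trans; [apply Rabs_pos|apply (HK 0)]).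
pose proof (lip_continuous _ _ HL) as CP.
unfold volt; rewrite Rmax_right by lra.
replace (_ - _) with (- (conv (fun v => Phi (1 - RInt h1 0 v)) h1 t -
   conv (fun v => Phi (1 - RInt h2 0 v)) h2 t)) by ring.
rewrite Rabs_Ropp; unfold conv.
assert (Ex : forall h, (forall x, continuous h x) ->
  ex_RInt (fun v => Phi (1 - RInt h 0 v) * h (t - v)) 0 t).
{ intros h Ch. apply (ex_RInt_conv (fun v => Phi (1 - RInt h 0 v)) h); auto.
  intros; now apply continuous_kernel. }
rewrite <- RInt_Rminus by auto.
assert (Hprim : forall v, 0 <= v <= t ->
   Rabs (RInt h1 0 v - RInt h2 0 v) <= S / L * exp (L * v)).
{ intros v Hv. rewrite <- RInt_Rminus by now apply ex_RInt_cont.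
  eapply Rle_trans.
  - apply (abs_RInt_le_fun _ (fun u => S * exp (L * u))); [lra| | |].
    + apply ex_RInt_Rminus; now apply ex_RInt_cont.
    + apply ex_RInt_cont, continuous_exp_scal.
    + intros x Hx; apply Hd; lra.
  - rewrite RInt_exp by lra. unfold Rdiv; rewrite <- Rmult_assoc.
    replace (S * / L * exp (L * v)) with (S * exp (L * v) * / L) by ring.
    apply Rmult_le_compat_r; [left; apply Rinv_0_lt_compat|]; lra. }
eapply Rle_trans.
- apply (abs_RInt_le_fun _ (fun v => K * S * exp (L * t) * exp (- L * v) +
     Lam * B * (S / L) * exp (L * v))); [lra| | |].
  + now apply ex_RInt_Rminus; auto.
  + apply ex_RInt_cont; intros x. apply cont_plus; apply continuous_exp_scal.
  + intros v Hv.
    replace (_ - _) with (Phi (1 - RInt h1 0 v) * (h1 (t - v) - h2 (t - v)) +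
      (Phi (1 - RInt h1 0 v) - Phi (1 - RInt h2 0 v)) * h2 (t - v)) by ring.
    eapply Rle_trans; [apply Rabs_triang|]. rewrite !Rabs_mult.
    apply Rplus_le_compat.
    * replace (K * S * exp (L * t) * exp (- L * v)) with (K * (S * exp (L * (t - v)))).
      2: { rewrite !Rmult_assoc, <- exp_plus. do 3 f_equal; ring. }
      apply Rmult_le_compat; try apply Rabs_pos; auto. apply Hd; lra.
    * replace (Lam * B * (S / L) * exp (L * v)) with (Lam * (S / L * exp (L * v)) * B) by ring.
      apply Rmult_le_compat; try apply Rabs_pos; [|apply Hb; lra].
      eapply Rle_trans; [apply HL|]. apply Rmult_le_compat_l; auto.
      replace (_ - _) with (- (RInt h1 0 v - RInt h2 0 v)) by ring.
      rewrite Rabs_Ropp; apply Hprim; lra.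
- rewrite RInt_Rplus by (apply ex_RInt_cont, continuous_exp_scal).
  rewrite !RInt_exp by lra.
  replace (- L * t) with (- (L * t)) by ring. rewrite exp_Ropp.
  assert (He1 : 1 <= exp (L * t)) by (apply exp_ge_1, Rmult_le_pos; lra).
  set (e := exp (L * t)) in *.
  assert (HiL : 0 < / L <= 1).
  { split. apply Rinv_0_lt_compat; lra. rewrite <- Rinv_1. apply Rinv_le_contravar; lra. }
  apply Rle_trans with (S * ((K + Lam * B) / L) * e).
  + replace (K * S * e * ((/ e - 1) / - L)) with (K * S * (e - 1) / L) by (field; lra).
    replace (S * ((K + Lam * B) / L) * e) with (K * S * e / L + Lam * B * S * e / L)
      by (field; lra).
    apply Rplus_le_compat.
    * unfold Rdiv; apply Rmult_le_compat_r; [lra|].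
      apply Rmult_le_compat_l; [|lra]. apply Rmult_le_pos; auto.
    * replace (Lam * B * (S / L) * ((e - 1) / L)) with ((Lam * B * S / L) * ((e - 1) * / L))
        by (field; lra).
      replace (Lam * B * S * e / L) with ((Lam * B * S / L) * e) by (field; lra).
      apply Rmult_le_compat_l; [unfold Rdiv; repeat apply Rmult_le_pos; auto; lra|nra].
  + replace (S / 2 * e) with (S * (1 / 2) * e) by field.
    apply Rmult_le_compat_r; [lra|]. apply Rmult_le_compat_l; auto.
    apply Rmult_le_reg_r with L; [lra|].
    replace ((K + Lam * B) / L * L) with (K + Lam * B) by (field; lra). lra.
Qed.

Lemma volt_unique (Phi h1 h2 : R -> R) (K Lam : R) :
  (forall x, Rabs (Phi x) <= K) ->
  (forall x y, Rabs (Phi x - Phi y) <= Lam * Rabs (x - y)) -> 0 <= Lam ->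
  (forall x, continuous h1 x) -> (forall x, continuous h2 x) ->
  (forall t, 0 <= t -> h1 t = volt Phi h1 t) ->
  (forall t, 0 <= t -> h2 t = volt Phi h2 t) ->
  forall t, 0 <= t -> h1 t = h2 t.
Proof.
intros HK HL HLam C1 C2 H1 H2 T HT.
assert (K0 : 0 <= K) by (eapply Rle_trans; [apply Rabs_pos|apply (HK 0)]).
destruct (bounded_on h2 0 T HT) as [B [HB0 HB]]; [now apply continuous_on_forall|].
destruct (bounded_on (fun t => h1 t - h2 t) 0 T HT) as [S0 [HS0 HS]].
{ apply continuous_on_forall; intros; cont. }
assert (HLB : 0 <= Lam * B) by now apply Rmult_le_pos.
set (L := 2 * (K + Lam * B) + 1).
assert (Hn : forall n t, 0 <= t <= T ->
   Rabs (h1 t - h2 t) <= S0 * (1 / 2) ^ n * exp (L * t)).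
{ induction n as [|n IH]; intros t Ht.
  - eapply Rle_trans; [now apply HS|]. simpl.
    assert (1 <= exp (L * t)) by (apply exp_ge_1, Rmult_le_pos; unfold L; lra). nra.
  - rewrite H1, H2 by lra.
    replace (S0 * (1 / 2) ^ S n) with (S0 * (1 / 2) ^ n / 2) by (simpl; field).
    apply (volt_contract Phi h1 h2 K Lam B L (S0 * (1/2) ^ n) T); auto; unfold L; try lra.
    apply Rmult_le_pos; auto. left; apply pow_half_pos. }
apply (eq_of_geom _ _ (S0 * exp (L * T))). intros n.
eapply Rle_trans; [apply (Hn n)|]; lra.
Qed.

Fixpoint picard (Phi : R -> R) (n : nat) : R -> R :=
  match n with
  | O => fun _ => 1 / 2
  | S n => volt Phi (picard Phi n)
  end.

(** The Picard iterates obey a common exponential bound, so that the contraction gives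
    uniform convergence on bounded intervals. *)
Lemma volt_exists (Phi : R -> R) (K Lam : R) :
  (forall x, Rabs (Phi x) <= K) -> 0 < K ->
  (forall x y, Rabs (Phi x - Phi y) <= Lam * Rabs (x - y)) -> 0 <= Lam ->
  exists h, (forall x, continuous h x) /\ (forall t, 0 <= t -> h t = volt Phi h t).
Proof.
intros HK K0 HL HLam.
pose proof (lip_continuous _ _ HL) as CP.
assert (Cp : forall n x, continuous (picard Phi n) x).
{ induction n; intros x; simpl; [apply continuous_const|now apply continuous_volt]. }
assert (Hneg : forall n t, picard Phi n t = picard Phi n (Rmax 0 t)).
{ intros [|n] t; simpl; auto. unfold volt. do 2 f_equal.
  unfold Rmax; repeat destruct Rle_dec; lra. }
(* exp (K t) / 2 solves the majorizing equation x = 1/2 + K * integral of x *)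
assert (Bp : forall n t, 0 <= t -> Rabs (picard Phi n t) <= 1 / 2 * exp (K * t)).
{ induction n as [|n IH]; intros t Ht.
  - simpl; rewrite Rabs_right by lra.
    assert (1 <= exp (K * t)) by (apply exp_ge_1; nra). lra.
  - simpl; unfold volt; rewrite Rmax_right by lra.
    eapply Rle_trans; [apply Rabs_triang|]. rewrite Rabs_Ropp, (Rabs_right (1/2)) by lra.
    assert (Ck : forall x, continuous (fun v => Phi (1 - RInt (picard Phi n) 0 v)) x)
      by (intros; now apply continuous_kernel).
    rewrite conv_comm by auto.
    assert (E : Rabs (conv (picard Phi n) (fun v => Phi (1 - RInt (picard Phi n) 0 v)) t)
       <= RInt (fun v => K / 2 * exp (K * v)) 0 t).
    { apply abs_RInt_le_fun; auto.
      - apply (ex_RInt_conv (picard Phi n) (fun v => Phi (1 - RInt (picard Phi n) 0 v))); auto.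
      - apply ex_RInt_cont, continuous_exp_scal.
      - intros v Hv; rewrite Rabs_mult, Rmult_comm.
        replace (K / 2 * exp (K * v)) with (K * (1 / 2 * exp (K * v))) by field.
        apply Rmult_le_compat; try apply Rabs_pos; auto. apply IH; lra. }
    rewrite RInt_exp in E by lra.
    replace (K / 2 * ((exp (K * t) - 1) / K)) with (1 / 2 * exp (K * t) - 1/2) in E
      by (field; lra). lra. }
assert (Hunif : forall T, 0 <= T -> exists M, 0 <= M /\ forall n m t, t <= T ->
   Rabs (picard Phi (m + n) t - picard Phi n t) <= M * (1 / 2) ^ n).
{ intros T HT. set (B := 1 / 2 * exp (K * T)).
  assert (HB0 : 0 <= B) by (unfold B; generalize (exp_pos (K * T)); lra).
  assert (HLB : 0 <= Lam * B) by now apply Rmult_le_pos.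
  assert (HBn : forall n t, 0 <= t <= T -> Rabs (picard Phi n t) <= B).
  { intros n t Ht; eapply Rle_trans; [apply Bp; lra|].
    apply Rmult_le_compat_l; [lra|]. apply exp_le; nra. }
  set (L := 2 * (K + Lam * B) + 1).
  assert (Hs : forall n t, 0 <= t <= T ->
     Rabs (picard Phi (S n) t - picard Phi n t) <= 2 * B * (1 / 2) ^ n * exp (L * t)).
  { induction n as [|n IH]; intros t Ht.
    - apply Rle_trans with (2 * B).
      + unfold Rminus; eapply Rle_trans; [apply Rabs_triang|].
        rewrite Rabs_Ropp; generalize (HBn 1%nat t Ht) (HBn 0%nat t Ht); lra.
      + assert (1 <= exp (L * t)) by (apply exp_ge_1, Rmult_le_pos; unfold L; lra).
        simpl; nra.
    - replace (2 * B * (1 / 2) ^ S n) with (2 * B * (1 / 2) ^ n / 2) by (simpl; field).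
      apply (volt_contract Phi (picard Phi (S n)) (picard Phi n) K Lam B L
        (2 * B * (1/2) ^ n) T); auto; unfold L; try lra.
      apply Rmult_le_pos; [lra|]. left; apply pow_half_pos. }
  exists (4 * B * exp (L * T)); split.
  { apply Rmult_le_pos; [lra|]. left; apply exp_pos. }
  assert (Hm : forall n m t, 0 <= t <= T ->
     Rabs (picard Phi (m + n) t - picard Phi n t) <=
       4 * B * exp (L * T) * ((1 / 2) ^ n - (1/2) ^ (m + n))).
  { intros n m t Ht; induction m as [|m IH].
    - simpl. rewrite !Rminus_diag, Rabs_R0. lra.
    - replace (picard Phi (S m + n) t - picard Phi n t) with
        ((picard Phi (S (m + n)) t - picard Phi (m + n) t) +
         (picard Phi (m + n) t - picard Phi n t)) by (simpl; ring).
      eapply Rle_trans; [apply Rabs_triang|].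
      specialize (Hs (m + n)%nat t Ht).
      assert (2 * B * (1 / 2) ^ (m + n) * exp (L * t) <=
        2 * B * (1 / 2) ^ (m + n) * exp (L * T)).
      { apply Rmult_le_compat_l; [apply Rmult_le_pos; [lra|left; apply pow_half_pos]|].
        apply exp_le, Rmult_le_compat_l; unfold L; lra. }
      replace (S m + n)%nat with (S (m + n)) by lia.
      rewrite <- (tech_pow_Rmult (1/2) (m + n)). lra. }
  intros n m t Ht. rewrite (Hneg (m + n)%nat t), (Hneg n t).
  eapply Rle_trans; [apply Hm; split; [apply Rmax_l|apply Rmax_lub; lra]|].
  apply Rmult_le_compat_l.
  - apply Rmult_le_pos; [lra|left; apply exp_pos].
  - generalize (pow_half_pos (m + n)); lra. }
set (h := fun t => real (Lim_seq (fun n => picard Phi n t))).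
assert (Hlim : forall T, 0 <= T -> exists M, 0 <= M /\ forall n t, t <= T ->
   Rabs (h t - picard Phi n t) <= M * (1 / 2) ^ n).
{ intros T HT. destruct (Hunif T HT) as [M [M0 HM]]. exists M; split; auto.
  intros n t Ht.
  assert (Hc : ex_finite_lim_seq (fun n => picard Phi n t)).
  { apply ex_lim_seq_cauchy_corr. intros e.
    destruct (pow_half_small (e / (M + 1) / 2)) as [N HN].
    { apply Rdiv_lt_0_compat; [|lra]; apply Rdiv_lt_0_compat; [apply cond_pos|lra]. }
    apply (Rmult_lt_compat_l (M + 1)) in HN; [|lra].
    replace ((M + 1) * (e / (M + 1) / 2)) with (e / 2) in HN by (field; lra).
    assert (HH : forall p, (N <= p)%nat -> Rabs (picard Phi p t - picard Phi N t) < e / 2).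
    { intros p Hp. replace p with ((p - N) + N)%nat by lia.
      eapply Rle_lt_trans; [now apply HM|]. generalize (pow_half_pos N); lra. }
    exists N; intros p q Hp Hq.
    replace (_ - _) with ((picard Phi p t - picard Phi N t) - (picard Phi q t - picard Phi N t))
      by ring.
    unfold Rminus at 1. eapply Rle_lt_trans; [apply Rabs_triang|]. rewrite Rabs_Ropp.
    generalize (HH p Hp) (HH q Hq); lra. }
  apply Lim_seq_correct' in Hc. fold (h t) in Hc.
  apply (is_lim_seq_le (fun m => Rabs (picard Phi (m + n) t - picard Phi n t))
    (fun _ => M * (1/2) ^ n) (Finite (Rabs (h t - picard Phi n t))) (Finite (M * (1/2) ^ n))).
  - intros m; now apply HM.
  - apply (is_lim_seq_abs _ (Finite (h t - picard Phi n t))).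
    apply (is_lim_seq_minus' _ _ (h t) (picard Phi n t)).
    + now apply -> (is_lim_seq_incr_n (fun m => picard Phi m t) n).
    + apply is_lim_seq_const.
  - apply is_lim_seq_const. }
assert (Ch : forall x, continuous h x).
{ intros x. destruct (Hlim (Rabs x + 1)) as [M [M0 HM]].
  { generalize (Rabs_pos x); lra. }
  intros P [e He].
  destruct (pow_half_small (e / (M + 1) / 3)) as [N HN].
  { apply Rdiv_lt_0_compat; [|lra]; apply Rdiv_lt_0_compat; [apply cond_pos|lra]. }
  apply (Rmult_lt_compat_l (M + 1)) in HN; [|lra].
  replace ((M + 1) * (e / (M + 1) / 3)) with (e / 3) in HN by (field; lra).
  assert (HpN := pow_half_pos N).
  assert (He' : 0 < e / 3) by (generalize (cond_pos e); lra).
  destruct (Cp N x _ (locally_ball (picard Phi N x) (mkposreal _ He'))) as [d Hd].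
  assert (Hd1 : 0 < Rmin d 1) by (apply Rmin_pos; [apply cond_pos|lra]).
  exists (mkposreal _ Hd1); intros y Hy; apply He, (proj2 (ball_R _ _ _)).
  apply ball_Rabs in Hy; simpl in Hy.
  assert (h1 := Rmin_l d 1). assert (h2 := Rmin_r d 1).
  assert (HB : ball (picard Phi N x) (mkposreal _ He') (picard Phi N y)).
  { apply Hd, (proj2 (ball_R _ _ _)); lra. }
  apply ball_Rabs in HB; simpl in HB.
  replace (h y - h x) with ((h y - picard Phi N y) + (picard Phi N y - picard Phi N x)
     + (- (h x - picard Phi N x))) by ring.
  eapply Rle_lt_trans; [apply Rabs_triang|]. rewrite Rabs_Ropp.
  eapply Rle_lt_trans; [apply Rplus_le_compat_r, Rabs_triang|].
  apply Rabs_lt_between in Hy. assert (Hx := Rle_abs x).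
  assert (h3 := HM N y ltac:(lra)). assert (h4 := HM N x ltac:(lra)). lra. }
exists h; split; auto.
intros T HT.
destruct (Hlim T HT) as [M [M0 HM]].
set (B := 1 / 2 * exp (K * T)).
assert (HB0 : 0 <= B) by (unfold B; generalize (exp_pos (K * T)); lra).
assert (HLB : 0 <= Lam * B) by now apply Rmult_le_pos.
set (L := 2 * (K + Lam * B) + 1).
assert (HeL : forall t, 0 <= t -> 1 <= exp (L * t)).
{ intros t Ht. apply exp_ge_1, Rmult_le_pos; unfold L; lra. }
apply (eq_of_geom _ _ (M * exp (L * T))). intros n.
replace (h T - volt Phi h T) with ((h T - picard Phi (S n) T) +
   - (volt Phi h T - volt Phi (picard Phi n) T)) by (simpl; ring).
eapply Rle_trans; [apply Rabs_triang|]. rewrite Rabs_Ropp.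
assert (HMn : 0 <= M * (1/2) ^ n) by (apply Rmult_le_pos; auto; left; apply pow_half_pos).
assert (H1 := HM (S n) T (Rle_refl _)).
assert (H2 : Rabs (volt Phi h T - volt Phi (picard Phi n) T) <= M * (1/2) ^ n / 2 * exp (L * T)).
{ apply (volt_contract Phi h (picard Phi n) K Lam B L (M * (1/2) ^ n) T); auto;
    unfold L; try lra.
  - intros t Ht; eapply Rle_trans; [apply Bp; lra|].
    apply Rmult_le_compat_l; [lra|]. apply exp_le; nra.
  - intros t Ht. eapply Rle_trans; [apply HM; lra|]. fold L.
    specialize (HeL t ltac:(lra)). nra. }
specialize (HeL T HT).
rewrite <- tech_pow_Rmult in H1.
assert (M * (1 / 2) ^ n * 1 <= M * (1 / 2) ^ n * exp (L * T)) by (apply Rmult_le_compat_l; lra).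
lra.
Qed.

(** * Positivity and relaxation of the FDT solution *)

Lemma continuous_pos (h : R -> R) (x : R) :
  continuous h x -> 0 < h x -> exists d, 0 < d /\ forall y, Rabs (y - x) < d -> 0 < h y.
Proof.
intros Hc Hp.
destruct (Hc _ (locally_ball (h x) (mkposreal _ Hp))) as [d Hd].
exists d; split; [apply cond_pos|]. intros y Hy.
assert (HB := ball_Rabs _ _ _ (Hd y (proj2 (ball_R _ _ _) Hy))). simpl in HB.
apply Rabs_lt_between in HB; lra.
Qed.

Lemma first_zero (h : R -> R) (t1 : R) :
  (forall x, continuous h x) -> 0 < h 0 -> 0 <= t1 -> h t1 <= 0 ->
  exists t0, 0 < t0 /\ h t0 <= 0 /\ forall t, 0 <= t < t0 -> 0 < h t.
Proof.
intros Hc H0 Ht1 H1.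
assert (E0 : 0 <= 0 <= t1 /\ forall y, 0 <= y <= 0 -> 0 < h y).
{ split; [lra|]; intros y Hy; replace y with 0 by lra; auto. }
destruct (completeness (fun x => 0 <= x <= t1 /\ forall y, 0 <= y <= x -> 0 < h y)) as [m [Hm1 Hm2]].
- exists t1; intros x [Hx _]; lra.
- now exists 0.
- assert (Hm0 : 0 <= m) by now apply Hm1.
  assert (Hmt : m <= t1) by (apply Hm2; intros x [Hx _]; lra).
  assert (Hlt : forall t, 0 <= t < m -> 0 < h t).
  { intros t Ht. destruct (Rlt_dec 0 (h t)) as [|Hn]; auto.
    exfalso; assert (m <= t); [|lra].
    apply Hm2; intros x [Hx Hx2]. destruct (Rle_dec x t); auto.
    exfalso; apply Hn, Hx2; lra. }
  assert (Hhm : h m <= 0).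
  { destruct (Rle_dec (h m) 0) as [|Hn]; auto. exfalso.
    destruct (continuous_pos h m (Hc m)) as [d [Hd Hdp]]; [lra|].
    assert (m <> t1) by (intros ->; lra).
    set (x := Rmin (m + d / 2) t1).
    assert (Hx : m < x) by (apply Rmin_glb_lt; lra).
    assert (x <= m); [|lra]. apply Hm1; split.
    - split; [lra|apply Rmin_r].
    - intros y Hy. destruct (Rlt_dec y m); [apply Hlt; lra|].
      apply Hdp. generalize (Rmin_l (m + d/2) t1); fold x; intros.
      rewrite Rabs_right; lra. }
  exists m; repeat split; auto.
  destruct Hm0 as [|<-]; auto; lra.
Qed.

(** At a first zero [t0] of [h], [c] has decreased on [0, t0], so the kernel
    [k = Phi o c] is nonincreasing there and
    [h t <= integral over (t, t0) of k (t0 - v) h v dv].  Near [t0] this says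
    that the maximum of [h] is at most half of itself. *)
Lemma volt_pos (Phi h : R -> R) (K : R) :
  (forall x, Rabs (Phi x) <= K) -> (forall x, continuous Phi x) ->
  (forall x y, x <= y -> Phi x <= Phi y) ->
  (forall x, continuous h x) -> (forall t, 0 <= t -> h t = volt Phi h t) ->
  forall t, 0 <= t -> 0 < h t.
Proof.
intros HK CP Hmono Ch Heq t1 Ht1.
destruct (Rlt_dec 0 (h t1)) as [|Hn]; auto. exfalso.
assert (K0 : 0 <= K) by (eapply Rle_trans; [apply Rabs_pos|apply (HK 0)]).
set (k := fun v => Phi (1 - RInt h 0 v)).
assert (Ck : forall x, continuous k x) by (intros; now apply continuous_kernel).
assert (Hv : forall t, 0 <= t -> h t = 1 / 2 - RInt (fun v => h v * k (t - v)) 0 t).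
{ intros t Ht; rewrite Heq by auto. unfold volt; rewrite Rmax_right, conv_comm by auto. reflexivity. }
assert (H0 : h 0 = 1 / 2) by (rewrite Hv, RInt_pt by lra; ring).
destruct (first_zero h t1) as [t0 [Ht0 [Hz Hp]]]; auto; try lra.
assert (Ex : forall t a b, ex_RInt (fun v => h v * k (t - v)) a b) by (intros; now apply (ex_RInt_conv h k)).
assert (Hk : forall s t, 0 <= s <= t -> t <= t0 -> k t <= k s).
{ intros s t Hs Ht. apply Hmono.
  rewrite <- (RInt_split h 0 s t) by now apply ex_RInt_cont.
  assert (0 <= RInt h s t); [|lra].
  apply RInt_ge_0; [lra|now apply ex_RInt_cont|]. intros x Hx; left; apply Hp; lra. }
assert (Hb : forall t, 0 <= t <= t0 -> h t <= K * RInt h t t0).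
{ intros t Ht.
  assert (E1 := Hv t (proj1 Ht)). assert (E2 := Hv t0 (Rlt_le _ _ Ht0)).
  rewrite <- (RInt_split _ 0 t t0) in E2 by apply Ex.
  assert (I1 : RInt (fun v => h v * k (t0 - v)) 0 t <= RInt (fun v => h v * k (t - v)) 0 t).
  { apply RInt_le; auto; [lra|].
    intros v Hv'. apply Rmult_le_compat_l; [left; apply Hp; lra|]. apply Hk; lra. }
  assert (I2 : RInt (fun v => h v * k (t0 - v)) t t0 <= RInt (fun v => K * h v) t t0).
  { apply RInt_le; auto; [lra|apply ex_RInt_cont; intros; cont|].
    intros v Hv'. rewrite (Rmult_comm K). apply Rmult_le_compat_l; [left; apply Hp; lra|].
    eapply Rle_trans; [apply Rle_abs|apply HK]. }
  rewrite RInt_Rscal in I2 by now apply ex_RInt_cont. lra. }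
set (d := Rmin t0 (/ (2 * K + 1))).
assert (Hd : 0 < d).
{ apply Rmin_pos; auto. apply Rinv_0_lt_compat; lra. }
assert (Hd1 : d <= t0) by apply Rmin_l.
assert (Hd2 : K * d <= 1 / 2).
{ apply Rle_trans with (K * / (2 * K + 1)).
  - apply Rmult_le_compat_l; auto. apply Rmin_r.
  - apply Rmult_le_reg_r with (2 * K + 1); [lra|]. rewrite Rmult_assoc, Rinv_l by lra. lra. }
destruct (continuity_ab_maj h (t0 - d) t0) as [m [Hm Hm2]]; [lra| |].
{ intros; apply cont_pt; auto. }
assert (Hmp : 0 < h m).
{ apply Rlt_le_trans with (h (t0 - d)); [apply Hp; lra|]. apply Hm; lra. }
assert (HI : RInt h m t0 <= h m * d).
{ apply Rle_trans with (RInt (fun _ => h m) m t0).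
  - apply RInt_le; [lra|now apply ex_RInt_cont|apply ex_RInt_const|].
    intros x Hx; apply Hm; lra.
  - rewrite RInt_Rconst, Rmult_comm. apply Rmult_le_compat_l; lra. }
assert (Hbm := Hb m ltac:(lra)).
assert (K * RInt h m t0 <= K * (h m * d)) by now apply Rmult_le_compat_l.
nra.
Qed.

Lemma clamp_bounds (F F' : R -> R) :
  (forall x, is_derive F x (F' x)) -> (forall x, continuous F' x) ->
  exists K Lam, 0 < K /\ 0 <= Lam /\ (forall x, Rabs (F (clamp 0 1 x)) <= K) /\
  (forall x y, Rabs (F (clamp 0 1 x) - F (clamp 0 1 y)) <= Lam * Rabs (x - y)).
Proof.
intros Hd Hc.
destruct (bounded_on F 0 1) as [K [HK HKb]]; [lra| |].
{ apply continuous_on_forall; intros; eapply derive_cont, Hd. }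
destruct (lip_on F F' 0 1) as [l [Hl Hlip]]; [lra|auto|auto|].
exists (K + 1), l; repeat split; auto; try lra.
- intros x; apply Rle_trans with K; [apply HKb, clamp_in|]; lra.
- intros x y. eapply Rle_trans; [apply Hlip; apply clamp_in; lra|].
  apply Rmult_le_compat_l; auto. apply clamp_lip.
Qed.

(** The solution of [c' = - (F o c) * c' - 1/2], [c 0 = 1], with [h = - c'].
    All three functions live on the whole line, so that one-sided derivatives
    at time 0 never appear in computations. *)
Record relaxation (F F' : R -> R) (x0 : R) (c h h' : R -> R) : Prop := {
  rel_c : forall t, is_derive c t (- h t);
  rel_h : forall t, is_derive h t (h' t);
  rel_h' : forall t, continuous h' t;
  rel_c0 : c 0 = 1;
  rel_in : forall t, 0 <= t -> x0 <= c t <= 1;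
  rel_pos : forall t, 0 <= t -> 0 < h t;
  rel_eq : forall t, 0 <= t -> h t = 1 / 2 - RInt (fun v => F (c v) * h (t - v)) 0 t;
  rel_eq' : forall t, 0 <= t ->
    h' t = RInt (fun v => F' (c v) * h v * h (t - v)) 0 t - F 1 * h t;
  rel_bound : exists M, forall t, 0 <= t -> Rabs (h t) <= M }.

Arguments rel_c {F F' x0 c h h'}.
Arguments rel_h {F F' x0 c h h'}.
Arguments rel_h' {F F' x0 c h h'}.
Arguments rel_c0 {F F' x0 c h h'}.
Arguments rel_in {F F' x0 c h h'}.
Arguments rel_pos {F F' x0 c h h'}.
Arguments rel_eq {F F' x0 c h h'}.
Arguments rel_eq' {F F' x0 c h h'}.
Arguments rel_bound {F F' x0 c h h'}.

(** The solution with [F] frozen outside [0, 1] is global and decreasing.  It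
    stays above [x0]: if [c] reached [x0] at time [t], then [F o c >= F x0] up
    to [t] would give [(F o c) * h >= F x0 * (1 - x0) >= 1/2], that is [h t <= 0].
    Hence it never feels the freezing, and it is as smooth as [F] allows. *)
Theorem relaxation_exists (F F' : R -> R) (x0 : R) :
  (forall x, is_derive F x (F' x)) -> (forall x, continuous F' x) ->
  (forall x y, 0 <= x -> x <= y -> y <= 1 -> F x <= F y) ->
  0 <= x0 < 1 -> 1 / 2 <= F x0 * (1 - x0) ->
  exists c h h', relaxation F F' x0 c h h'.
Proof.
intros HF CF' Hmono Hx0 Hx1.
assert (CF : forall x, continuous F x) by (intros; eapply derive_cont, HF).
destruct (clamp_bounds F F' HF CF') as [K [Lam [K0 [HLam [HK HL]]]]].
set (Phi := fun x => F (clamp 0 1 x)).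
assert (CPhi := lip_continuous Phi Lam HL).
destruct (volt_exists Phi K Lam) as [h [Ch Heq]]; auto.
assert (Hpos := volt_pos Phi h K HK CPhi
  ltac:(intros x y Hxy; apply Hmono; [apply clamp_in; lra|now apply clamp_mono|apply clamp_in; lra])
  Ch Heq).
set (c := fun t => 1 - RInt h 0 t).
assert (Dprim : forall g : R -> R, (forall x, continuous g x) ->
  forall t, is_derive (fun t => 1 - RInt g 0 t) t (- g t)).
{ intros g Cg t. evar_last.
  - apply deriv_minus; [apply is_derive_const|now apply is_derive_primitive].
  - unfold zero; simpl; ring. }
assert (Dc := Dprim h Ch : forall t, is_derive c t (- h t)).
assert (Cc : forall x, continuous c x) by (intros; eapply derive_cont, Dc).
assert (Hc0 : c 0 = 1) by (unfold c; rewrite RInt_pt; ring).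
assert (Hc1 : forall t, 0 <= t -> c t <= 1).
{ intros t Ht. assert (0 <= RInt h 0 t); [|unfold c; lra].
  apply RInt_ge_0; auto. now apply ex_RInt_cont. intros x Hx; left; apply Hpos; lra. }
set (k := fun v => Phi (c v)).
assert (Ck : forall x, continuous k x) by (intros; now apply continuous_kernel).
assert (Hv : forall t, 0 <= t -> h t = 1 / 2 - RInt (fun v => h v * k (t - v)) 0 t).
{ intros t Ht; rewrite Heq by auto. unfold volt; rewrite Rmax_right, conv_comm by auto. reflexivity. }
assert (Ex : forall t a b, ex_RInt (fun v => h v * k (t - v)) a b) by (intros; now apply (ex_RInt_conv h k)).
assert (Hcx : forall t, 0 <= t -> x0 < c t).
{ intros t1 Ht1. destruct (Rlt_dec x0 (c t1)) as [|Hn]; auto. exfalso.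
  destruct (first_zero (fun t => c t - x0) t1) as [t0 [Ht0 [Hz Hp]]]; auto; try lra.
  { intros; apply cont_minus; auto. apply continuous_const. }
  assert (HI : RInt (fun v => F x0 * h v) 0 t0 <= RInt (fun v => h v * k (t0 - v)) 0 t0).
  { apply RInt_le; auto; [lra|apply ex_RInt_cont; intros; cont|].
    intros v Hv'. rewrite (Rmult_comm (F x0)). apply Rmult_le_compat_l; [left; apply Hpos; lra|].
    assert (Hcv := Hp (t0 - v) ltac:(lra)). simpl in Hcv.
    assert (Hcv1 := Hc1 (t0 - v) ltac:(lra)).
    unfold k, Phi. rewrite clamp_id by lra. apply Hmono; lra. }
  rewrite RInt_Rscal in HI by now apply ex_RInt_cont.
  assert (Hh := Hpos t0 ltac:(lra)). rewrite Hv in Hh by lra.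
  unfold c in Hz. assert (0 < F x0) by nra. nra. }
set (K1 := fun v => F (c v)).
set (K1' := fun v => - h v * F' (c v)).
assert (DK : forall v, is_derive K1 v (K1' v)) by (intros; now apply (deriv_comp F c)).
assert (CK' : forall x, continuous K1' x).
{ intros x; apply cont_mult; [apply cont_opp; auto|apply (continuous_comp c F'); auto]. }
assert (CK1 : forall x, continuous K1 x) by (intros; eapply derive_cont, DK).
(* hf has the smooth kernel F o c at all times, and equals h from time 0 on *)
set (hf := fun t => 1 / 2 - conv h K1 t).
set (hf' := fun t => - (conv h K1' t + h t * K1 0)).
assert (Dhf : forall t, is_derive hf t (hf' t)).
{ intros t; unfold hf. evar_last.
  - apply deriv_minus; [apply is_derive_const|]. apply (is_derive_conv K1 K1' h); auto.
  - unfold hf', zero; simpl; ring. }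
assert (Chf : forall x, continuous hf x) by (intros; eapply derive_cont, Dhf).
assert (Hk : forall v, 0 <= v -> k v = K1 v).
{ intros v Hv'. unfold k, K1, Phi. rewrite clamp_id; auto.
  generalize (Hcx v Hv') (Hc1 v Hv'); lra. }
assert (Hhf : forall t, 0 <= t -> hf t = h t).
{ intros t Ht. unfold hf. rewrite Hv by auto. apply (f_equal (Rminus (1 / 2))).
  apply RInt_ext_le; auto. intros x Hx. rewrite Hk by lra. reflexivity. }
set (cf := fun t => 1 - RInt hf 0 t).
assert (Hcf : forall t, 0 <= t -> cf t = c t).
{ intros t Ht. unfold cf, c. f_equal. apply RInt_ext_le; auto. intros x Hx; apply Hhf; lra. }
exists cf, hf, hf'. constructor.
- apply Dprim, Chf.
- exact Dhf.
- intros t. apply cont_opp, cont_plus; [now apply continuous_conv|].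
  apply cont_mult; auto. apply continuous_const.
- rewrite Hcf; auto; lra.
- intros t Ht. rewrite Hcf by auto. split; [left|]; auto.
- intros t Ht; rewrite Hhf; auto.
- intros t Ht. unfold hf at 1. f_equal. rewrite conv_comm by auto.
  apply RInt_ext_le; auto. intros v Hv'. rewrite Hcf, Hhf by lra. reflexivity.
- intros t Ht. unfold hf'. rewrite Hhf by auto.
  replace (K1 0) with (F 1) by (unfold K1; now rewrite Hc0).
  rewrite conv_comm by auto.
  replace (RInt (fun v => F' (cf v) * hf v * hf (t - v)) 0 t) with (- conv K1' h t); [ring|].
  unfold conv. rewrite <- RInt_Ropp by now apply (ex_RInt_conv K1' h).
  apply RInt_ext_le; auto. intros v Hv'. rewrite Hcf, !Hhf by lra. unfold K1'. ring.
- exists (1 / 2 + K). intros t Ht. rewrite Hhf by auto.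
  assert (Hh := Hpos t Ht). rewrite Rabs_right by lra. rewrite Hv by auto.
  assert (Hab : Rabs (RInt (fun v => h v * k (t - v)) 0 t) <= RInt (fun v => K * h v) 0 t).
  { apply abs_RInt_le_fun; auto.
    - apply ex_RInt_cont; intros; cont.
    - intros v Hv'. assert (Hp := Hpos v ltac:(lra)).
      rewrite Rabs_mult, (Rabs_right (h v)), Rmult_comm by lra.
      apply Rmult_le_compat_r; [lra|apply HK]. }
  rewrite RInt_Rscal in Hab by now apply ex_RInt_cont.
  assert (H1 := Hcx t Ht). unfold c in H1. apply Rabs_le_between in Hab. nra.
Qed.

(** * Mixtures as power series *)

(** Inside the disk of convergence [nu], [nu1] and [nu2] are the sums of their
    series; outside they have no meaning. *)
Definition in_disk (b : nat -> R) (x : R) : Prop :=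
  Rbar_lt (Finite (Rabs x)) (CV_radius (fun p => b p ^ 2)).

(** The condition on the mixture gives [b_p <= exp (- d p)] for large [p], hence a
    radius of convergence larger than 1. *)
Lemma limsup_decay (b : nat -> R) : mixture b ->
  exists d m, 0 < d /\ forall p, (m <= p)%nat -> b p <= exp (- d * INR p).
Proof.
intros [_ [_ [Hpos [_ [rbar [H1 H2]]]]]].
set (u := fun p => Rbar_mult (Finite (/ INR p)) (Rbar_ln (Finite (b p)))) in H2.
assert (Hd : exists d, 0 < d /\ Rbar_lt (Finite d) (Rbar_ln rbar)).
{ destruct rbar as [r| |]; simpl in *.
  - destruct (Rle_dec r 0); [lra|]. exists (ln r / 2).
    assert (0 < ln r) by (rewrite <- ln_1; apply ln_increasing; lra). simpl; lra.
  - exists 1; simpl; split; [lra|exact I].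
  - contradiction. }
destruct Hd as [d [Hd1 Hd2]].
unfold Rbar_LimSup_seq in H2. rewrite Inf_opp_sup in H2.
set (S1 := Sup_seq _) in H2.
assert (HS : Rbar_lt (Finite d) S1).
{ apply Rbar_lt_le_trans with (1 := Hd2).
  revert H2; destruct S1 as [s| |]; destruct (Rbar_ln rbar) as [l| |]; simpl; auto; try lra. }
apply Sup_seq_minor_lt in HS. destruct HS as [m Hm].
exists d, (S m); split; auto. intros p Hp.
assert (Hup : Rbar_le (u p) (Finite (- d))).
{ apply Rbar_not_lt_le. intros Hlt.
  assert (Hs : Rbar_lt (Finite (- d)) (Sup_seq (fun n => u (n + m)%nat))).
  { apply Sup_seq_minor_lt. exists (p - m)%nat. replace (p - m + m)%nat with p by lia. auto. }
  revert Hm Hs; destruct (Sup_seq (fun n => u (n + m)%nat)) as [s| |]; simpl; auto; try lra. }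
assert (Hp0 : 0 < INR p) by (apply lt_0_INR; lia).
assert (Hip : 0 < / INR p) by now apply Rinv_0_lt_compat.
unfold u, Rbar_ln in Hup. destruct (Rle_dec (b p) 0) as [Hb|Hb].
- apply Rle_trans with 0; auto. left; apply exp_pos.
- simpl in Hup. rewrite <- (exp_ln (b p)) by lra.
  assert (Hl : ln (b p) <= - d * INR p).
  { apply (Rmult_le_compat_r (INR p)) in Hup; [|lra].
    replace (/ INR p * ln (b p) * INR p) with (ln (b p)) in Hup by (field; lra). lra. }
  destruct Hl as [Hl|Hl]; [left; now apply exp_increasing|rewrite Hl; lra].
Qed.

Lemma mixture_radius (b : nat -> R) : mixture b ->
  Rbar_lt (Finite 1) (CV_radius (fun p => b p ^ 2)).
Proof.
intros Hb. destruct (limsup_decay b Hb) as [d [m [Hd Hm]]].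
destruct Hb as [_ [_ [Hpos _]]].
apply Rbar_lt_le_trans with (Finite (exp d)).
{ simpl. rewrite <- exp_0; apply exp_increasing; auto. }
apply (proj1 (CV_radius_bounded _)).
set (f := fun p => Rabs (b p ^ 2 * exp d ^ p)).
assert (HM : forall n, exists M, forall p, (p < n)%nat -> f p <= M).
{ induction n as [|n [M IH]].
  - exists 0; intros; lia.
  - exists (Rmax M (f n)); intros p Hp. destruct (Nat.eq_dec p n) as [->|].
    + apply Rmax_r.
    + eapply Rle_trans; [apply IH; lia|apply Rmax_l]. }
destruct (HM m) as [M HMm].
exists (Rmax M 1); intros p. destruct (Nat.lt_ge_cases p m) as [Hp|Hp].
- eapply Rle_trans; [apply (HMm p Hp)|apply Rmax_l].
- eapply Rle_trans; [|apply Rmax_r].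
  rewrite Rabs_right.
  2:{ apply Rle_ge, Rmult_le_pos; [apply pow2_ge_0|apply pow_le; left; apply exp_pos]. }
  assert (He : exp d ^ p = exp (d * INR p)).
  { clear. induction p as [|p IH]; [simpl; now rewrite Rmult_0_r, exp_0|].
    rewrite <- tech_pow_Rmult, IH, <- exp_plus, S_INR. f_equal; ring. }
  rewrite He. specialize (Hm p Hp). specialize (Hpos p).
  assert (H2 : b p ^ 2 <= exp (- d * INR p) ^ 2) by (apply pow_incr; lra).
  eapply Rle_trans; [apply Rmult_le_compat_r; [left; apply exp_pos|apply H2]|].
  simpl; rewrite Rmult_1_r, <- !exp_plus.
  replace (- d * INR p + - d * INR p + d * INR p) with (- (d * INR p)) by ring.
  assert (0 <= d * INR p) by (apply Rmult_le_pos; [lra|apply pos_INR]).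
  rewrite exp_Ropp, <- Rinv_1. apply Rinv_le_contravar; [lra|]. now apply exp_ge_1.
Qed.

Lemma in_disk_le (b : nat -> R) (x y : R) : Rabs x <= Rabs y -> in_disk b y -> in_disk b x.
Proof. intros H; apply Rbar_le_lt_trans; simpl; auto. Qed.

Lemma in_disk_le1 (b : nat -> R) (x : R) : mixture b -> Rabs x <= 1 -> in_disk b x.
Proof.
intros Hb H. apply Rbar_le_lt_trans with (Finite 1); [auto|now apply mixture_radius].
Qed.

Lemma in_disk_01 (b : nat -> R) (x : R) : mixture b -> 0 <= x <= 1 -> in_disk b x.
Proof. intros Hb Hx; apply in_disk_le1; auto; rewrite Rabs_right; lra. Qed.

Lemma in_disk_opp (b : nat -> R) (x : R) : in_disk b x -> in_disk b (- x).
Proof. apply in_disk_le; rewrite Rabs_Ropp; lra. Qed.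

Lemma in_disk_locally (b : nat -> R) (x : R) : in_disk b x -> locally x (in_disk b).
Proof.
intros H. unfold in_disk in *.
destruct (CV_radius (fun p => b p ^ 2)) as [r| |] eqn:E; simpl in *; try contradiction.
- assert (Hd : 0 < r - Rabs x) by lra. exists (mkposreal _ Hd). intros y Hy.
  apply ball_Rabs in Hy; simpl in Hy.
  generalize (Rabs_triang_inv y x); lra.
- exists (mkposreal 1 Rlt_0_1); auto.
Qed.

Lemma nu1_PS (b : nat -> R) (x : R) : in_disk b x ->
  nu1 b x = PSeries (PS_derive (fun p => b p ^ 2)) x.
Proof. intros H; apply is_derive_unique, is_derive_PSeries; auto. Qed.

Lemma is_derive_nu (b : nat -> R) (x : R) : in_disk b x -> is_derive (nu b) x (nu1 b x).
Proof. intros H; rewrite nu1_PS by auto. apply is_derive_PSeries; auto. Qed.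

Lemma in_disk_derive (b : nat -> R) (x : R) : in_disk b x ->
  Rbar_lt (Finite (Rabs x)) (CV_radius (PS_derive (fun p => b p ^ 2))).
Proof. now rewrite CV_radius_derive. Qed.

Lemma is_derive_nu1_PS (b : nat -> R) (x : R) : in_disk b x ->
  is_derive (nu1 b) x (PSeries (PS_derive (PS_derive (fun p => b p ^ 2))) x).
Proof.
intros H. eapply is_derive_ext_loc; [|apply is_derive_PSeries, in_disk_derive, H].
eapply filter_imp; [|apply in_disk_locally, H]. intros y Hy; simpl; symmetry; now apply nu1_PS.
Qed.

Lemma nu2_PS (b : nat -> R) (x : R) : in_disk b x ->
  nu2 b x = PSeries (PS_derive (PS_derive (fun p => b p ^ 2))) x.
Proof. intros H. apply (is_derive_unique (nu1 b)). now apply is_derive_nu1_PS. Qed.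

Lemma is_derive_nu1 (b : nat -> R) (x : R) : in_disk b x -> is_derive (nu1 b) x (nu2 b x).
Proof. intros H. rewrite nu2_PS by auto. now apply is_derive_nu1_PS. Qed.

Definition nu3 (b : nat -> R) : R -> R :=
  PSeries (PS_derive (PS_derive (PS_derive (fun p => b p ^ 2)))).

Lemma is_derive_nu2 (b : nat -> R) (x : R) : in_disk b x -> is_derive (nu2 b) x (nu3 b x).
Proof.
intros H. eapply is_derive_ext_loc.
2:{ apply is_derive_PSeries. rewrite !CV_radius_derive. apply H. }
eapply filter_imp; [|apply in_disk_locally, H]. intros y Hy; simpl; symmetry; now apply nu2_PS.
Qed.

Lemma continuous_nu1 (b : nat -> R) (x : R) : in_disk b x -> continuous (nu1 b) x.
Proof. intros H; eapply derive_cont, is_derive_nu1, H. Qed.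
Lemma continuous_nu2 (b : nat -> R) (x : R) : in_disk b x -> continuous (nu2 b) x.
Proof. intros H; eapply derive_cont, is_derive_nu2, H. Qed.
Lemma continuous_nu3 (b : nat -> R) (x : R) : in_disk b x -> continuous (nu3 b) x.
Proof.
intros H; eapply derive_cont. apply is_derive_PSeries. rewrite !CV_radius_derive. apply H.
Qed.

(** ** Term-by-term expansions *)

Lemma series_PS (a : nat -> R) (x : R) : Rbar_lt (Finite (Rabs x)) (CV_radius a) ->
  is_series (fun n => a n * x ^ n) (PSeries a x).
Proof. intros H. exact (proj1 (is_pseries_R _ _ _) (PSeries_correct _ _ (CV_radius_inside _ _ H))). Qed.

Lemma series_nu (b : nat -> R) (x : R) : in_disk b x ->
  is_series (fun p => b p ^ 2 * x ^ p) (nu b x).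
Proof. intros H. exact (series_PS _ _ H). Qed.

Lemma series_nu1 (b : nat -> R) (x : R) : in_disk b x ->
  is_series (fun p => b p ^ 2 * (INR p * x ^ (pred p))) (nu1 b x).
Proof.
intros H. apply is_series_decr_1.
replace (plus _ _) with (nu1 b x) by (unfold plus, opp; simpl; ring).
rewrite nu1_PS by auto.
eapply is_series_ext; [|apply series_PS, in_disk_derive, H].
intros n. unfold PS_derive. simpl pred. simpl; rring.
Qed.

Lemma series_nu2 (b : nat -> R) (x : R) : in_disk b x ->
  is_series (fun p => b p ^ 2 * (INR p * (INR p - 1) * x ^ (pred (pred p)))) (nu2 b x).
Proof.
intros H. apply is_series_decr_1, is_series_decr_1.
replace (plus _ _) with (nu2 b x) by (unfold plus, opp; simpl; ring).
rewrite nu2_PS by auto.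
eapply is_series_ext.
2:{ apply series_PS. rewrite !CV_radius_derive. apply H. }
intros n. unfold PS_derive. rewrite !S_INR. simpl pred. rring.
Qed.

Lemma series_lin (u v : nat -> R) (lu lv c d : R) :
  is_series u lu -> is_series v lv ->
  is_series (fun n => c * u n + d * v n) (c * lu + d * lv).
Proof.
intros Hu Hv.
apply (is_series_plus (K := R_AbsRing) (V := R_NormedModule)
  (fun n => c * u n) (fun n => d * v n) (c * lu) (d * lv));
 now apply (is_series_scal (K := R_AbsRing) (V := R_NormedModule)).
Qed.

Lemma series_xnu1 (b : nat -> R) (x : R) : in_disk b x ->
  is_series (fun p => b p ^ 2 * (INR p * x ^ p)) (x * nu1 b x).
Proof.
intros H. eapply is_series_ext;
  [|apply (is_series_scal (K := R_AbsRing) (V := R_NormedModule) x), series_nu1, H].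
intros [|n]; unfold scal; simpl; unfold mult; simpl; rring.
Qed.

Lemma series_xpsi (b : nat -> R) (x : R) : in_disk b x ->
  is_series (fun p => b p ^ 2 * (INR p ^ 2 * x ^ p)) (x * psi b x).
Proof.
intros H.
replace (x * psi b x) with ((x * x) * nu2 b x + x * nu1 b x) by (unfold psi; ring).
eapply is_series_ext; [|apply series_lin; [apply series_nu2, H|apply series_nu1, H]].
intros [|[|n]]; simpl pred; rewrite ?S_INR; simpl; rring.
Qed.

Lemma series_psi (b : nat -> R) (x : R) : in_disk b x ->
  is_series (fun p => b p ^ 2 * (INR p ^ 2 * x ^ (pred p))) (psi b x).
Proof.
intros H.
replace (psi b x) with (x * nu2 b x + 1 * nu1 b x) by (unfold psi; ring).
eapply is_series_ext; [|apply series_lin; [apply series_nu2, H|apply series_nu1, H]].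
intros [|[|n]]; simpl pred; rewrite ?S_INR; simpl; rring.
Qed.

(** ** Sums of nonnegative terms *)

Lemma sum_n_nonneg (u : nat -> R) (n : nat) : (forall p, 0 <= u p) -> 0 <= sum_n u n.
Proof.
intros H; induction n; [rewrite sum_O; auto|].
rewrite sum_Sn. unfold plus; simpl; generalize (H (S n)); lra.
Qed.

Lemma sum_n_mono (u : nat -> R) (n m : nat) : (forall p, 0 <= u p) -> (n <= m)%nat ->
  sum_n u n <= sum_n u m.
Proof.
intros H; induction 1; [lra|].
rewrite sum_Sn. unfold plus; simpl; generalize (H (S m)); lra.
Qed.

Lemma series_term_le (u : nat -> R) (l : R) (p : nat) :
  (forall p, 0 <= u p) -> is_series u l -> u p <= l.
Proof.
intros H Hs.
apply (is_lim_seq_le_loc (fun _ => u p) (sum_n u) (u p) l).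
- exists p; intros n Hn. eapply Rle_trans; [|apply (sum_n_mono u p n); auto].
  destruct p; [rewrite sum_O; lra|]. rewrite sum_Sn; unfold plus; simpl.
  generalize (sum_n_nonneg u p H); lra.
- apply is_lim_seq_const.
- exact Hs.
Qed.

Lemma series_nonneg (u : nat -> R) (l : R) :
  (forall p, 0 <= u p) -> is_series u l -> 0 <= l.
Proof. intros H Hs. eapply Rle_trans; [apply (H 0%nat)|]. now apply series_term_le. Qed.

Lemma series_zero (u : nat -> R) (l : R) :
  (forall p, 0 <= u p) -> is_series u l -> l = 0 -> forall p, u p = 0.
Proof. intros H Hs -> p. generalize (series_term_le u 0 p H Hs) (H p); lra. Qed.

Lemma series_zero_sum (l : R) : is_series (fun _ : nat => 0) l -> l = 0.
Proof.
intros H. apply is_series_unique in H. rewrite <- H.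
assert (H0 : is_lim_seq (sum_n (fun _ : nat => 0)) 0).
{ apply (is_lim_seq_ext (fun _ => 0)); [|apply is_lim_seq_const].
  intros n; rewrite sum_n_const; rring. }
now apply is_series_unique.
Qed.

Lemma mixture_supp (b : nat -> R) : mixture b -> exists p, (2 <= p)%nat /\ 0 < b p.
Proof.
intros [H0 [H1 [Hp [[p Hne] _]]]]. exists p.
destruct p as [|[|p]]; try (exfalso; lra). split; [lia|]. generalize (Hp (S (S p))); lra.
Qed.

Lemma sq_pos_of (b : nat -> R) (p : nat) : b p <> 0 -> 0 < b p ^ 2.
Proof. intros H; simpl; rewrite Rmult_1_r. now apply Rsqr_pos_lt. Qed.

Lemma nu1_pos (b : nat -> R) (x : R) : mixture b -> in_disk b x -> 0 < x -> 0 < nu1 b x.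
Proof.
intros Hb Hx H0. destruct (mixture_supp b Hb) as [p [Hp Hbp]].
apply Rlt_le_trans with (b p ^ 2 * (INR p * x ^ (pred p))).
- apply Rmult_lt_0_compat; [apply pow_lt; auto|].
  apply Rmult_lt_0_compat; [apply lt_0_INR; lia|now apply pow_lt].
- apply (series_term_le (fun p => b p ^ 2 * (INR p * x ^ (pred p)))); [|now apply series_nu1].
  intros q. apply Rmult_le_pos; [apply pow2_ge_0|].
  apply Rmult_le_pos; [apply pos_INR|apply pow_le; lra].
Qed.

Lemma nu_pos (b : nat -> R) (x : R) : mixture b -> in_disk b x -> 0 < x -> 0 < nu b x.
Proof.
intros Hb Hx H0. destruct (mixture_supp b Hb) as [p [Hp Hbp]].
apply Rlt_le_trans with (b p ^ 2 * x ^ p).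
- apply Rmult_lt_0_compat; apply pow_lt; auto.
- apply (series_term_le (fun p => b p ^ 2 * x ^ p)); [|now apply series_nu].
  intros q. apply Rmult_le_pos; [apply pow2_ge_0|apply pow_le; lra].
Qed.

Lemma nu2_nonneg (b : nat -> R) (x : R) : in_disk b x -> 0 <= x -> 0 <= nu2 b x.
Proof.
intros Hx H0. eapply series_nonneg; [|apply (series_nu2 b x Hx)].
intros q; simpl. apply Rmult_le_pos; [apply pow2_ge_0|].
apply Rmult_le_pos; [|apply pow_le; lra].
destruct q; [simpl; lra|]. apply Rmult_le_pos; [apply pos_INR|].
rewrite S_INR; generalize (pos_INR q); lra.
Qed.

Lemma nu1_mono (b : nat -> R) (x y : R) : mixture b -> 0 <= x -> x <= y -> y <= 1 ->
  nu1 b x <= nu1 b y.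
Proof.
intros Hb Hx Hxy Hy.
assert (HH : - nu1 b y <= - nu1 b x); [|lra].
apply (mvt_le (fun z => - nu1 b z) (fun z => - nu2 b z) x y); auto.
- apply continuous_on_forall; intros z Hz. apply cont_opp, continuous_nu1, in_disk_01; auto; lra.
- intros z Hz. apply deriv_opp, is_derive_nu1, in_disk_01; auto; lra.
- intros z Hz. assert (0 <= nu2 b z); [|lra]. apply nu2_nonneg; [apply in_disk_01; auto|]; lra.
Qed.

Lemma nu_0 (b : nat -> R) : mixture b -> nu b 0 = 0.
Proof.
intros [H0 _]. unfold nu. rewrite PSeries_0, H0. ring.
Qed.

Lemma nu1_0 (b : nat -> R) : mixture b -> nu1 b 0 = 0.
Proof.
intros Hb. rewrite nu1_PS by (apply in_disk_01; auto; lra).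
rewrite PSeries_0. unfold PS_derive. destruct Hb as [_ [H1 _]]. rewrite H1. ring.
Qed.

(** ** Cauchy-Schwarz for the mixture *)

(** The sum of squares [sum_p p b_p^2 (alpha^(p-1) - l q^(p-1))^2]. *)
Lemma cs_series (b : nat -> R) (al q l : R) : mixture b ->
  Rabs al <= 1 -> Rabs q <= 1 ->
  is_series (fun p => b p ^ 2 * INR p * (al ^ (pred p) - l * q ^ (pred p)) ^ 2)
    (nu1 b (al ^ 2) - 2 * l * nu1 b (al * q) + l ^ 2 * nu1 b (q ^ 2)).
Proof.
intros Hb Ha Hq.
assert (Hsq : forall x, Rabs x <= 1 -> in_disk b (x ^ 2)).
{ intros x Hx. apply in_disk_01; auto. apply Rabs_le_between in Hx. nra. }
assert (H1 := Hsq al Ha). assert (H2 := Hsq q Hq).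
assert (H3 : in_disk b (al * q)).
{ apply in_disk_le1; auto. rewrite Rabs_mult, <- (Rmult_1_r 1).
  apply Rmult_le_compat; auto; apply Rabs_pos. }
pose proof (series_lin _ _ _ _ 1 1 (series_lin _ _ _ _ 1 (- (2 * l)) (series_nu1 b _ H1)
  (series_nu1 b _ H3)) (series_lin _ _ _ _ (l ^ 2) 0 (series_nu1 b _ H2) (series_nu1 b _ H2))) as H.
replace (nu1 b (al ^ 2) - 2 * l * nu1 b (al * q) + l ^ 2 * nu1 b (q ^ 2)) with
  (1 * (1 * nu1 b (al ^ 2) + - (2 * l) * nu1 b (al * q)) +
       1 * (l ^ 2 * nu1 b (q ^ 2) + 0 * nu1 b (q ^ 2))) by ring.
eapply is_series_ext; [|apply H].
intros p; simpl. rewrite !Rpow_mult_distr, !pow1. rring.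
Qed.

(** Minimizing the sum of squares over [l] gives the Cauchy-Schwarz inequality;
    equality makes every term of the sum vanish. *)
Lemma cs_nu1 (b : nat -> R) (al q : R) : mixture b -> Rabs al <= 1 -> 0 < q <= 1 ->
  nu1 b (al * q) ^ 2 / nu1 b (q ^ 2) <= nu1 b (al ^ 2) /\
  (nu1 b (al * q) ^ 2 / nu1 b (q ^ 2) = nu1 b (al ^ 2) <->
   forall p, b p <> 0 ->
     al ^ (pred p) = nu1 b (al * q) / nu1 b (q ^ 2) * q ^ (pred p)).
Proof.
intros Hb Ha Hq.
assert (Hqp : 0 < nu1 b (q ^ 2)).
{ apply nu1_pos; auto; [apply in_disk_01; auto; nra|apply pow_lt; lra]. }
set (l := nu1 b (al * q) / nu1 b (q ^ 2)).
assert (Hs := cs_series b al q l Hb Ha ltac:(rewrite Rabs_right; lra)).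
assert (El : nu1 b (al ^ 2) - 2 * l * nu1 b (al * q) + l ^ 2 * nu1 b (q ^ 2) =
  nu1 b (al ^ 2) - nu1 b (al * q) ^ 2 / nu1 b (q ^ 2)) by (unfold l; field; lra).
rewrite El in Hs.
assert (Hnn : forall p, 0 <= b p ^ 2 * INR p * (al ^ (pred p) - l * q ^ (pred p)) ^ 2).
{ intros p. apply Rmult_le_pos; [|apply pow2_ge_0].
  apply Rmult_le_pos; [apply pow2_ge_0|apply pos_INR]. }
split; [generalize (series_nonneg _ _ Hnn Hs); lra|].
split.
- intros He p Hp.
  assert (Hz := series_zero _ _ Hnn Hs ltac:(lra) p).
  apply Rmult_integral in Hz. destruct Hz as [Hz|Hz].
  + exfalso. apply Rmult_integral in Hz. destruct Hz as [Hz|Hz].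
    * generalize (sq_pos_of b p Hp); lra.
    * destruct Hb as [H0 _]. assert (p = 0)%nat by (apply INR_eq; auto). subst; auto.
  + simpl in Hz. rewrite Rmult_1_r in Hz. apply Rmult_integral in Hz. lra.
- intros H.
  assert (Hz : is_series (fun _ : nat => 0) (nu1 b (al ^ 2) - nu1 b (al * q) ^ 2 / nu1 b (q ^ 2))).
  { eapply is_series_ext; [|apply Hs]. intros p; simpl.
    destruct (Req_dec (b p) 0) as [->|Hne]; [rring|]. rewrite (H p Hne). fold l. rring. }
  generalize (series_zero_sum _ Hz); lra.
Qed.

Lemma nu1_strict (b : nat -> R) (x : R) : mixture b -> 0 <= x < 1 -> nu1 b x < nu1 b 1.
Proof.
intros Hb Hx. destruct (mixture_supp b Hb) as [p [Hp Hbp]].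
assert (H1 : in_disk b 1) by (apply in_disk_01; auto; lra).
assert (H2 : in_disk b x) by (apply in_disk_01; auto; lra).
pose proof (series_lin _ _ _ _ 1 (-1) (series_nu1 b _ H1) (series_nu1 b _ H2)) as H.
assert (Hle : forall n, x ^ n <= 1 ^ n) by (intros; apply pow_incr; lra).
assert (Hs : (fun p => 1 * (b p ^ 2 * (INR p * 1 ^ (pred p))) +
   -1 * (b p ^ 2 * (INR p * x ^ (pred p)))) p <= 1 * nu1 b 1 + -1 * nu1 b x).
{ apply (series_term_le (fun p => 1 * (b p ^ 2 * (INR p * 1 ^ (pred p))) +
   -1 * (b p ^ 2 * (INR p * x ^ (pred p))))); auto.
  intros q.
  replace (_ + _) with (b q ^ 2 * (INR q * (1 ^ pred q - x ^ pred q))) by ring.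
  apply Rmult_le_pos; [apply pow2_ge_0|]. apply Rmult_le_pos; [apply pos_INR|].
  specialize (Hle (pred q)); lra. }
simpl in Hs.
assert (x ^ pred p < 1).
{ apply pow_lt_1_compat; [lra|lia]. }
assert (0 < b p ^ 2 * INR p * (1 - x ^ pred p)).
{ apply Rmult_lt_0_compat; [|lra]. apply Rmult_lt_0_compat; [now apply pow_lt|apply lt_0_INR; lia]. }
rewrite pow1 in Hs. simpl in H3. lra.
Qed.

(** * The FDT equation: existence and uniqueness *)

Lemma halfline_of_derive (f f' : R -> R) :
  (forall x, is_derive f x (f' x)) -> derivative_on_halfline f f'.
Proof.
intros Hd x _ P [e He].
destruct (proj1 (is_derive_Reals f x (f' x)) (Hd x) e (cond_pos e)) as [d Hdd].
exists d. intros y Hy Hne _. apply He, (proj2 (ball_R _ _ _)).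
apply ball_Rabs in Hy.
replace y with (x + (y - x)) at 1 by ring. apply Hdd; auto. lra.
Qed.

Lemma halfline_derive (f f' : R -> R) (x : R) :
  derivative_on_halfline f f' -> 0 < x -> is_derive f x (f' x).
Proof.
intros Hd Hx. apply is_derive_Reals. intros e He.
destruct (Hd x (Rlt_le _ _ Hx) _ (locally_ball (f' x) (mkposreal e He))) as [d Hdd].
assert (Hm : 0 < Rmin d x) by (apply Rmin_pos; [apply cond_pos|auto]).
exists (mkposreal _ Hm). intros h Hh Hlt. simpl in Hlt.
assert (h1 := Rmin_l d x). assert (h2 := Rmin_r d x).
assert (HB : ball (f' x) (mkposreal e He) ((f (x + h) - f x) / (x + h - x))).
{ apply Hdd.
  - apply (proj2 (ball_R _ _ _)). replace (x + h - x) with h by ring. lra.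
  - intros E; apply Hh; lra.
  - apply Rabs_lt_between in Hlt; lra. }
apply ball_Rabs in HB. simpl in HB. replace (x + h - x) with h in HB by ring. exact HB.
Qed.

Lemma halfline_continuous (f f' : R -> R) :
  derivative_on_halfline f f' -> continuous_on (fun x => 0 <= x) f.
Proof.
intros Hd x Hx P [e He].
destruct (Hd x Hx _ (locally_ball (f' x) (mkposreal 1 Rlt_0_1))) as [d Hdd].
assert (HK : 0 < Rabs (f' x) + 1) by (generalize (Rabs_pos (f' x)); lra).
assert (Hm : 0 < Rmin d (e / (Rabs (f' x) + 1))).
{ apply Rmin_pos; [apply cond_pos|]. apply Rdiv_lt_0_compat; auto; apply cond_pos. }
exists (mkposreal _ Hm). intros y Hy Hy0. apply He, (proj2 (ball_R _ _ _)). apply ball_Rabs in Hy; simpl in Hy.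
destruct (Req_dec y x) as [->|Hne].
{ rewrite Rminus_diag, Rabs_R0. apply cond_pos. }
assert (h1 := Rmin_l d (e / (Rabs (f' x) + 1))).
assert (h2 := Rmin_r d (e / (Rabs (f' x) + 1))).
assert (HB : ball (f' x) 1 ((f y - f x) / (y - x))).
{ apply (Hdd y); auto. apply (proj2 (ball_R _ _ _)); lra. }
apply ball_Rabs in HB.
assert (Hq : Rabs ((f y - f x) / (y - x)) <= Rabs (f' x) + 1).
{ replace ((f y - f x) / (y - x)) with (((f y - f x) / (y - x) - f' x) + f' x) by ring.
  eapply Rle_trans; [apply Rabs_triang|]. lra. }
replace (f y - f x) with ((f y - f x) / (y - x) * (y - x)) by (field; lra).
rewrite Rabs_mult.
apply Rle_lt_trans with ((Rabs (f' x) + 1) * Rabs (y - x)).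
- apply Rmult_le_compat_r; [apply Rabs_pos|auto].
- apply Rlt_le_trans with ((Rabs (f' x) + 1) * (e / (Rabs (f' x) + 1))).
  + apply Rmult_lt_compat_l; auto; lra.
  + right; field; lra.
Qed.

Lemma halfline_primitive (f f' : R -> R) (t : R) :
  C1_on_halfline f f' -> 0 <= t -> f t = f 0 + RInt (fun u => f' (Rmax 0 u)) 0 t.
Proof.
intros [Hd Hc] Ht.
set (g := fun u => f' (Rmax 0 u)).
assert (Cg : forall x, continuous g x) by (intros; now apply continuous_on_Rmax).
assert (H : Rabs ((f t - RInt g 0 t) - (f 0 - RInt g 0 0)) <= 0 - 0).
{ apply (mvt_abs (fun t => f t - RInt g 0 t) (fun _ => 0) (fun x => f' x - g x) (fun _ => 0)); auto.
  - apply continuous_on_minus.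
    + eapply continuous_on_subset; [|apply (halfline_continuous f f' Hd)]. simpl; intros; lra.
    + apply continuous_on_forall; intros; now apply continuous_primitive.
  - apply continuous_on_forall; intros; apply continuous_const.
  - intros x Hx. apply deriv_minus.
    + apply halfline_derive; auto; lra.
    + now apply is_derive_primitive.
  - intros; auto_derive; auto.
  - intros x Hx. unfold g. rewrite Rmax_right by lra. rewrite Rminus_diag, Rabs_R0; lra. }
rewrite RInt_pt in H. replace (f t - RInt g 0 t - (f 0 - 0)) with (f t - RInt g 0 t - f 0) in H by ring.
assert (H0 := Rabs_pos (f t - RInt g 0 t - f 0)).
assert (H1 : Rabs (f t - RInt g 0 t - f 0) = 0) by lra.
apply Rabs_eq_0 in H1. lra.
Qed.

(** A C^1 function on the whole line that coincides with [phi] on [0, 1]; outside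
    the disk of convergence [phi] itself is of no use. *)
Definition phi_ext (gamma beta : R) (b : nat -> R) (x : R) : R :=
  gamma + 2 * beta ^ 2 * (nu1 b 0 + RInt (fun u => nu2 b (clamp 0 1 u)) 0 x).

Lemma continuous_nu2_clamp (b : nat -> R) (x : R) : mixture b ->
  continuous (fun u => nu2 b (clamp 0 1 u)) x.
Proof.
intros Hb. apply continuous_on_clamp; [lra|]. apply continuous_on_forall; intros y Hy.
apply continuous_nu2, in_disk_01; auto.
Qed.

Lemma phi_ext_eq (gamma beta : R) (b : nat -> R) (x : R) : mixture b -> 0 <= x <= 1 ->
  phi_ext gamma beta b x = phi gamma beta b x.
Proof.
intros Hb Hx. unfold phi_ext, phi. do 2 f_equal.
rewrite (RInt_ext_le _ (nu2 b)); [|lra|].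
2:{ intros y Hy; rewrite clamp_id; auto; lra. }
rewrite (ftc (nu1 b) (nu2 b)); [ring|lra| |]; intros y Hy.
- apply is_derive_nu1, in_disk_01; auto; lra.
- apply continuous_nu2, in_disk_01; auto; lra.
Qed.

Lemma is_derive_phi_ext (gamma beta : R) (b : nat -> R) (x : R) : mixture b ->
  is_derive (phi_ext gamma beta b) x (2 * beta ^ 2 * nu2 b (clamp 0 1 x)).
Proof.
intros Hb. unfold phi_ext. evar_last.
- apply deriv_plus; [apply is_derive_const|].
  apply is_derive_scal.
  apply deriv_plus; [apply is_derive_const|].
  apply is_derive_primitive; intros; now apply continuous_nu2_clamp.
- unfold plus, zero; simpl; ring.
Qed.

Theorem fdt_exists (b : nat -> R) (beta gamma x0 : R) : mixture b ->
  0 <= x0 < 1 -> 1 / 2 <= phi gamma beta b x0 * (1 - x0) ->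
  exists c h h', relaxation (phi gamma beta b) (fun x => 2 * beta ^ 2 * nu2 b x) x0 c h h'.
Proof.
intros Hb Hx0 Hx1.
destruct (relaxation_exists (phi_ext gamma beta b)
  (fun x => 2 * beta ^ 2 * nu2 b (clamp 0 1 x)) x0) as [c [h [h' HR]]]; auto.
- intros; now apply is_derive_phi_ext.
- intros x. apply cont_mult; [apply continuous_const|now apply continuous_nu2_clamp].
- intros x y Hx Hxy Hy. rewrite !phi_ext_eq by (auto; lra). unfold phi.
  apply Rplus_le_compat_l, Rmult_le_compat_l; [generalize (pow2_ge_0 beta); lra|].
  now apply nu1_mono.
- rewrite phi_ext_eq; auto; lra.
- assert (Hin := rel_in HR).
  exists c, h, h'. constructor; try apply HR.
  + intros t Ht; rewrite (rel_eq HR t Ht). f_equal. apply RInt_ext_le; auto.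
    intros v Hv. rewrite phi_ext_eq; auto. specialize (Hin v); lra.
  + intros t Ht. rewrite (rel_eq' HR t Ht), phi_ext_eq by (auto; lra). f_equal.
    apply RInt_ext_le; auto. intros v Hv. rewrite clamp_id; auto. specialize (Hin v); lra.
Qed.

Lemma strict_decr_of (c h : R -> R) :
  (forall t, is_derive c t (- h t)) -> (forall t, 0 <= t -> 0 < h t) ->
  forall x y, 0 <= x < y -> c y < c x.
Proof.
intros Hd Hp x y Hxy.
destruct (MVT_gen c x y (fun t => - h t)) as [z [Hz Hz2]].
- intros; apply Hd.
- intros; apply cont_pt; eapply derive_cont, Hd.
- rewrite Rmin_left, Rmax_right in Hz by lra. specialize (Hp z ltac:(lra)). nra.
Qed.

(** In terms of [e = - d'], any solution of the FDT equation solves the Volterra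
    equation above, for which uniqueness is known. *)
Lemma fdt_volt (b : nat -> R) (beta gamma : R) (d d' : R -> R) : mixture b ->
  FDT_solution beta b gamma d d' ->
  let e := fun t => - d' (Rmax 0 t) in
  (forall x, continuous e x) /\
  (forall t, 0 <= t -> d t = 1 - RInt e 0 t) /\
  (forall t, 0 <= t -> e t = volt (fun x => phi_ext gamma beta b (clamp 0 1 x)) e t).
Proof.
intros Hb [Hr [_ [HC [H0 Heq]]]] e.
assert (Ce : forall x, continuous e x).
{ intros x. apply cont_opp, continuous_on_Rmax, HC. }
assert (Hd : forall t, 0 <= t -> d t = 1 - RInt e 0 t).
{ intros t Ht. rewrite (halfline_primitive d d' t HC Ht), H0. unfold e.
  rewrite RInt_Ropp.
  - ring.
  - apply ex_RInt_cont; intros; apply continuous_on_Rmax, HC. }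
repeat split; auto.
intros t Ht. unfold e at 1. unfold volt, conv. rewrite !Rmax_right, Heq by auto.
replace (- (- RInt (fun v => phi gamma beta b (d v) * d' (t - v)) 0 t - 1 / 2)) with
  (1 / 2 - (- RInt (fun v => phi gamma beta b (d v) * d' (t - v)) 0 t)) by ring.
f_equal.
rewrite (RInt_ext_le _ (fun v => - (phi_ext gamma beta b (clamp 0 1 (1 - RInt e 0 v)) * e (t - v)))).
- rewrite RInt_Ropp; [ring|].
  apply (ex_RInt_conv (fun v => phi_ext gamma beta b (clamp 0 1 (1 - RInt e 0 v))) e); auto.
  intros x; apply (continuous_kernel (fun x => phi_ext gamma beta b (clamp 0 1 x)) e); auto.
  intros y; apply (continuous_comp (clamp 0 1) (phi_ext gamma beta b));
   [apply continuous_clamp|eapply derive_cont, is_derive_phi_ext; auto].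
- auto.
- intros v Hv. rewrite <- Hd by lra. unfold e. rewrite Rmax_right by lra.
  specialize (Hr v ltac:(lra)). rewrite clamp_id, phi_ext_eq by auto. ring.
Qed.

Theorem fdt_unique (b : nat -> R) (beta gamma : R) (c c' d d' : R -> R) : mixture b ->
  FDT_solution beta b gamma c c' -> FDT_solution beta b gamma d d' ->
  forall t, 0 <= t -> d t = c t.
Proof.
intros Hb Hc Hd t Ht.
destruct (fdt_volt b beta gamma c c' Hb Hc) as [A1 [A2 A3]].
destruct (fdt_volt b beta gamma d d' Hb Hd) as [B1 [B2 B3]].
rewrite (A2 t), (B2 t) by auto. apply (f_equal (Rminus 1)).
destruct (clamp_bounds (phi_ext gamma beta b) (fun x => 2 * beta ^ 2 * nu2 b (clamp 0 1 x)))
  as [K [Lam [K0 [HLam [HK HL]]]]].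
{ intros; now apply is_derive_phi_ext. }
{ intros x. apply cont_mult; [apply continuous_const|now apply continuous_nu2_clamp]. }
apply RInt_ext_le; auto. intros x Hx.
apply (volt_unique (fun x => phi_ext gamma beta b (clamp 0 1 x)) (fun t => - d' (Rmax 0 t)) (fun t => - c' (Rmax 0 t)) K Lam); auto. lra.
Qed.

Lemma fdt_is_c_gamma (b : nat -> R) (beta gamma x0 : R) (c h h' : R -> R) : mixture b ->
  0 <= x0 -> relaxation (phi gamma beta b) (fun x => 2 * beta ^ 2 * nu2 b x) x0 c h h' ->
  is_c_gamma beta b gamma c (fun t => - h t) /\
  C1_on_halfline (fun t => - h t) (fun t => - h' t).
Proof.
intros Hb Hx0 [H1 H2 H3 H4 H6 H7 H8 _ _].
assert (Ch : forall x, continuous h x) by (intros; eapply derive_cont, H2).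
assert (HF : FDT_solution beta b gamma c (fun t => - h t)).
{ split; [|split; [|split; [|split]]]; auto.
  - intros t Ht; specialize (H6 t Ht); lra.
  - now apply (strict_decr_of c h).
  - split; [now apply halfline_of_derive|].
    apply continuous_on_forall; intros; apply cont_opp; auto.
  - intros t Ht. rewrite H8 by auto.
    rewrite (RInt_ext_le (fun v => phi gamma beta b (c v) * - h (t - v))
      (fun v => - (phi gamma beta b (c v) * h (t - v)))); auto.
    2: intros; ring.
    rewrite RInt_Ropp; [ring|].
    apply (ex_RInt_ext_le (fun v => phi_ext gamma beta b (c v) * h (t - v))); auto.
    { intros v Hv. rewrite phi_ext_eq; auto. specialize (H6 v); lra. }
    apply (ex_RInt_conv (fun v => phi_ext gamma beta b (c v)) h); auto.
    intros x; apply (continuous_comp c (phi_ext gamma beta b));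
     eapply derive_cont; [apply H1|now apply is_derive_phi_ext]. }
split; [split; auto|].
- intros d d' Hd; now apply (fdt_unique b beta gamma c (fun t => - h t) d d').
- split.
  + apply halfline_of_derive. intros x; apply deriv_opp; auto.
  + apply continuous_on_forall; intros; apply cont_opp; auto.
Qed.

(** * The stationary dynamics built from a solution of the FDT equation *)

(** [v] as a function of [y - q_o x / q_star^2]: in the degenerate case
    [|q_o| = q_star] the coefficient is 0. *)
Definition zc (qs qo : R) : R :=
  if Rlt_dec (Rabs qo) qs then / sqrt (qs ^ 2 - qo ^ 2) else 0.

Lemma zvar_lin (qs qo x y : R) : zvar qs qo x y = zc qs qo * (y - qo / qs ^ 2 * x).
Proof. unfold zvar, zc, Rdiv. destruct Rlt_dec; ring. Qed.

Definition vx_val (b : nat -> R) (qs qo w2 w3 k x y : R) : R :=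
  w2 * nu1 b x + w3 * (psi b x / qs ^ 2)
  + k * ((y - qo / qs ^ 2 * x) * nu2 b x - qo / qs ^ 2 * nu1 b x).

Definition vy_val (b : nat -> R) (w1 k x y : R) : R := w1 * nu1 b y + k * nu1 b x.

Lemma v_x_of (b : nat -> R) (qs qo w1 w2 w3 w4 x y : R) : in_disk b x ->
  v_x (v_of b qs qo w1 w2 w3 w4) x y = vx_val b qs qo w2 w3 (w4 * zc qs qo) x y.
Proof.
intros Hx. apply is_derive_unique.
apply (is_derive_ext (fun x => w1 * nu b y + w2 * nu b x + w3 * (x * nu1 b x / qs ^ 2)
  + w4 * ((zc qs qo * (y - qo / qs ^ 2 * x)) * nu1 b x))).
{ intros t; unfold v_of; now rewrite zvar_lin. }
assert (D1 := is_derive_nu b x Hx). assert (D2 := is_derive_nu1 b x Hx).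
auto_derive.
- repeat split; eexists; eauto.
- change (Derive (fun x0 => nu b x0) x) with (nu1 b x).
  change (Derive (fun x0 => nu1 b x0) x) with (nu2 b x).
  unfold vx_val, psi, Rdiv. simpl. ring.
Qed.

Lemma is_derive_v_y (b : nat -> R) (qs qo w1 w2 w3 w4 x y : R) : in_disk b y ->
  is_derive (v_of b qs qo w1 w2 w3 w4 x) y (vy_val b w1 (w4 * zc qs qo) x y).
Proof.
intros Hy.
apply (is_derive_ext (fun y => w1 * nu b y + w2 * nu b x + w3 * (x * nu1 b x / qs ^ 2)
  + w4 * ((zc qs qo * (y - qo / qs ^ 2 * x)) * nu1 b x))).
{ intros t; unfold v_of; now rewrite zvar_lin. }
assert (D1 := is_derive_nu b y Hy).
auto_derive.
- repeat split; eexists; eauto.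
- change (Derive (fun x0 => nu b x0) y) with (nu1 b y). unfold vy_val, Rdiv. simpl. ring.
Qed.

Lemma v_y_of (b : nat -> R) (qs qo w1 w2 w3 w4 x y : R) : in_disk b y ->
  v_y (v_of b qs qo w1 w2 w3 w4) x y = vy_val b w1 (w4 * zc qs qo) x y.
Proof. intros Hy. apply is_derive_unique. exact (is_derive_v_y b qs qo w1 w2 w3 w4 x y Hy). Qed.

Definition stat_dynamics (c h : R -> R) (qo H0 : R) : dynamics :=
  Dynamics (fun s t => c (Rabs (s - t)))
    (fun s t => if Rle_dec t s then 2 * h (s - t) else 0)
    (fun s t => RInt (fun u => if Rle_dec u s then 2 * h (s - u) else 0) 0 t)
    (fun _ => qo) (fun _ => H0).

(** The equations of [solves_sp] for one given function [v]. *)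
Definition solves_v (beta : R) (b : nat -> R) (qs qo : R) (v : R -> R -> R) (D : dynamics) : Prop :=
  let A := A_C beta b qs v D in
  CR_system beta b A D /\
  dq D 0 = qo /\
  (forall s, 0 < s ->
     is_derive (dq D) s (- (1 / 2 + beta * A s s) * dq D s + beta * A_q beta b qs qo v D s)) /\
  (forall s, 0 <= s ->
     dH D s = beta * RInt (fun u => dR D s u * nu1 b (dC D s u)) 0 s
              - beta * nu1 b (dq D s) * dL b qs D s + v (dq D s) (dC D s 0)).

Lemma is_derive_profile (F f f' : R -> R) (t s : R) : (forall x, is_derive f x (f' x)) ->
  (forall u, t < u -> F u = f (u - t)) -> t < s -> is_derive F s (f' (s - t)).
Proof.
intros Df HF Hs. apply (is_derive_ext_loc (fun u => f (u - t))).
- eapply filter_imp; [|apply locally_gt, Hs]. intros u Hu; symmetry; now apply HF.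
- replace (f' (s - t)) with (1 * f' (s - t)) by ring.
  apply (deriv_comp f (fun u => u - t)); auto. auto_derive; auto.
Qed.

Lemma C1_after_profile (F f f' : R -> R) (t : R) : (forall x, is_derive f x (f' x)) ->
  (forall x, continuous f' x) -> (forall u, t < u -> F u = f (u - t)) -> C1_after t F.
Proof.
intros Df Cf HF s Hs. split; [eexists; now apply (is_derive_profile F f f' t s)|].
apply (continuous_ext_loc _ (fun u => f' (u - t))); [|now apply cont_shift].
eapply filter_imp; [|apply locally_gt, Hs]. intros u Hu.
symmetry; now apply is_derive_unique, is_derive_profile with f.
Qed.

Lemma C1_after_const (t k : R) (F : R -> R) : (forall u, F u = k) -> C1_after t F.
Proof.
intros HF. apply (C1_after_profile F (fun _ => k) (fun _ => 0)); auto.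
- intros; auto_derive; auto.
- intros; apply continuous_const.
Qed.

Section Stat.
Variables (b : nat -> R) (beta gamma x0 : R) (c h h' : R -> R).
Hypothesis Hb : mixture b.
Hypothesis Hx0 : 0 <= x0.
Hypothesis HR : relaxation (phi gamma beta b) (fun x => 2 * beta ^ 2 * nu2 b x) x0 c h h'.

Lemma Cc : forall x, continuous c x.
Proof. intros x; exact (derive_cont _ _ _ (rel_c HR x)). Qed.
Lemma Chh : forall x, continuous h x.
Proof. intros x; exact (derive_cont _ _ _ (rel_h HR x)). Qed.
Hint Resolve Cc Chh : core.

Lemma c01 (t : R) : 0 <= t -> 0 <= c t <= 1.
Proof. intros Ht; generalize (rel_in HR t Ht); lra. Qed.
Lemma in_disk_c (t : R) : 0 <= t -> in_disk b (c t).
Proof. intros Ht; apply in_disk_01, c01; auto. Qed.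

Lemma h0 : h 0 = 1 / 2.
Proof. rewrite (rel_eq HR), RInt_pt by lra. ring. Qed.

Lemma D_refl_c (s x : R) : is_derive (fun u => c (s - u)) x (h (s - x)).
Proof.
replace (h (s - x)) with (-1 * - h (s - x)) by ring.
apply (deriv_comp c (fun u => s - u)); [apply (rel_c HR)|auto_derive; auto; rring].
Qed.

Lemma D_shift_c (s x : R) : is_derive (fun u => c (u - s)) x (- h (x - s)).
Proof.
replace (- h (x - s)) with (1 * - h (x - s)) by ring.
apply (deriv_comp c (fun u => u - s)); [apply (rel_c HR)|auto_derive; auto].
Qed.

Lemma cont_c_comp (f : R -> R) (x : R) : (forall y, in_disk b y -> continuous f y) -> 0 <= x ->
  continuous (fun v => f (c v)) x.
Proof. intros Hf Hx. apply (continuous_comp c f); auto. now apply Hf, in_disk_c. Qed.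

Lemma cont_nuc (f : R -> R) (s x : R) : (forall y, in_disk b y -> continuous f y) -> x <= s ->
  continuous (fun u => f (c (s - u))) x.
Proof.
intros Hf Hx. apply (continuous_comp (fun u => c (s - u)) f); [cont|apply Hf, in_disk_c; lra].
Qed.

Ltac cont_c := cont; lazymatch goal with
  | |- continuous (fun u => ?f (c (?s - u))) _ => apply (cont_nuc f s)
  | |- continuous (fun u => ?f (c u)) _ => apply (cont_c_comp f)
  | |- _ => idtac end; intros; lazymatch goal with
  | |- continuous (nu1 _) _ => now apply continuous_nu1
  | |- continuous (nu2 _) _ => now apply continuous_nu2
  | |- _ => auto; try lra end.

Lemma D_nuc (f f' : R -> R) (s x : R) : (forall y, in_disk b y -> is_derive f y (f' y)) -> x <= s ->
  is_derive (fun u => f (c (s - u))) x (f' (c (s - x)) * h (s - x)).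
Proof.
intros Hf Hx. rewrite Rmult_comm.
apply (deriv_comp f (fun u => c (s - u))); [apply Hf, in_disk_c; lra|apply D_refl_c].
Qed.

(** As [c] starts at 1, the response [2 h] is an exact derivative along the past:
    [2 h (s - u) f' (c (s - u))] is the derivative in [u] of [2 f (c (s - u))]. *)
Lemma int_nuc (f f' : R -> R) (s t : R) : t <= s ->
  (forall y, in_disk b y -> is_derive f y (f' y)) -> (forall y, in_disk b y -> continuous f' y) ->
  RInt (fun u => 2 * h (s - u) * f' (c (s - u))) t s = 2 * (f 1 - f (c (s - t))).
Proof.
intros Hs Df Cf'.
rewrite (ftc (fun u => 2 * f (c (s - u)))); [|lra| |].
- replace (s - s) with 0 by ring. rewrite (rel_c0 HR); rring.
- intros x Hx. replace (2 * h (s - x) * f' (c (s - x))) with (2 * (f' (c (s - x)) * h (s - x))) by ring.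
  apply is_derive_scal, (D_nuc f f'); auto; lra.
- intros x Hx. cont. now apply (cont_nuc f').
Qed.

Lemma int_h (s t : R) : t <= s -> RInt (fun u => 2 * h (s - u)) t s = 2 * (1 - c (s - t)).
Proof.
intros Ht. rewrite <- (int_nuc (fun x => x) (fun _ => 1)); auto.
- apply RInt_ext; intros; rring.
- intros; apply (is_derive_id (K := R_AbsRing)).
- intros; apply continuous_const.
Qed.

(** The part of the convolution in the FDT equation that is not an exact derivative. *)
Definition J (t : R) : R := RInt (fun v => nu1 b (c v) * h (t - v)) 0 t.

Lemma exJ (t : R) : 0 <= t -> ex_RInt (fun v => nu1 b (c v) * h (t - v)) 0 t.
Proof. intros Ht. apply ex_RInt_closed; auto. intros x Hx. cont_c. Qed.

Lemma fdt_J (t : R) : 0 <= t -> 2 * beta ^ 2 * J t = 1 / 2 - gamma * (1 - c t) - h t.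
Proof.
intros Ht. rewrite (rel_eq HR t Ht). unfold J, phi.
rewrite (RInt_ext_le (fun v => (gamma + 2 * beta ^ 2 * nu1 b (c v)) * h (t - v))
  (fun v => gamma / 2 * (2 * h (t - v)) +
  2 * beta ^ 2 * (nu1 b (c v) * h (t - v)))); auto; [|intros; in_R; field].
assert (E : ex_RInt (fun v => 2 * h (t - v)) 0 t) by (apply ex_RInt_cont; intros; cont).
assert (E2 := exJ t Ht).
rewrite RInt_Rplus, (RInt_Rscal (gamma / 2)), (RInt_Rscal (2 * beta ^ 2)), int_h, Rminus_0_r; auto; [field| |];
 now apply (ex_RInt_scal (V := R_NormedModule)).
Qed.

(** The integrand of the sum is the derivative of
    [u => 2 nu' (c (s - u)) c (t - u)]. *)
Lemma I2_eq (s t : R) : 0 <= t <= s ->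
  RInt (fun u => 2 * h (s - u) * nu2 b (c (s - u)) * c (t - u)) 0 t +
  RInt (fun u => 2 * h (t - u) * nu1 b (c (s - u))) 0 t
  = 2 * (nu1 b (c (s - t)) - nu1 b (c s) * c t).
Proof.
intros Ht.
rewrite <- RInt_Rplus by (apply ex_RInt_closed; [|intros; cont_c]; lra).
rewrite (ftc (fun u => 2 * (nu1 b (c (s - u)) * c (t - u)))); [|lra| |].
- rewrite !Rminus_0_r. replace (t - t) with 0 by ring. rewrite (rel_c0 HR). ring.
- intros x Hx. evar_last.
  + apply is_derive_scal, (deriv_mult (fun u => nu1 b (c (s - u))) (fun u => c (t - u))).
    * apply (D_nuc (nu1 b) (nu2 b)); [intros; now apply is_derive_nu1|lra].
    * apply D_refl_c.
  + ring.
- intros x Hx. cont_c.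
Qed.

(** Same computation, with [c (u - t)] increasing the lag as [u] grows; the term
    with [nu'] is then the convolution [J]. *)
Lemma I3_eq (s t : R) : 0 <= t <= s ->
  RInt (fun u => 2 * h (s - u) * nu2 b (c (s - u)) * c (u - t)) t s
  = 2 * (nu1 b 1 * c (s - t) - nu1 b (c (s - t)) + J (s - t)).
Proof.
intros Ht.
assert (E : RInt (fun u => 2 * h (s - u) * nu2 b (c (s - u)) * c (u - t) -
   2 * (nu1 b (c (s - u)) * h (u - t))) t s = 2 * (nu1 b 1 * c (s - t) - nu1 b (c (s - t)))).
{ rewrite (ftc (fun u => 2 * (nu1 b (c (s - u)) * c (u - t)))); [|lra| |].
  - replace (t - t) with 0 by ring. replace (s - s) with 0 by ring.
    rewrite (rel_c0 HR). rring.
  - intros x Hx. evar_last.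
    + apply is_derive_scal, (deriv_mult (fun u => nu1 b (c (s - u))) (fun u => c (u - t))).
      * apply (D_nuc (nu1 b) (nu2 b)); [intros; now apply is_derive_nu1|lra].
      * apply D_shift_c.
    + ring.
  - intros x Hx. cont_c. }
assert (E0 : ex_RInt (fun u => nu1 b (c (s - u)) * h (u - t)) t s).
{ apply ex_RInt_closed; [lra|]. intros; cont_c. }
rewrite RInt_Rminus, RInt_Rscal in E; auto.
- replace (RInt (fun u => nu1 b (c (s - u)) * h (u - t)) t s) with (J (s - t)) in E; [lra|].
  unfold J. rewrite <- (RInt_reflect (fun v => nu1 b (c v) * h (s - t - v)) s t) by (apply exJ; lra).
  apply RInt_ext; intros x _. f_equal. f_equal. ring.
- apply ex_RInt_closed; [lra|]. intros; cont_c.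
- now apply (ex_RInt_scal (V := R_NormedModule)).
Qed.

Section System.
Variables (qs al w2 w3 w4 : R).
Hypothesis Hqs : 0 < qs <= 1.
Hypothesis Hal : Rabs al < 1.
Let qo := al * qs.
Let ba := b_alpha b qs al.
Let k := - (2 * beta * ba).
Hypothesis Hbeta : 0 < beta.
Hypothesis Hk : w4 * zc qs qo = k.
Hypothesis Hgam : gamma = gamma_star beta b qs al.
Hypothesis HV1 : vx_val b qs qo w2 w3 k qo 1 = al / (2 * beta * qs * (1 - al ^ 2)).
Let v := v_of b qs qo (2 * beta) w2 w3 w4.
Variable H0 : R.
Let D := stat_dynamics c h qo H0.

Lemma D_C (s t : R) : 0 <= t <= s -> dC D s t = c (s - t).
Proof. intros H; unfold D; simpl. rewrite Rabs_right; auto; lra. Qed.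
Lemma D_C' (s t : R) : 0 <= s <= t -> dC D s t = c (t - s).
Proof. intros H; unfold D; simpl. rewrite Rabs_left1 by lra. f_equal; ring. Qed.
Lemma D_R (s t : R) : t <= s -> dR D s t = 2 * h (s - t).
Proof. intros H; unfold D; simpl. destruct Rle_dec; auto; lra. Qed.

Lemma qo_abs : Rabs qo <= 1.
Proof.
unfold qo. rewrite Rabs_mult, (Rabs_right qs) by lra. generalize (Rabs_pos al); nra.
Qed.

Lemma D_L (s : R) : 0 <= s -> dL b qs D s = ba * (2 * (1 - c s)).
Proof.
intros Hs. unfold dL.
rewrite (RInt_ext_le _ (fun u => nu1 b qo * (2 * h (s - u)))); auto.
2: { intros u Hu. rewrite D_R by lra. unfold D; simpl. ring. }
rewrite RInt_Rscal by (apply ex_RInt_cont; intros; cont).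
rewrite int_h, Rminus_0_r by lra. unfold ba, b_alpha. fold qo. unfold Rdiv. ring.
Qed.

Lemma v_x_D (s : R) : 0 <= s ->
  v_x v (dq D s) (dC D s 0) = al / (2 * beta * qs * (1 - al ^ 2)) + k * (c s - 1) * nu2 b qo.
Proof.
intros Hs. rewrite D_C by lra. change (dq D s) with qo. rewrite Rminus_0_r.
unfold v; rewrite v_x_of by (apply in_disk_le1; auto; apply qo_abs).
rewrite Hk, <- HV1. unfold vx_val. ring.
Qed.

Lemma v_y_D (s : R) : 0 <= s ->
  v_y v (dq D s) (dC D s 0) = 2 * beta * nu1 b (c s) + k * nu1 b qo.
Proof.
intros Hs. rewrite D_C by lra. change (dq D s) with qo. rewrite Rminus_0_r.
unfold v; rewrite v_y_of by (apply in_disk_c; auto).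
rewrite Hk. reflexivity.
Qed.

(** By [I2_eq], [I3_eq] and the FDT equation, the terms in [nu'] of [c s] and the
    terms in [c t] cancel against those of [v] and [L], precisely because
    [w1 = 2 beta], [k = - 2 beta b_alpha] and [gamma = gamma_star]: what is left
    depends on [s - t] only. *)
Lemma D_A (s t : R) : 0 <= t <= s ->
  beta * A_C beta b qs v D s t =
  2 * beta ^ 2 * nu1 b 1 * c (s - t) + gamma * c (s - t) - h (s - t).
Proof.
intros Ht. unfold A_C. rewrite v_x_D, v_y_D, !D_L by lra.
rewrite (D_C t 0) by lra. rewrite Rminus_0_r.
assert (E1 : forall x, 0 < x < t -> 2 * h (s - x) * nu2 b (c (s - x)) * c (t - x) =
  dR D s x * nu2 b (dC D s x) * dC D x t).
{ intros x Hx. rewrite D_R, D_C, D_C' by lra. reflexivity. }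
assert (E2 : forall x, t < x < s -> 2 * h (s - x) * nu2 b (c (s - x)) * c (x - t) =
  dR D s x * nu2 b (dC D s x) * dC D x t).
{ intros x Hx. rewrite D_R, !D_C by lra. reflexivity. }
rewrite <- (RInt_split _ 0 t s).
2: { eapply ex_RInt_ext_le; [| apply E1|]; [lra|]. apply ex_RInt_closed; [|intros; cont_c]; lra. }
2: { eapply ex_RInt_ext_le; [| apply E2|]; [lra|]. apply ex_RInt_closed; [|intros; cont_c]; lra. }
rewrite <- (RInt_ext_le _ _ 0 t ltac:(lra) E1), <- (RInt_ext_le _ _ t s ltac:(lra) E2).
rewrite (RInt_ext_le (fun u => dR D t u * nu1 b (dC D s u)) (fun u => 2 * h (t - u) * nu1 b (c (s - u)))).
2: lra.
2: { intros x Hx. rewrite D_R, D_C by lra. reflexivity. }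
rewrite I3_eq by lra.
assert (HI := I2_eq s t Ht).
set (X := RInt (fun u => 2 * h (s - u) * nu2 b (c (s - u)) * c (t - u)) 0 t) in *.
set (Y := RInt (fun u => 2 * h (t - u) * nu1 b (c (s - u))) 0 t) in *.
clearbody X Y.
assert (HX : X = 2 * (nu1 b (c (s - t)) - nu1 b (c s) * c t) - Y) by (simpl in *; lra).
rewrite HX.
assert (HJ := fdt_J (s - t) ltac:(lra)).
assert (HG : gamma = 1 / 2 + qo * (beta * (al / (2 * beta * qs * (1 - al ^ 2)))) + beta * k * nu1 b qo).
{ rewrite Hgam. unfold gamma_star, k, ba, b_alpha. fold qo. unfold qo at 2.
  assert (0 < 1 - al ^ 2).
  { apply Rabs_lt_between in Hal. nra. }
  assert (0 < nu1 b (qs ^ 2)).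
  { apply nu1_pos; auto; [apply in_disk_01; auto; nra|nra]. }
  field. repeat split; lra. }
change (dq D t) with qo; change (dq D s) with qo.
replace (J (s - t)) with ((1 / 2 - gamma * (1 - c (s - t)) - h (s - t)) / (2 * beta ^ 2))
  by (rewrite <- HJ; field; lra).
set (V1 := al / (2 * beta * qs * (1 - al ^ 2))) in *.
assert (HV : qo * V1 = (gamma - 1 / 2 - beta * k * nu1 b qo) / beta).
{ apply Rmult_eq_reg_l with beta; [|lra]. transitivity (qo * (beta * V1)); [ring|].
  rewrite HG. field. lra. }
transitivity (beta * (beta * (2 * (nu1 b (c (s - t)) - nu1 b (c s) * c t) - Y +
 2 * (nu1 b 1 * c (s - t) - nu1 b (c (s - t)) +
   (1 / 2 - gamma * (1 - c (s - t)) - h (s - t)) / (2 * beta ^ 2))) + beta * Y -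
 beta * (qo * nu2 b qo * (ba * (2 * (1 - c s)))) - beta * (nu1 b qo * (ba * (2 * (1 - c t)))) +
 ((gamma - 1 / 2 - beta * k * nu1 b qo) / beta + qo * (k * (c s - 1) * nu2 b qo)) +
 c t * (2 * beta * nu1 b (c s) + k * nu1 b qo))).
{ rewrite <- HV. ring. }
unfold k. field. lra.
Qed.

Lemma mu_D (s : R) : 0 <= s ->
  1 / 2 + beta * A_C beta b qs v D s s = phi gamma beta b 1.
Proof.
intros Hs. rewrite D_A by lra. replace (s - s) with 0 by ring. rewrite (rel_c0 HR), h0. unfold phi. ring.
Qed.

Lemma C_eq (s t : R) : 0 <= t < s ->
  is_derive (fun s' => dC D s' t) s
    (- (1 / 2 + beta * A_C beta b qs v D s s) * dC D s t + beta * A_C beta b qs v D s t).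
Proof.
intros Ht. rewrite mu_D, D_A, D_C by lra. unfold phi. evar_last.
- apply (is_derive_profile _ c (fun t => - h t)); [apply (rel_c HR)| |apply Ht]. intros; apply D_C; lra.
- simpl. ring.
Qed.

Lemma R_eq (s t : R) : 0 <= t < s ->
  is_derive (fun s' => dR D s' t) s
    (- (1 / 2 + beta * A_C beta b qs v D s s) * dR D s t
     + beta ^ 2 * RInt (fun u => dR D u t * dR D s u * nu2 b (dC D s u)) t s).
Proof.
intros Ht. rewrite mu_D, D_R by lra. evar_last.
- apply (is_derive_profile _ (fun x => 2 * h x) (fun x => 2 * h' x)); [|intros; apply D_R; lra|apply Ht].
  intros x; apply is_derive_scal, (rel_h HR).
- cbv beta. rewrite (rel_eq' HR) by lra.
  set (g := fun v => nu2 b (c v) * h v * h (s - t - v)).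
  assert (Ex : ex_RInt g 0 (s - t)) by (apply ex_RInt_closed; [lra|]; intros; unfold g; cont_c).
  rewrite (RInt_ext_le (fun u => dR D u t * _ * _) (fun u => 4 * g (s - u))); [|lra|].
  2: { intros x Hx. rewrite !D_R, D_C by lra. unfold g.
    replace (s - t - (s - x)) with (x - t) by ring. ring. }
  rewrite (RInt_ext_le _ (fun v => 2 * beta ^ 2 * g v) 0); [|lra|intros; unfold g; rring].
  rewrite (RInt_Rscal (2 * beta ^ 2)), (RInt_Rscal 4), (RInt_reflect g); auto; [ring|].
  apply ex_RInt_closed; [lra|]. intros x Hx. unfold g. cont_c.
  apply (continuous_comp (fun u => s - t - (s - u)) h); auto. cont.
Qed.

Lemma q_eq (s : R) : 0 < s ->
  is_derive (dq D) s
    (- (1 / 2 + beta * A_C beta b qs v D s s) * dq D s + beta * A_q beta b qs qo v D s).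
Proof.
intros Hs. rewrite mu_D by lra. unfold A_q. rewrite v_x_D, v_y_D, D_L by lra.
rewrite (RInt_ext_le _ (fun u => qo * (2 * h (s - u) * nu2 b (c (s - u))))); [|lra|].
2: { intros x Hx. rewrite D_R, D_C by lra. unfold D; simpl; ring. }
rewrite RInt_Rscal by (apply ex_RInt_closed; [lra|]; intros; cont_c).
rewrite (int_nuc (nu1 b) (nu2 b)); [|lra|intros; now apply is_derive_nu1|intros; now apply continuous_nu2].
rewrite Rminus_0_r. unfold D; simpl.
evar_last; [apply is_derive_const|]. unfold zero; simpl.
unfold phi. rewrite Hgam. unfold gamma_star.
assert (0 < 1 - al ^ 2).
{ apply Rabs_lt_between in Hal. nra. }
assert (0 < nu1 b (qs ^ 2)).
{ apply nu1_pos; auto; [apply in_disk_01; auto; nra|nra]. }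
change (qs * (qs * 1)) with (qs ^ 2). change (al * (al * 1)) with (al ^ 2).
fold qo. unfold k, ba, b_alpha. fold qo.
replace (nu1 b qo * (nu1 b qo * 1)) with (nu1 b qo * nu1 b qo) by ring.
set (nq := nu1 b qo). set (n2q := nu2 b qo). set (nqs := nu1 b (qs ^ 2)) in *.
unfold qo. field. repeat split; lra.
Qed.

Hypothesis HH0 : H0 = 2 * beta * nu b 1 + w2 * nu b qo
  + w3 * (qo * nu1 b qo / qs ^ 2) + k * (1 - al ^ 2) * nu1 b qo.

Lemma H_eq (s : R) : 0 <= s ->
  dH D s = beta * RInt (fun u => dR D s u * nu1 b (dC D s u)) 0 s
           - beta * nu1 b (dq D s) * dL b qs D s + v (dq D s) (dC D s 0).
Proof.
intros Hs. rewrite D_L, (D_C s 0) by lra. rewrite Rminus_0_r.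
rewrite (RInt_ext_le _ (fun u => 2 * h (s - u) * nu1 b (c (s - u)))); [|lra|].
2: { intros x Hx. rewrite D_R, D_C by lra. reflexivity. }
rewrite (int_nuc (nu b) (nu1 b)); [|lra|intros; now apply is_derive_nu|intros; now apply continuous_nu1].
rewrite Rminus_0_r.
unfold v, v_of. rewrite zvar_lin. unfold D; simpl.
replace (w4 * (zc qs qo * (c s - qo / (qs * (qs * 1)) * qo) * nu1 b qo)) with
  ((w4 * zc qs qo) * ((c s - qo / qs ^ 2 * qo) * nu1 b qo)) by (simpl; ring).
rewrite Hk, HH0. unfold k. replace (qo / qs ^ 2 * qo) with (al ^ 2) by (unfold qo; field; lra).
simpl. ring.
Qed.

Lemma D_regular : regular b D.
Proof.
destruct (rel_bound HR) as [M HM].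
split; [|split; [|split; [|split; [|split; [|split; [|split; [|split]]]]]]].
- apply continuous_on_forall; intros p _. unfold D; simpl.
  apply (continuous_comp (fun p : R * R => Rabs (fst p - snd p)) c); auto.
  apply (continuous_comp (fun p : R * R => fst p - snd p) Rabs); [cont|].
  apply (continuous_abs (K := R_AbsRing)).
- apply (continuous_on_ext _ (fun p : R * R => 2 * h (fst p - snd p))).
  + intros p Hp. rewrite D_R; auto. apply Hp.
  + apply continuous_on_forall; intros p _. cont.
    apply (continuous_comp (fun p : R * R => fst p - snd p) h); [cont|auto].
- apply continuous_on_forall; intros; apply continuous_const.
- apply continuous_on_forall; intros; apply continuous_const.
- exists (1 + 2 * Rabs M + Rabs qo + Rabs H0). intros s t Hs Ht.
  generalize (Rabs_pos M) (Rabs_pos qo) (Rabs_pos H0); intros.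
  unfold D; simpl. repeat split; try lra.
  + assert (Hc := c01 (Rabs (s - t)) (Rabs_pos _)). rewrite Rabs_right; lra.
  + destruct Rle_dec; [|rewrite Rabs_R0; lra].
    rewrite Rabs_mult, (Rabs_right 2) by lra.
    specialize (HM (s - t) ltac:(lra)). generalize (Rle_abs M); lra.
- intros s t Hs Ht. split.
  + unfold D; simpl. apply in_disk_c, Rabs_pos.
  + apply (in_disk_le1 b qo Hb qo_abs).
- intros t Ht. split.
  + apply (C1_after_profile _ c (fun t => - h t)); [apply (rel_c HR)|intros; cont|intros; apply D_C; lra].
  + apply (C1_after_profile _ (fun t => 2 * h t) (fun t => 2 * h' t)).
    * intros; apply is_derive_scal, (rel_h HR).
    * intros; cont. apply (rel_h' HR).
    * intros; apply D_R; lra.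
- apply (C1_after_const 0 qo); reflexivity.
- apply (C1_after_const 0 H0); reflexivity.
Qed.

Lemma D_CR : CR_system beta b (A_C beta b qs v D) D.
Proof.
split; [apply D_regular|].
split; [|split; [|split; [|split; [|split; [|split]]]]].
- intros s t _ _. unfold D; simpl. now rewrite Rabs_minus_sym.
- intros s _. unfold D; simpl. rewrite Rminus_diag, Rabs_R0. apply (rel_c0 HR).
- intros s _. rewrite D_R by lra. rewrite Rminus_diag, h0. field.
- intros s t Hst. unfold D; simpl. destruct Rle_dec; auto; lra.
- intros s t _ _. reflexivity.
- exact R_eq.
- exact C_eq.
Qed.

Lemma D_solves : solves_v beta b qs qo v D.
Proof. split; [exact D_CR|split; [reflexivity|split; [exact q_eq|exact H_eq]]]. Qed.

Lemma D_stationary : stationary D.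
Proof.
split.
- exists c, (fun t => 2 * h t). intros s t Ht. now rewrite D_C, D_R.
- intros; split; reflexivity.
Qed.

Lemma D_profile : has_profile D c (fun t => - 2 * - h t).
Proof. intros s t Ht. rewrite D_C, D_R by lra. split; auto; ring. Qed.

End System.
End Stat.

(** * Uniqueness of the dynamics *)

(** On a compact set of times the values stay away from the boundary of the disk
    of convergence, so that [nu], [nu1] and [nu2] are Lipschitz on them. *)
Lemma quadrant_compact (b : nat -> R) (f : R -> R -> R) (M T : R) : 0 <= T ->
  continuous_on (fun p : R * R => 0 <= fst p /\ 0 <= snd p) (fun p => f (fst p) (snd p)) ->
  (forall s t, 0 <= s -> 0 <= t -> Rabs (f s t) <= M) ->
  (forall s t, 0 <= s -> 0 <= t -> in_disk b (f s t)) ->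
  exists rho, 0 <= rho /\ in_disk b rho /\
    forall s t, 0 <= s <= T -> 0 <= t <= T -> Rabs (f s t) <= rho.
Proof.
intros HT Hc HM Hr.
assert (M0 : 0 <= M) by (eapply Rle_trans; [apply Rabs_pos|apply (HM 0 0); lra]).
unfold in_disk in *.
destruct (CV_radius (fun p => b p ^ 2)) as [r| |] eqn:E.
2: { exists M; simpl; repeat split; auto. intros; apply HM; lra. }
2: { exfalso; apply (Hr 0 0); lra. }
assert (Hd : forall p : R * R, exists d : posreal, 0 <= fst p /\ 0 <= snd p ->
  d <= (r - Rabs (f (fst p) (snd p))) / 2 /\
  forall x y, 0 <= x -> 0 <= y -> Rabs (x - fst p) < d -> Rabs (y - snd p) < d ->
    Rabs (f x y) < (Rabs (f (fst p) (snd p)) + r) / 2).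
{ intros [u v]; simpl.
  destruct (Rle_dec 0 u) as [Hu|Hu]; [|exists (mkposreal 1 Rlt_0_1); intros; lra].
  destruct (Rle_dec 0 v) as [Hv|Hv]; [|exists (mkposreal 1 Rlt_0_1); intros; lra].
  specialize (Hr u v Hu Hv). simpl in Hr.
  assert (He : 0 < (r - Rabs (f u v)) / 2) by lra.
  destruct (Hc (u, v) (conj Hu Hv) _ (locally_ball (f u v) (mkposreal _ He))) as [d Hdd].
  assert (Hm : 0 < Rmin d ((r - Rabs (f u v)) / 2)) by (apply Rmin_pos; [apply cond_pos|auto]).
  exists (mkposreal _ Hm); simpl. intros _; split; [apply Rmin_r|].
  intros x y Hx Hy H1 H2.
  assert (HB : ball (f u v) (mkposreal _ He) (f x y)).
  { apply (Hdd (x, y)).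
    - split; apply (proj2 (ball_R _ _ _)); simpl; (eapply Rlt_le_trans; [eassumption|apply Rmin_l]).
    - simpl; auto. }
  apply ball_Rabs in HB. simpl in HB.
  generalize (Rabs_triang_inv (f x y) (f u v)); lra. }
destruct (functional_choice _ Hd) as [dl Hdl].
destruct (compactness_value_2d 0 T 0 T (fun u v => dl (u, v))) as [d Hdd].
assert (Hall : forall s t, 0 <= s <= T -> 0 <= t <= T -> Rabs (f s t) <= r - d).
{ intros s t Hs Ht. destruct (Rle_dec (Rabs (f s t)) (r - d)) as [|Hn]; auto.
  exfalso; apply (Hdd s t Hs Ht). intros [u [v [Hu [Hv [H1 [H2 H3]]]]]]. apply Hn.
  destruct (Hdl (u, v)) as [Ha Hb]; [simpl; lra|]. simpl in *.
  specialize (Hb s t ltac:(lra) ltac:(lra) H1 H2). lra. }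
assert (H0 := Hall 0 0 ltac:(lra) ltac:(lra)).
exists (r - d). assert (Hrd := Rabs_pos (f 0 0)). assert (Hdp := cond_pos d).
split; [lra|]. split; auto. simpl. rewrite Rabs_right; lra.
Qed.

Lemma continuous_on_line_fst (P : R -> R -> Prop) (f : R -> R -> R) (t : R) :
  continuous_on (fun p : R * R => P (fst p) (snd p)) (fun p => f (fst p) (snd p)) ->
  continuous_on (fun u => P u t) (fun u => f u t).
Proof.
intros H. apply (continuous_on_comp_l (fun u => P u t)
  (fun p : R * R => P (fst p) (snd p)) (fun u => (u, t)) (fun p => f (fst p) (snd p))); auto.
intros; apply continuous_pair_l.
Qed.

Lemma continuous_on_line_snd (P : R -> R -> Prop) (f : R -> R -> R) (s : R) :
  continuous_on (fun p : R * R => P (fst p) (snd p)) (fun p => f (fst p) (snd p)) ->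
  continuous_on (fun u => P s u) (fun u => f s u).
Proof.
intros H. apply (continuous_on_comp_l (fun u => P s u)
  (fun p : R * R => P (fst p) (snd p)) (fun u => (s, u)) (fun p => f (fst p) (snd p))); auto.
intros; apply continuous_pair_r.
Qed.

Section Reg.
Variables (b : nat -> R) (D : dynamics).
Hypothesis HR : regular b D.

Lemma reg_C_fst (t : R) : 0 <= t -> continuous_on (fun u => 0 <= u) (fun u => dC D u t).
Proof.
intros Ht. destruct HR as [H _].
eapply continuous_on_subset; [|apply (continuous_on_line_fst (fun x y => 0 <= x /\ 0 <= y) (dC D) t H)].
simpl; auto.
Qed.
Lemma reg_C_snd (s : R) : 0 <= s -> continuous_on (fun u => 0 <= u) (fun u => dC D s u).
Proof.
intros Ht. destruct HR as [H _].
eapply continuous_on_subset; [|apply (continuous_on_line_snd (fun x y => 0 <= x /\ 0 <= y) (dC D) s H)].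
simpl; auto.
Qed.
Lemma reg_R_fst (t : R) : 0 <= t -> continuous_on (fun u => t <= u) (fun u => dR D u t).
Proof.
intros Ht. destruct HR as [_ [H _]].
eapply continuous_on_subset; [|apply (continuous_on_line_fst (fun x y => 0 <= y <= x) (dR D) t H)].
simpl; auto.
Qed.
Lemma reg_R_snd (s : R) : continuous_on (fun u => 0 <= u <= s) (fun u => dR D s u).
Proof. destruct HR as [_ [H _]]. exact (continuous_on_line_snd (fun x y => 0 <= y <= x) (dR D) s H). Qed.
Lemma reg_q : continuous_on (fun u => 0 <= u) (dq D).
Proof. apply HR. Qed.
Lemma reg_disk_C (s t : R) : 0 <= s -> 0 <= t -> in_disk b (dC D s t).
Proof. intros Hs Ht. destruct HR as [_ [_ [_ [_ [_ [H _]]]]]]. now apply (H s t). Qed.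
Lemma reg_disk_q (s : R) : 0 <= s -> in_disk b (dq D s).
Proof. intros Hs. destruct HR as [_ [_ [_ [_ [_ [H _]]]]]]. now apply (H s 0 Hs (Rle_refl _)). Qed.
Lemma reg_bound : exists M, 0 <= M /\ forall s t, 0 <= s -> 0 <= t ->
  Rabs (dC D s t) <= M /\ Rabs (dR D s t) <= M /\ Rabs (dq D s) <= M.
Proof.
destruct HR as [_ [_ [_ [_ [[M HM] _]]]]]. exists M; split.
- eapply Rle_trans; [apply Rabs_pos|apply (HM 0 0); lra].
- intros s t Hs Ht. destruct (HM s t Hs Ht) as [? [? [? ?]]]; auto.
Qed.

Lemma reg_rho (T : R) : 0 <= T -> exists rho, 0 <= rho /\ in_disk b rho /\
  (forall s t, 0 <= s <= T -> 0 <= t <= T -> Rabs (dC D s t) <= rho) /\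
  (forall s, 0 <= s <= T -> Rabs (dq D s) <= rho).
Proof.
intros HT. destruct reg_bound as [M [M0 HM]].
destruct (quadrant_compact b (dC D) M T) as [r1 [H1 [H2 H3]]]; auto.
{ apply HR. }
{ intros; now apply HM. }
{ intros; now apply reg_disk_C. }
destruct (quadrant_compact b (fun s _ => dq D s) M T) as [r2 [K1 [K2 K3]]]; auto.
{ apply (continuous_on_comp_l _ (fun u => 0 <= u) (fun p : R * R => fst p) (dq D)).
  - apply reg_q.
  - intros p [H _]; auto.
  - intros; apply continuous_fst. }
{ intros; now apply (HM s t). }
{ intros; now apply reg_disk_q. }
exists (Rmax r1 r2). repeat split.
- eapply Rle_trans; [apply H1|apply Rmax_l].
- unfold Rmax; destruct Rle_dec; auto.
- intros s t Hs Ht. eapply Rle_trans; [now apply H3|apply Rmax_l].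
- intros s Hs. eapply Rle_trans; [now apply (K3 s s)|apply Rmax_r].
Qed.

Lemma on_sub (a c : R) (f : R -> R) (P : R -> Prop) :
  continuous_on P f -> (forall u, a <= u <= c -> P u) -> continuous_on (fun u => a <= u <= c) f.
Proof. intros H HP. eapply continuous_on_subset; [|apply H]. exact HP. Qed.

Ltac reg := lazymatch goal with
  | |- continuous_on _ (fun u => @?f u * @?g u) => apply (continuous_on_mult _ f g); reg
  | |- continuous_on _ (fun u => nu1 b (@?f u)) => apply (continuous_on_comp_r _ f (nu1 b));
      [reg|intros; apply continuous_nu1; (apply reg_disk_C || apply reg_disk_q); lra]
  | |- continuous_on _ (fun u => nu2 b (@?f u)) => apply (continuous_on_comp_r _ f (nu2 b));
      [reg|intros; apply continuous_nu2; (apply reg_disk_C || apply reg_disk_q); lra]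
  | |- continuous_on _ (fun u => dC D u ?t) =>
      apply (on_sub _ _ _ (fun u => 0 <= u)); [apply reg_C_fst; lra|intros; lra]
  | |- continuous_on _ (fun u => dC D ?s u) =>
      apply (on_sub _ _ _ (fun u => 0 <= u)); [apply reg_C_snd; lra|intros; lra]
  | |- continuous_on _ (fun u => dR D u ?t) =>
      apply (on_sub _ _ _ (fun u => t <= u)); [apply reg_R_fst; lra|intros; lra]
  | |- continuous_on _ (fun u => dR D ?s u) =>
      apply (on_sub _ _ _ (fun u => 0 <= u <= s)); [apply reg_R_snd|intros; lra]
  | |- _ => apply (on_sub _ _ _ (fun u => 0 <= u)); [apply reg_q|intros; lra]
  end.

Lemma ex_int1 (s t : R) : 0 <= s -> 0 <= t ->
  ex_RInt (fun u => dR D s u * nu2 b (dC D s u) * dC D u t) 0 s.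
Proof. intros Hs Ht. apply ex_RInt_on; auto. reg. Qed.

Lemma ex_int2 (s t : R) : 0 <= s -> 0 <= t ->
  ex_RInt (fun u => dR D t u * nu1 b (dC D s u)) 0 t.
Proof. intros Hs Ht. apply ex_RInt_on; auto. reg. Qed.

Lemma ex_int3 (s : R) : 0 <= s -> ex_RInt (fun u => dR D s u * nu1 b (dq D u)) 0 s.
Proof. intros Hs. apply ex_RInt_on; auto. reg. Qed.

Lemma ex_int4 (s : R) : 0 <= s ->
  ex_RInt (fun u => dR D s u * dq D u * nu2 b (dC D s u)) 0 s.
Proof. intros Hs. apply ex_RInt_on; auto. reg. Qed.

Lemma ex_int5 (s t : R) : 0 <= t <= s ->
  ex_RInt (fun u => dR D u t * dR D s u * nu2 b (dC D s u)) t s.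
Proof. intros Ht. apply ex_RInt_on; [lra|]. reg. Qed.
End Reg.

(** ** Lipschitz functionals of the past *)

Section Unique.
Variables (b : nat -> R) (beta qs qo w1 w2 w3 w4 : R) (D1 D2 : dynamics).
Let v := v_of b qs qo w1 w2 w3 w4.
Let A := A_C beta b qs v.
Hypothesis S1 : solves_v beta b qs qo v D1.
Hypothesis S2 : solves_v beta b qs qo v D2.
Let sol (D : dynamics) : Prop := D = D1 \/ D = D2.

Lemma sol_solves (D : dynamics) : sol D -> solves_v beta b qs qo v D.
Proof. intros [->| ->]; auto. Qed.
Lemma sol_reg (D : dynamics) : sol D -> regular b D.
Proof. intros H. apply (sol_solves D H). Qed.

Definition close (m d : R) : Prop := forall s t, 0 <= s <= m -> 0 <= t <= m ->
  Rabs (dC D1 s t - dC D2 s t) <= d /\ Rabs (dR D1 s t - dR D2 s t) <= d /\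
  Rabs (dq D1 s - dq D2 s) <= d.

Section Horizon.
Variable T : R.
Hypothesis HT : 0 <= T.

Definition dom (s t u : R) : Prop := 0 <= t <= s /\ s <= T /\ 0 <= u <= s.

(** A good functional at [(s, t, u)] depends on the dynamics up to time [s] in a
    bounded and Lipschitz way; every term of the equations is one.  The
    Lipschitz condition is only asked between [D1] and [D2]. *)
Definition good (F : dynamics -> R -> R -> R -> R) : Prop :=
  exists B K, 0 <= B /\ 0 <= K /\ forall s t u, dom s t u ->
    (forall D, sol D -> Rabs (F D s t u) <= B) /\
    forall d, 0 <= d -> close s d -> Rabs (F D1 s t u - F D2 s t u) <= K * d.

Lemma good_const (a : R) : good (fun _ _ _ _ => a).
Proof.
exists (Rabs a), 0. split; [apply Rabs_pos|split; [lra|]]. split; [intros; lra|].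
intros d Hd _. rewrite Rminus_diag, Rabs_R0. lra.
Qed.

Lemma good_plus (F G : dynamics -> R -> R -> R -> R) : good F -> good G ->
  good (fun D s t u => F D s t u + G D s t u).
Proof.
intros [B [K [HB [HK H]]]] [B' [K' [HB' [HK' H']]]].
exists (B + B'), (K + K'). split; [lra|split; [lra|]].
intros s t u H0. destruct (H s t u H0) as [a1 a3]; destruct (H' s t u H0) as [b1 b3]. split.
- intros D HD. specialize (a1 D HD). specialize (b1 D HD).
  eapply Rle_trans; [apply Rabs_triang|lra].
- intros d Hd Hc. specialize (a3 d Hd Hc). specialize (b3 d Hd Hc).
  replace (_ - _) with ((F D1 s t u - F D2 s t u) + (G D1 s t u - G D2 s t u)) by ring.
  eapply Rle_trans; [apply Rabs_triang|lra].
Qed.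

Lemma good_mult (F G : dynamics -> R -> R -> R -> R) : good F -> good G ->
  good (fun D s t u => F D s t u * G D s t u).
Proof.
intros [B [K [HB [HK H]]]] [B' [K' [HB' [HK' H']]]].
exists (B * B'), (B * K' + K * B').
split; [now apply Rmult_le_pos|]. split.
{ apply Rplus_le_le_0_compat; now apply Rmult_le_pos. }
intros s t u H0. destruct (H s t u H0) as [a1 a3]; destruct (H' s t u H0) as [b1 b3]. split.
- intros D HD. rewrite Rabs_mult. apply Rmult_le_compat; auto; apply Rabs_pos.
- intros d Hd Hc. specialize (a3 d Hd Hc). specialize (b3 d Hd Hc).
  replace (_ - _) with (F D1 s t u * (G D1 s t u - G D2 s t u) +
    (F D1 s t u - F D2 s t u) * G D2 s t u) by ring.
  eapply Rle_trans; [apply Rabs_triang|]. rewrite !Rabs_mult.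
  replace ((B * K' + K * B') * d) with (B * (K' * d) + (K * d) * B') by ring.
  apply Rplus_le_compat; apply Rmult_le_compat; try apply Rabs_pos; auto.
  + apply a1; now left.
  + apply b1; now right.
Qed.

Lemma good_ext (F G : dynamics -> R -> R -> R -> R) : good F ->
  (forall D s t u, sol D -> dom s t u -> F D s t u = G D s t u) -> good G.
Proof.
intros [B [K [HB [HK H]]]] HE. exists B, K; split; [auto|split; [auto|]].
intros s t u Hd. destruct (H s t u Hd) as [a1 a2]. split.
- intros D HD. rewrite <- HE; auto.
- intros d. rewrite <- !HE by (auto; now (left + right)). apply a2.
Qed.

Lemma good_minus (F G : dynamics -> R -> R -> R -> R) : good F -> good G ->
  good (fun D s t u => F D s t u - G D s t u).
Proof.
intros Hf Hg. apply (good_ext (fun D s t u => F D s t u + -1 * G D s t u)); [|intros; ring].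
apply good_plus; auto. apply good_mult; auto. apply good_const.
Qed.

Lemma good_diag (F : dynamics -> R -> R -> R -> R) : good F ->
  good (fun D s _ u => F D s s u).
Proof.
intros [B [K [HB [HK H]]]]. exists B, K; split; [auto|split; [auto|]].
intros s t u [Hd1 [Hd2 Hd3]]. apply H. unfold dom; lra.
Qed.

Lemma good_int (F : dynamics -> R -> R -> R -> R) (a c : R -> R -> R) : good F ->
  (forall s t, 0 <= t <= s -> s <= T -> 0 <= a s t /\ a s t <= c s t /\ c s t <= s /\
    forall D, sol D -> ex_RInt (F D s t) (a s t) (c s t)) ->
  good (fun D s t _ => RInt (F D s t) (a s t) (c s t)).
Proof.
intros [B [K [HB [HK H]]]] Ha. exists (T * B), (T * K).
split; [now apply Rmult_le_pos|]. split; [now apply Rmult_le_pos|].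
intros s t u [Hd1 [Hd2 Hd3]].
destruct (Ha s t Hd1 Hd2) as [a0 [a1 [a2 X]]].
assert (Hdom : forall x, a s t <= x <= c s t -> dom s t x) by (intros; unfold dom; lra).
split.
- intros D HD. eapply Rle_trans; [apply (abs_RInt_le_const _ _ _ B); auto|].
  + intros x Hx. now apply H; auto.
  + apply Rmult_le_compat_r; lra.
- intros d Hd Hc.
  assert (X1 := X D1 (or_introl eq_refl)). assert (X2 := X D2 (or_intror eq_refl)).
  rewrite <- RInt_Rminus by auto.
  eapply Rle_trans; [apply (abs_RInt_le_const _ _ _ (K * d)); auto|].
  + now apply ex_RInt_Rminus.
  + intros x Hx. now apply H; auto.
  + rewrite Rmult_assoc. apply Rmult_le_compat_r; [now apply Rmult_le_pos|lra].
Qed.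

Lemma good_field (F : dynamics -> R -> R -> R) (p r : R -> R -> R -> R) :
  (forall D, sol D -> exists M, forall s t, 0 <= s -> 0 <= t -> Rabs (F D s t) <= M) ->
  (forall m d, close m d -> forall s t, 0 <= s <= m -> 0 <= t <= m ->
    Rabs (F D1 s t - F D2 s t) <= d) ->
  (forall s t u, dom s t u -> 0 <= p s t u <= s /\ 0 <= r s t u <= s) ->
  good (fun D s t u => F D (p s t u) (r s t u)).
Proof.
intros HF HL Hp. destruct (HF D1 (or_introl eq_refl)) as [M1 H1].
destruct (HF D2 (or_intror eq_refl)) as [M2 H2].
exists (Rmax 0 (Rmax M1 M2)), 1. split; [apply Rmax_l|split; [lra|]]. intros s t u Hd.
destruct (Hp s t u Hd) as [P1 P2].
assert (L1 := Rmax_l M1 M2). assert (L2 := Rmax_r M1 M2). assert (L3 := Rmax_r 0 (Rmax M1 M2)).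
split.
- intros D [->| ->]; eapply Rle_trans; [apply H1| |apply H2|]; lra.
- intros d Hd0 Hc. rewrite Rmult_1_l. now apply (HL s).
Qed.

Lemma good_C (p r : R -> R -> R -> R) :
  (forall s t u, dom s t u -> 0 <= p s t u <= s /\ 0 <= r s t u <= s) ->
  good (fun D s t u => dC D (p s t u) (r s t u)).
Proof.
apply (good_field dC).
- intros D HD. destruct (reg_bound b D (sol_reg D HD)) as [M [_ H]]. exists M; intros; now apply H.
- intros m d H s t Hs Ht; now apply H.
Qed.

Lemma good_R (p r : R -> R -> R -> R) :
  (forall s t u, dom s t u -> 0 <= p s t u <= s /\ 0 <= r s t u <= s) ->
  good (fun D s t u => dR D (p s t u) (r s t u)).
Proof.
apply (good_field dR).
- intros D HD. destruct (reg_bound b D (sol_reg D HD)) as [M [_ H]]. exists M; intros; now apply H.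
- intros m d H s t Hs Ht; now apply H.
Qed.

Lemma good_q (p : R -> R -> R -> R) : (forall s t u, dom s t u -> 0 <= p s t u <= s) ->
  good (fun D s t u => dq D (p s t u)).
Proof.
intros Hp. apply (good_field (fun D s _ => dq D s) p p); auto.
- intros D HD. destruct (reg_bound b D (sol_reg D HD)) as [M [_ H]]. exists M; intros s t Hs Ht.
  now apply (H s t).
- intros m d H s t Hs Ht; now apply (H s t).
Qed.

Lemma good_comp (g g' : R -> R) (rho : R) (F : dynamics -> R -> R -> R -> R) :
  0 <= rho -> in_disk b rho ->
  (forall x, in_disk b x -> is_derive g x (g' x)) -> (forall x, in_disk b x -> continuous g' x) ->
  good F -> (forall D s t u, sol D -> dom s t u -> Rabs (F D s t u) <= rho) ->
  good (fun D s t u => g (F D s t u)).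
Proof.
intros Hr Hir Hd Hc' [B [K [HB [HK H]]]] Hf.
assert (Hin : forall x, - rho <= x <= rho -> in_disk b x).
{ intros x Hx. apply (in_disk_le b x rho); auto. rewrite (Rabs_right rho) by lra. apply Rabs_le; lra. }
destruct (lip_on g g' (- rho) rho) as [l [Hl HL]]; [lra|auto|auto|].
destruct (bounded_on g (- rho) rho) as [B' [HB' HBb]]; [lra| |].
{ apply continuous_on_forall; intros x Hx. eapply derive_cont, Hd, Hin, Hx. }
exists B', (l * K). split; auto. split; [now apply Rmult_le_pos|].
intros s t u Hdom. split.
- intros D HD. now apply HBb, Rabs_le_between, Hf.
- intros d Hd0 Hcl. eapply Rle_trans; [apply HL; apply Rabs_le_between, Hf; auto; now (left + right)|].
  rewrite Rmult_assoc. apply Rmult_le_compat_l; auto. now apply H.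
Qed.

Lemma common_rho : exists rho, 0 <= rho /\ in_disk b rho /\ forall D, sol D ->
  (forall s t, 0 <= s <= T -> 0 <= t <= T -> Rabs (dC D s t) <= rho) /\
  (forall s, 0 <= s <= T -> Rabs (dq D s) <= rho).
Proof.
destruct (reg_rho b D1 (sol_reg D1 (or_introl eq_refl)) T HT) as [r1 [H1 [H2 [H3 H4]]]].
destruct (reg_rho b D2 (sol_reg D2 (or_intror eq_refl)) T HT) as [r2 [K1 [K2 [K3 K4]]]].
assert (L1 := Rmax_l r1 r2). assert (L2 := Rmax_r r1 r2).
exists (Rmax r1 r2). split; [lra|]. split; [unfold Rmax; destruct Rle_dec; auto|].
intros D [->| ->]; split; intros.
- specialize (H3 s t H H0). lra.
- specialize (H4 s H). lra.
- specialize (K3 s t H H0). lra.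
- specialize (K4 s H). lra.
Qed.

Lemma good_nuC (g g' : R -> R) (p r : R -> R -> R -> R) :
  (forall x, in_disk b x -> is_derive g x (g' x)) -> (forall x, in_disk b x -> continuous g' x) ->
  (forall s t u, dom s t u -> 0 <= p s t u <= s /\ 0 <= r s t u <= s) ->
  good (fun D s t u => g (dC D (p s t u) (r s t u))).
Proof.
intros Hg Hg' Hp. destruct common_rho as [rho [H1 [H2 H3]]].
apply (good_comp g g' rho (fun D s t u => dC D (p s t u) (r s t u))); auto; [now apply good_C|].
intros D s t u HD Hd. destruct (Hp s t u Hd). destruct Hd. apply H3; auto; lra.
Qed.

Lemma good_nuq (g g' : R -> R) (p : R -> R -> R -> R) :
  (forall x, in_disk b x -> is_derive g x (g' x)) -> (forall x, in_disk b x -> continuous g' x) ->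
  (forall s t u, dom s t u -> 0 <= p s t u <= s) ->
  good (fun D s t u => g (dq D (p s t u))).
Proof.
intros Hg Hg' Hp. destruct common_rho as [rho [H1 [H2 H3]]].
apply (good_comp g g' rho (fun D s t u => dq D (p s t u))); auto; [now apply good_q|].
intros D s t u HD Hd. specialize (Hp s t u Hd). destruct Hd. apply H3; auto; lra.
Qed.

Ltac good_nu := intros; lazymatch goal with
  | |- is_derive (nu1 _) _ _ => now apply is_derive_nu1
  | |- is_derive (nu2 _) _ _ => now apply is_derive_nu2
  | |- continuous (nu2 _) _ => now apply continuous_nu2
  | |- continuous (nu3 _) _ => now apply continuous_nu3 end.
Ltac good := lazymatch goal with
  | |- good (fun D s t u => @?F D s t u + @?G D s t u) => apply (good_plus F G); good
  | |- good (fun D s t u => @?F D s t u - @?G D s t u) => apply (good_minus F G); good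
  | |- good (fun D s t u => @?F D s t u * @?G D s t u) => apply (good_mult F G); good
  | |- good (fun D s t u => dC D (@?p s t u) (@?r s t u)) =>
      apply (good_C p r); unfold dom; intros; lra
  | |- good (fun D s t u => dR D (@?p s t u) (@?r s t u)) =>
      apply (good_R p r); unfold dom; intros; lra
  | |- good (fun D s t u => dq D (@?p s t u)) => apply (good_q p); unfold dom; intros; lra
  | |- good (fun D s t u => nu1 b (dC D (@?p s t u) (@?r s t u))) =>
      apply (good_nuC (nu1 b) (nu2 b) p r); [good_nu|good_nu|unfold dom; intros; lra]
  | |- good (fun D s t u => nu2 b (dC D (@?p s t u) (@?r s t u))) =>
      apply (good_nuC (nu2 b) (nu3 b) p r); [good_nu|good_nu|unfold dom; intros; lra]
  | |- good (fun D s t u => nu1 b (dq D (@?p s t u))) =>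
      apply (good_nuq (nu1 b) (nu2 b) p); [good_nu|good_nu|unfold dom; intros; lra]
  | |- good (fun D s t u => nu2 b (dq D (@?p s t u))) =>
      apply (good_nuq (nu2 b) (nu3 b) p); [good_nu|good_nu|unfold dom; intros; lra]
  | |- good (fun _ _ _ _ => ?a) => apply (good_const a)
  | |- _ => auto
  end.

Lemma good_L : good (fun D s t _ => dL b qs D t).
Proof.
unfold dL. good.
apply (good_int (fun D s t u => dR D t u * nu1 b (dq D u)) (fun _ _ => 0) (fun _ t => t)); [good|].
intros s t Ht Hs. repeat split; try lra. intros D HD. apply ex_int3; [now apply sol_reg|lra].
Qed.
Lemma good_Ls : good (fun D s t _ => dL b qs D s).
Proof. exact (good_diag _ good_L). Qed.

Lemma good_vx : good (fun D s t _ => v_x v (dq D s) (dC D s 0)).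
Proof.
apply (good_ext (fun D s t u => vx_val b qs qo w2 w3 (w4 * zc qs qo) (dq D s) (dC D s 0))).
- unfold vx_val, psi, Rdiv. good.
- intros D s t u HD Hd. symmetry; apply v_x_of, reg_disk_q; [now apply sol_reg|destruct Hd; lra].
Qed.

Lemma good_vy : good (fun D s t _ => v_y v (dq D s) (dC D s 0)).
Proof.
apply (good_ext (fun D s t u => vy_val b w1 (w4 * zc qs qo) (dq D s) (dC D s 0))).
- unfold vy_val. good.
- intros D s t u HD Hd. symmetry; apply v_y_of, reg_disk_C; [now apply sol_reg|destruct Hd; lra|lra].
Qed.

Hint Resolve good_L good_Ls good_vx good_vy : core.

Lemma good_A : good (fun D s t _ => A D s t).
Proof.
unfold A, A_C. good.
- apply (good_int (fun D s t u => dR D s u * nu2 b (dC D s u) * dC D u t) (fun _ _ => 0) (fun s _ => s));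
   [good|].
  intros s t Ht Hs. repeat split; try lra. intros D HD. apply ex_int1; [now apply sol_reg|lra|lra].
- apply (good_int (fun D s t u => dR D t u * nu1 b (dC D s u)) (fun _ _ => 0) (fun _ t => t));
   [good|].
  intros s t Ht Hs. repeat split; try lra. intros D HD. apply ex_int2; [now apply sol_reg|lra|lra].
Qed.

Lemma good_mu : good (fun D s t _ => - (1 / 2 + beta * A D s s)).
Proof.
apply (good_ext (fun D s t _ => -1 * (1 / 2 + beta * A D s s))); [|intros; ring].
assert (H := good_diag _ good_A). good.
Qed.

Hint Resolve good_A good_mu : core.

Lemma good_dC : good (fun D s t _ => - (1 / 2 + beta * A D s s) * dC D s t + beta * A D s t).
Proof. good. Qed.

Lemma good_dR : good (fun D s t _ => - (1 / 2 + beta * A D s s) * dR D s t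
     + beta ^ 2 * RInt (fun u => dR D u t * dR D s u * nu2 b (dC D s u)) t s).
Proof.
good.
apply (good_int (fun D s t u => dR D u t * dR D s u * nu2 b (dC D s u)) (fun _ t => t) (fun s _ => s));
 [good|].
intros s t Ht Hs. repeat split; try lra. intros D HD. apply ex_int5; [now apply sol_reg|lra].
Qed.

Lemma good_dq : good (fun D s t _ =>
  - (1 / 2 + beta * A D s s) * dq D s + beta * A_q beta b qs qo v D s).
Proof.
unfold A_q. good.
apply (good_int (fun D s t u => dR D s u * dq D u * nu2 b (dC D s u)) (fun _ _ => 0) (fun s _ => s));
 [good|].
intros s t Ht Hs. repeat split; try lra. intros D HD. apply ex_int4; [now apply sol_reg|lra].
Qed.

(** ** Contraction in an exponentially weighted norm *)

Definition near_exp (S L : R) : Prop := forall s t, 0 <= t <= s -> s <= T ->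
  Rabs (dC D1 s t - dC D2 s t) <= S * exp (L * s) /\
  Rabs (dR D1 s t - dR D2 s t) <= S * exp (L * s) /\
  Rabs (dq D1 s - dq D2 s) <= S * exp (L * s).

Lemma near_close (S L m : R) : 0 <= S -> 0 <= L -> near_exp S L -> 0 <= m <= T ->
  close m (S * exp (L * m)).
Proof.
intros HS HL H Hm s t Hs Ht.
assert (He : forall x, 0 <= x <= m -> S * exp (L * x) <= S * exp (L * m)).
{ intros x Hx. apply Rmult_le_compat_l, exp_le, Rmult_le_compat_l; lra. }
destruct (Rle_dec t s) as [Hts|Hts].
- destruct (H s t) as [a1 [a2 a3]]; try lra. specialize (He s Hs). lra.
- destruct (H t s) as [a1 [a2 a3]]; try lra. destruct (H s s) as [_ [_ a4]]; try lra.
  assert (He1 := He s Hs). assert (He2 := He t Ht).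
  destruct S1 as [[_ [Y1 [_ [_ [Z1 _]]]]] _]. destruct S2 as [[_ [Y2 [_ [_ [Z2 _]]]]] _].
  rewrite (Y1 s t), (Y2 s t), (Z1 s t), (Z2 s t) by lra.
  repeat split; try lra. rewrite Rminus_diag, Rabs_R0.
  apply Rmult_le_pos; auto. left; apply exp_pos.
Qed.

Lemma growth (f df : R -> R) (S L K t s : R) : t <= s -> 0 <= S -> 0 < L -> 2 * K <= L ->
  continuous_on (fun x => t <= x <= s) f ->
  (forall x, t < x < s -> is_derive f x (df x)) ->
  (forall x, t < x < s -> Rabs (df x) <= K * (S * exp (L * x))) -> f t = 0 ->
  Rabs (f s) <= S / 2 * exp (L * s).
Proof.
intros Hts HS HL HK Hc Hd Hb H0.
assert (H : Rabs (f s - f t) <= S / 2 * exp (L * s) - S / 2 * exp (L * t)).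
{ apply (mvt_abs f (fun x => S / 2 * exp (L * x)) df (fun x => L / 2 * (S * exp (L * x)))); auto.
  - apply continuous_on_forall; intros; apply continuous_exp_scal.
  - intros x Hx. auto_derive; auto. field.
  - intros x Hx. eapply Rle_trans; [now apply Hb|].
    apply Rmult_le_compat_r; [|lra]. apply Rmult_le_pos; auto. left; apply exp_pos. }
rewrite H0, Rminus_0_r in H.
assert (0 <= S / 2 * exp (L * t)).
{ apply Rmult_le_pos; [lra|]. left; apply exp_pos. }
lra.
Qed.

(** The right-hand sides are Lipschitz with some constant [K], so integrating them
    against the weight [exp (L s)] with [L > 2 K] halves the distance. *)
Lemma near_contract : exists L, 0 <= L /\ forall S, 0 <= S -> near_exp S L -> near_exp (S / 2) L.
Proof.
destruct good_dC as [Bc [Kc [HBc [HKc Hc]]]].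
destruct good_dR as [Br [Kr [HBr [HKr Hr]]]].
destruct good_dq as [Bq [Kq [HBq [HKq Hq]]]].
set (K := Kc + Kr + Kq). set (L := 2 * K + 1).
assert (HL : 0 < L) by (unfold L, K; lra).
exists L. split; [lra|]. intros S HS HN s t Ht HsT.
assert (W : forall (F G : dynamics -> R -> R) (k t : R), 0 <= k <= K -> 0 <= t <= s ->
  (forall D, sol D -> continuous_on (fun x => t <= x <= s) (F D) /\
     forall x, t < x < s -> is_derive (F D) x (G D x)) ->
  (forall x d, t < x < s -> 0 <= d -> close x d -> Rabs (G D1 x - G D2 x) <= k * d) ->
  F D1 t = F D2 t -> Rabs (F D1 s - F D2 s) <= S / 2 * exp (L * s)).
{ intros F G k t' Hk Ht' HF HG HE.
  destruct (HF D1 (or_introl eq_refl)) as [F1 G1]. destruct (HF D2 (or_intror eq_refl)) as [F2 G2].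
  apply (growth (fun x => F D1 x - F D2 x) (fun x => G D1 x - G D2 x) S L K t' s);
   auto; try (unfold L; lra).
  - now apply continuous_on_minus.
  - intros x Hx. apply deriv_minus; auto.
  - intros x Hx.
    assert (He : 0 <= S * exp (L * x)) by (apply Rmult_le_pos; auto; left; apply exp_pos).
    apply Rle_trans with (k * (S * exp (L * x))); [|apply Rmult_le_compat_r; lra].
    apply HG; auto. apply near_close; auto; lra. }
split; [|split].
- apply (W (fun D x => dC D x t) (fun D x => - (1 / 2 + beta * A D x x) * dC D x t + beta * A D x t) Kc t);
   auto; [unfold K; lra| | |].
  + intros D HD. destruct (sol_solves D HD) as [[r [_ [_ [_ [_ [_ [_ FC]]]]]]] _]. split.
    * apply (on_sub _ _ _ (fun u => 0 <= u)); [apply (reg_C_fst b D r); lra|intros; lra].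
    * intros x Hx; apply FC; lra.
  + intros x d Hx. apply (Hc x t 0). unfold dom; lra.
  + destruct S1 as [[_ [_ [d1 _]]] _]. destruct S2 as [[_ [_ [d2 _]]] _]. rewrite d1, d2 by lra. auto.
- apply (W (fun D x => dR D x t) (fun D x => - (1 / 2 + beta * A D x x) * dR D x t
     + beta ^ 2 * RInt (fun u => dR D u t * dR D x u * nu2 b (dC D x u)) t x) Kr t);
   auto; [unfold K; lra| | |].
  + intros D HD. destruct (sol_solves D HD) as [[r [_ [_ [_ [_ [_ [FR _]]]]]]] _]. split.
    * apply (on_sub _ _ _ (fun u => t <= u)); [apply (reg_R_fst b D r); lra|intros; lra].
    * intros x Hx; apply FR; lra.
  + intros x d Hx. apply (Hr x t 0). unfold dom; lra.
  + destruct S1 as [[_ [_ [_ [e1 _]]]] _]. destruct S2 as [[_ [_ [_ [e2 _]]]] _].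
    rewrite e1, e2 by lra. auto.
- apply (W dq (fun D x => - (1 / 2 + beta * A D x x) * dq D x + beta * A_q beta b qs qo v D x) Kq 0);
   auto; [unfold K; lra|lra| | |].
  + intros D HD. destruct (sol_solves D HD) as [[r _] [_ [Hd _]]]. split.
    * apply (on_sub _ _ _ (fun u => 0 <= u)); [apply (reg_q b D r)|intros; lra].
    * intros x Hx; apply Hd; lra.
  + intros x d Hx. apply (Hq x 0 0). unfold dom; lra.
  + destruct S1 as [_ [q1 _]]. destruct S2 as [_ [q2 _]]. now rewrite q1, q2.
Qed.

Lemma eq_on_horizon (s t : R) : 0 <= t <= s -> s <= T ->
  dC D1 s t = dC D2 s t /\ dR D1 s t = dR D2 s t /\ dq D1 s = dq D2 s.
Proof.
intros Ht Hs. destruct near_contract as [L [HL HL0]].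
destruct (reg_bound b D1 (sol_reg D1 (or_introl eq_refl))) as [M1 [H1 HM1]].
destruct (reg_bound b D2 (sol_reg D2 (or_intror eq_refl))) as [M2 [H2 HM2]].
assert (Hn : forall n, near_exp ((M1 + M2) * (1 / 2) ^ n) L).
{ induction n as [|n IH].
  - intros x y Hy Hx.
    assert (Hb : M1 + M2 <= (M1 + M2) * (1 / 2) ^ 0 * exp (L * x)).
    { assert (1 <= exp (L * x)) by (apply exp_ge_1, Rmult_le_pos; lra). simpl. nra. }
    destruct (HM1 x y) as [a1 [a2 a3]]; try lra. destruct (HM2 x y) as [b1 [b2 b3]]; try lra.
    unfold Rminus. repeat split; (eapply Rle_trans; [apply Rabs_triang|rewrite Rabs_Ropp; lra]).
  - replace ((M1 + M2) * (1 / 2) ^ S n) with ((M1 + M2) * (1 / 2) ^ n / 2) by (simpl; field).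
    apply HL0; auto. apply Rmult_le_pos; [lra|]. left; apply pow_half_pos. }
repeat split; apply (eq_of_geom _ _ ((M1 + M2) * exp (L * s))); intros n;
 destruct (Hn n s t Ht Hs) as [? [? ?]]; lra.
Qed.
End Horizon.

Theorem solves_v_unique : eq_dynamics D1 D2.
Proof.
assert (H : forall s t, 0 <= t <= s ->
  dC D1 s t = dC D2 s t /\ dR D1 s t = dR D2 s t /\ dq D1 s = dq D2 s).
{ intros s t Ht. apply (eq_on_horizon s); lra. }
destruct S1 as [[_ [Y1 [_ [_ [Z1 [X1 _]]]]]] [_ [_ H1]]].
destruct S2 as [[_ [Y2 [_ [_ [Z2 [X2 _]]]]]] [_ [_ H2]]].
assert (U1 : forall s t, 0 <= s -> 0 <= t -> dC D1 s t = dC D2 s t /\ dR D1 s t = dR D2 s t).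
{ intros s t Hs Ht. destruct (Rle_dec t s) as [Hts|Hts].
  - destruct (H s t) as [? [? ?]]; auto.
  - rewrite (Y1 s t), (Y2 s t), (Z1 s t), (Z2 s t) by lra. split; auto. apply (H t s); lra. }
assert (U2 : forall s, 0 <= s -> dq D1 s = dq D2 s) by (intros s Hs; apply (H s s); lra).
split.
- intros s t Hs Ht. destruct (U1 s t Hs Ht) as [a1 a2]. repeat split; auto.
  rewrite X1, X2 by auto. apply RInt_ext_le; auto. intros u Hu. apply U1; lra.
- intros s Hs. split; auto.
  assert (HLs : dL b qs D1 s = dL b qs D2 s).
  { unfold dL. f_equal. apply RInt_ext_le; auto. intros u Hu.
    rewrite (proj2 (U1 s u Hs ltac:(lra))), (U2 u) by lra. reflexivity. }
  rewrite H1, H2 by auto. rewrite HLs, U2, (proj1 (U1 s 0 Hs (Rle_refl 0))) by auto.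
  do 3 f_equal. apply RInt_ext_le; auto. intros u Hu.
  destruct (U1 s u Hs ltac:(lra)) as [-> ->]. reflexivity.
Qed.
End Unique.

(** * Consequences of stationarity at small times *)

(** ** Limits at time 0 and at the corner of the set of pairs of times *)

Definition lim0 (f : R -> R) (l : R) : Prop := filterlim f (at_right 0) (locally l).

Definition tri (p : R * R) : Prop := 0 <= snd p <= fst p.
Definition limtri (F : R -> R -> R) (l : R) : Prop :=
  filterlim (fun p => F (fst p) (snd p)) (within tri (locally (0, 0))) (locally l).

Lemma lim0_const (a : R) : lim0 (fun _ => a) a.
Proof. apply filterlim_const. Qed.

Lemma lim0_plus (f g : R -> R) (a c : R) : lim0 f a -> lim0 g c -> lim0 (fun s => f s + g s) (a + c).
Proof.
intros Hf Hg. apply (filterlim_comp_2 (G := locally a) (H := locally c) _ _ Rplus); auto.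
apply (filterlim_plus (K := R_AbsRing) (V := R_NormedModule)).
Qed.

Lemma lim0_mult (f g : R -> R) (a c : R) : lim0 f a -> lim0 g c -> lim0 (fun s => f s * g s) (a * c).
Proof.
intros Hf Hg. apply (filterlim_comp_2 (G := locally a) (H := locally c) _ _ Rmult); auto.
apply (filterlim_mult (K := R_AbsRing)).
Qed.

Lemma lim0_opp (f : R -> R) (a : R) : lim0 f a -> lim0 (fun s => - f s) (- a).
Proof.
intros Hf. eapply filterlim_comp; [apply Hf|].
apply (filterlim_opp (K := R_AbsRing) (V := R_NormedModule)).
Qed.

Lemma lim0_minus (f g : R -> R) (a c : R) : lim0 f a -> lim0 g c -> lim0 (fun s => f s - g s) (a - c).
Proof. intros Hf Hg. apply lim0_plus; auto. now apply lim0_opp. Qed.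

Lemma lim0_eq (f : R -> R) (a l : R) : lim0 f a -> a = l -> lim0 f l.
Proof. now intros H <-. Qed.

Lemma at_right_pos (P : R -> Prop) : (forall s, 0 < s -> P s) -> at_right 0 P.
Proof. intros H. exists (mkposreal 1 Rlt_0_1). intros y _ Hy. now apply H. Qed.

Lemma lim0_ext (f g : R -> R) (l : R) : (forall s, 0 < s -> f s = g s) -> lim0 f l -> lim0 g l.
Proof. intros H. apply filterlim_ext_loc, at_right_pos, H. Qed.

Lemma lim0_unique (f : R -> R) (a c : R) : lim0 f a -> lim0 f c -> a = c.
Proof.
intros Ha Hc.
apply (filterlim_locally_unique (K := R_AbsRing) (V := R_NormedModule) (F := at_right 0) f); auto.
Qed.

Lemma lim0_on (f : R -> R) : continuous_on (fun u => 0 <= u) f -> lim0 f (f 0).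
Proof.
intros H P HP. specialize (H 0 (Rle_refl 0) P HP).
destruct H as [d Hd]. exists d. intros y Hy Hy0. apply Hd; auto; lra.
Qed.

Lemma lim0_comp (f g : R -> R) (l : R) : lim0 f l -> continuous g l -> lim0 (fun s => g (f s)) (g l).
Proof. intros Hf Hg. eapply filterlim_comp; [apply Hf|apply Hg]. Qed.

Lemma limtri_mult (F G : R -> R -> R) (a c : R) : limtri F a -> limtri G c ->
  limtri (fun s u => F s u * G s u) (a * c).
Proof.
intros Hf Hg. apply (filterlim_comp_2 (G := locally a) (H := locally c) _ _ Rmult); auto.
apply (filterlim_mult (K := R_AbsRing)).
Qed.

Lemma limtri_comp (F : R -> R -> R) (g : R -> R) (l : R) : limtri F l -> continuous g l ->
  limtri (fun s u => g (F s u)) (g l).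
Proof. intros Hf Hg. eapply filterlim_comp; [apply Hf|apply Hg]. Qed.

Lemma limtri_const (a : R) : limtri (fun _ _ => a) a.
Proof.
intros P HP. exists (mkposreal 1 Rlt_0_1). intros p _ _. exact (locally_singleton a P HP).
Qed.

Lemma limtri_on (F : R -> R -> R) :
  continuous_on (fun p : R * R => 0 <= snd p <= fst p) (fun p => F (fst p) (snd p)) ->
  limtri F (F 0 0).
Proof. intros H. apply (H (0, 0)). simpl; lra. Qed.

Lemma limtri_ext (F G : R -> R -> R) (l : R) : (forall s u, 0 <= u <= s -> F s u = G s u) ->
  limtri F l -> limtri G l.
Proof.
intros H. apply filterlim_ext_loc.
exists (mkposreal 1 Rlt_0_1). intros [s u] _ Ht; simpl. apply H, Ht.
Qed.

(** The only point is that [F] has a limit as both times go to 0 together: the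
    triangle [0 <= u <= s] shrinks to the corner. *)
Lemma limtri_mean (F : R -> R -> R) (l : R) : limtri F l ->
  (forall s, 0 <= s -> ex_RInt (F s) 0 s) -> lim0 (fun s => RInt (F s) 0 s / s) l.
Proof.
intros HF Hex P [e He].
assert (He2 : 0 < e / 2) by (generalize (cond_pos e); lra).
destruct (HF _ (locally_ball l (mkposreal _ He2))) as [d Hd].
exists d. intros s Hs Hs0. apply He, (proj2 (ball_R _ _ _)).
apply ball_Rabs in Hs. rewrite Rminus_0_r, Rabs_right in Hs by lra.
assert (Hb : forall u, 0 <= u <= s -> Rabs (F s u - l) <= e / 2).
{ intros u Hu. left. apply (ball_Rabs l (e / 2)). apply (Hd (s, u)).
  - split; apply (proj2 (ball_R _ _ _)); simpl; rewrite Rminus_0_r, Rabs_right; lra.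
  - unfold tri; simpl; lra. }
assert (HI : Rabs (RInt (fun u => F s u - l) 0 s) <= (s - 0) * (e / 2)).
{ apply abs_RInt_le_const; auto; [lra|].
  apply ex_RInt_Rminus; [apply Hex; lra|apply ex_RInt_const]. }
rewrite RInt_Rminus, RInt_Rconst in HI by first [apply Hex; lra|apply ex_RInt_const].
replace (RInt (F s) 0 s / s - l) with ((RInt (F s) 0 s - (s - 0) * l) / s) by (field; lra).
unfold Rdiv at 1. rewrite Rabs_mult, (Rabs_right (/ s)) by (apply Rle_ge; left; now apply Rinv_0_lt_compat).
apply Rle_lt_trans with ((s - 0) * (e / 2) * / s).
- apply Rmult_le_compat_r; auto. left; now apply Rinv_0_lt_compat.
- replace ((s - 0) * (e / 2) * / s) with (e / 2) by (field; lra). lra.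
Qed.

Lemma lim0_of_mean (f : R -> R) (l : R) : lim0 (fun s => f s / s) l -> lim0 f 0.
Proof.
intros Hf. apply (lim0_eq _ (l * 0)); [|ring].
apply (lim0_ext (fun s => f s / s * s)); [intros; field; lra|].
apply lim0_mult; auto.
apply (lim0_on (fun s => s)). apply continuous_on_forall; intros; apply continuous_id.
Qed.

Lemma limtri_int0 (F : R -> R -> R) (l : R) : limtri F l ->
  (forall s, 0 <= s -> ex_RInt (F s) 0 s) -> lim0 (fun s => RInt (F s) 0 s) 0.
Proof. intros HF Hex. eapply lim0_of_mean, limtri_mean; eauto. Qed.

(** ** The equations of the dynamics at small times *)

(** The hypotheses keep of [v] only its shape along [x = q_o], which is common to all
    cases of [is_v]. *)
Section Necessity.
Variables (b : nat -> R) (beta qs qo : R) (v : R -> R -> R) (D : dynamics) (w1 a0 a1 a2 : R).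
Hypothesis Hb : mixture b.
Let A := A_C beta b qs v D.
Hypothesis HS : CR_system beta b A D.
Hypothesis Hq : forall s, 0 <= s -> dq D s = qo.
Hypothesis Eq : forall s, 0 < s -> is_derive (dq D) s
  (- (1 / 2 + beta * A s s) * dq D s + beta * A_q beta b qs qo v D s).
Hypothesis Hvx : forall y, in_disk b y -> v_x v qo y = a0 + a1 * y.
Hypothesis Hvy : forall y, in_disk b y -> is_derive (v qo) y (w1 * nu1 b y + a2).

Lemma nec_reg : regular b D. Proof. apply HS. Qed.
Lemma in_disk_1 : in_disk b 1. Proof. apply in_disk_01; auto; lra. Qed.
Lemma nec_C00 : dC D 0 0 = 1.
Proof. destruct HS as [_ [_ [H _]]]; apply H; lra. Qed.
Lemma nec_R00 : dR D 0 0 = 1.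
Proof. destruct HS as [_ [_ [_ [H _]]]]; apply H; lra. Qed.

Lemma lim_R : limtri (dR D) 1.
Proof. rewrite <- nec_R00. apply limtri_on. apply nec_reg. Qed.
Lemma lim_C : limtri (dC D) 1.
Proof.
rewrite <- nec_C00. apply limtri_on. eapply continuous_on_subset; [|apply nec_reg].
intros [s u]; simpl; intros; lra.
Qed.
Lemma lim_Cswap : limtri (fun s u => dC D u s) 1.
Proof.
apply (limtri_ext (dC D)); [|apply lim_C]. intros s u Hu.
destruct HS as [_ [H _]]. apply H; lra.
Qed.
Lemma lim_C0 : limtri (fun s u => dC D u 0) 1.
Proof.
rewrite <- nec_C00. apply (limtri_on (fun s u => dC D u 0)).
apply (continuous_on_comp_l _ (fun u => 0 <= u) (fun p : R * R => snd p) (fun u => dC D u 0)).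
- apply (reg_C_fst b); [apply nec_reg|lra].
- intros [s u]; simpl; intros; lra.
- intros; apply continuous_snd.
Qed.
Lemma lim_Cs : lim0 (fun s => dC D s 0) 1.
Proof.
rewrite <- nec_C00. apply (lim0_on (fun s => dC D s 0)). apply (reg_C_fst b); [apply nec_reg|lra].
Qed.

Lemma lim_q (f : R -> R) : lim0 (fun s => f (dq D s)) (f qo).
Proof. apply (lim0_ext (fun _ => f qo)); [|apply lim0_const]. intros s Hs; rewrite Hq; auto; lra. Qed.

Ltac lim := lazymatch goal with
  | |- lim0 (fun s => @?f s + @?g s) _ => eapply (lim0_plus f g); lim
  | |- lim0 (fun s => @?f s - @?g s) _ => eapply (lim0_minus f g); lim
  | |- lim0 (fun s => @?f s * @?g s) _ => eapply (lim0_mult f g); lim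
  | |- lim0 (fun s => - @?f s) _ => eapply (lim0_opp f); lim
  | |- lim0 (fun _ => ?a) _ => apply (lim0_const a)
  | |- lim0 (fun s => dq D s) _ => apply (lim_q (fun x => x))
  | |- lim0 (fun s => ?f (dq D s)) _ => apply (lim_q f)
  | |- _ => eauto
  end.

Lemma lim_vx : lim0 (fun s => v_x v (dq D s) (dC D s 0)) (a0 + a1 * 1).
Proof.
apply (lim0_ext (fun s => a0 + a1 * dC D s 0)).
- intros s Hs. rewrite Hq by lra. rewrite Hvx; [reflexivity|apply (reg_disk_C b D nec_reg); lra].
- assert (H := lim_Cs). lim.
Qed.
Lemma lim_vy : lim0 (fun s => v_y v (dq D s) (dC D s 0)) (w1 * nu1 b 1 + a2).
Proof.
apply (lim0_ext (fun s => w1 * nu1 b (dC D s 0) + a2)).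
- intros s Hs. rewrite Hq by lra. symmetry. apply is_derive_unique.
  apply (Hvy (dC D s 0)), (reg_disk_C b D nec_reg); lra.
- lim. apply (lim0_comp (fun s => dC D s 0) (nu1 b)); [apply lim_Cs|apply continuous_nu1, in_disk_1].
Qed.

Lemma lim_Lmean : lim0 (fun s => dL b qs D s / s) (/ nu1 b (qs ^ 2) * (1 * nu1 b qo)).
Proof.
apply (lim0_ext (fun s => / nu1 b (qs ^ 2) *
   (RInt (fun u => dR D s u * nu1 b (dq D u)) 0 s / s))).
- intros s Hs. unfold dL, Rdiv. ring.
- apply lim0_mult; [apply lim0_const|].
  apply (limtri_mean (fun s u => dR D s u * nu1 b (dq D u))).
  + apply limtri_mult; [apply lim_R|].
    apply (limtri_ext (fun _ _ => nu1 b qo)); [|apply limtri_const].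
    intros s u Hu. rewrite Hq; auto; lra.
  + intros s Hs. now apply (ex_int3 b D nec_reg).
Qed.
Lemma lim_L : lim0 (fun s => dL b qs D s) 0.
Proof. eapply lim0_of_mean, lim_Lmean. Qed.
Lemma L_0 : dL b qs D 0 = 0.
Proof. unfold dL. rewrite RInt_pt. ring. Qed.

Hint Resolve lim_Cs lim_vx lim_vy lim_L : core.

Lemma lim_nu2C : limtri (fun s u => nu2 b (dC D s u)) (nu2 b 1).
Proof. apply (limtri_comp (dC D) (nu2 b)); [apply lim_C|apply continuous_nu2, in_disk_1]. Qed.
Lemma lim_nu1C : limtri (fun s u => nu1 b (dC D s u)) (nu1 b 1).
Proof. apply (limtri_comp (dC D) (nu1 b)); [apply lim_C|apply continuous_nu1, in_disk_1]. Qed.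

Let P1 := qo * (a0 + a1 * 1) + 1 * (w1 * nu1 b 1 + a2).

(** As the integrals and [L] vanish at time 0, only the gradient of [v] remains in the
    limit of the equations for [C] and [q]. *)
Lemma lim_Ass : lim0 (fun s => A s s) P1.
Proof.
unfold A, A_C. eapply lim0_eq; [lim|].
- apply (limtri_int0 (fun s u => dR D s u * nu2 b (dC D s u) * dC D u s) (1 * nu2 b 1 * 1)).
  + apply limtri_mult; [apply limtri_mult; [apply lim_R|apply lim_nu2C]|apply lim_Cswap].
  + intros s Hs. now apply (ex_int1 b D nec_reg).
- apply (limtri_int0 (fun s u => dR D s u * nu1 b (dC D s u)) (1 * nu1 b 1)).
  + apply limtri_mult; [apply lim_R|apply lim_nu1C].
  + intros s Hs. now apply (ex_int2 b D nec_reg).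
- unfold P1. ring.
Qed.

Lemma lim_As0 : lim0 (fun s => A s 0) P1.
Proof.
apply (lim0_ext (fun s => beta * RInt (fun u => dR D s u * nu2 b (dC D s u) * dC D u 0) 0 s +
  beta * 0 - beta * (qo * nu2 b (dq D s) * dL b qs D s) - beta * (nu1 b (dq D s) * 0)
  + qo * v_x v (dq D s) (dC D s 0) + 1 * v_y v (dq D s) (dC D s 0))).
{ intros s Hs. unfold A, A_C. now rewrite RInt_pt, L_0, (Hq 0 (Rle_refl 0)), nec_C00. }
eapply lim0_eq; [lim|].
- apply (limtri_int0 (fun s u => dR D s u * nu2 b (dC D s u) * dC D u 0) (1 * nu2 b 1 * 1)).
  + apply limtri_mult; [apply limtri_mult; [apply lim_R|apply lim_nu2C]|apply lim_C0].
  + intros s Hs. apply (ex_int1 b D nec_reg); lra.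
- unfold P1. ring.
Qed.

Lemma lim_Aq : lim0 (A_q beta b qs qo v D) (qs ^ 2 * (a0 + a1 * 1) + qo * (w1 * nu1 b 1 + a2)).
Proof.
unfold A_q. eapply lim0_eq; [lim|].
- apply (limtri_int0 (fun s u => dR D s u * dq D u * nu2 b (dC D s u)) (1 * qo * nu2 b 1)).
  + apply limtri_mult; [apply limtri_mult; [apply lim_R|]|apply lim_nu2C].
    apply (limtri_ext (fun _ _ => qo)); [|apply limtri_const].
    intros s u Hu. rewrite Hq; auto; lra.
  + intros s Hs. now apply (ex_int4 b D nec_reg).
- ring.
Qed.

Hint Resolve lim_Ass lim_As0 lim_Aq : core.

(** [q] is constant, so the right-hand side of its equation vanishes for all [s > 0],
    hence in the limit. *)
Lemma nec_q : beta * (qs ^ 2 - qo ^ 2) * (a0 + a1) = qo / 2.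
Proof.
assert (H0 : forall s, 0 < s -> - (1 / 2 + beta * A s s) * dq D s + beta * A_q beta b qs qo v D s = 0).
{ intros s Hs. rewrite <- (is_derive_unique _ _ _ (Eq s Hs)).
  apply is_derive_unique. apply (is_derive_ext_loc (fun _ => qo)); [|auto_derive; auto].
  exists (mkposreal s Hs). intros y Hy. apply ball_Rabs, Rabs_lt_between in Hy; simpl in Hy.
  symmetry; apply Hq; lra. }
assert (H1 : lim0 (fun s => - (1 / 2 + beta * A s s) * dq D s + beta * A_q beta b qs qo v D s)
  (- (1 / 2 + beta * P1) * qo + beta * (qs ^ 2 * (a0 + a1 * 1) + qo * (w1 * nu1 b 1 + a2)))) by lim.
assert (H2 := lim0_unique _ _ 0 H1).
rewrite <- (Rplus_0_l (qo / 2)). rewrite <- H2.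
- unfold P1. field.
- apply (lim0_ext (fun _ => 0)); [|apply lim0_const]. intros s Hs. now rewrite (H0 s Hs).
Qed.

(** In the limit of the equation of [C (s, 0)], the values of [A] cancel and [- 1/2]
    remains. *)
Lemma nec_slope : lim0 (fun s => (dC D s 0 - 1) / s) (- (1 / 2)).
Proof.
assert (H1 : lim0 (fun s => - (1 / 2 + beta * A s s) * dC D s 0 + beta * A s 0) (- (1 / 2))).
{ eapply lim0_eq; [lim|]. field. }
intros P [e He].
assert (He2 : 0 < e / 2) by (generalize (cond_pos e); lra).
destruct (H1 _ (locally_ball (- (1 / 2)) (mkposreal _ He2))) as [d Hd].
exists d. intros s Hs Hs0. apply He, (proj2 (ball_R _ _ _)).
apply ball_Rabs in Hs. rewrite Rminus_0_r, Rabs_right in Hs by lra.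
assert (HM : Rabs ((dC D s 0 + s / 2) - (dC D 0 0 + 0 / 2)) <= e / 2 * s - e / 2 * 0).
{ apply (mvt_abs (fun x => dC D x 0 + x / 2) (fun x => e / 2 * x)
    (fun x => (- (1 / 2 + beta * A x x) * dC D x 0 + beta * A x 0) + 1 / 2) (fun _ => e / 2)); try lra.
  - apply continuous_on_plus.
    + apply (on_sub _ _ _ (fun u => 0 <= u)); [apply (reg_C_fst b); [apply nec_reg|lra]|intros; lra].
    + apply continuous_on_forall; intros; unfold Rdiv; cont.
  - apply continuous_on_forall; intros; cont.
  - intros x Hx. apply deriv_plus.
    + destruct HS as [_ [_ [_ [_ [_ [_ [_ HC]]]]]]]. apply HC; lra.
    + auto_derive; auto.
  - intros x Hx. auto_derive; auto; ring.
  - intros x Hx.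
    assert (HB : ball (- (1 / 2)) (mkposreal _ He2) (- (1 / 2 + beta * A x x) * dC D x 0 + beta * A x 0)).
    { apply Hd; [|lra]. apply (proj2 (ball_R _ _ _)). rewrite Rminus_0_r, Rabs_right; lra. }
    apply ball_Rabs in HB. simpl in HB. left.
    replace (- (1 / 2 + beta * A x x) * dC D x 0 + beta * A x 0 + 1 / 2) with
     (- (1 / 2 + beta * A x x) * dC D x 0 + beta * A x 0 - - (1 / 2)) by ring. auto. }
rewrite nec_C00 in HM.
replace ((dC D s 0 - 1) / s - - (1 / 2)) with ((dC D s 0 + s / 2 - (1 + 0 / 2)) / s) by (field; lra).
unfold Rdiv at 1. rewrite Rabs_mult, (Rabs_right (/ s)) by (apply Rle_ge; left; now apply Rinv_0_lt_compat).
apply Rle_lt_trans with ((e / 2 * s - e / 2 * 0) * / s).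
- apply Rmult_le_compat_r; auto. left; now apply Rinv_0_lt_compat.
- replace ((e / 2 * s - e / 2 * 0) * / s) with (e / 2) by (field; lra). lra.
Qed.

Hypothesis HH : forall s, 0 <= s -> dH D s = dH D 0.
Hypothesis EH : forall s, 0 <= s ->
  dH D s = beta * RInt (fun u => dR D s u * nu1 b (dC D s u)) 0 s
           - beta * nu1 b (dq D s) * dL b qs D s + v (dq D s) (dC D s 0).

(** [H] is constant.  Dividing its equation by [s], the integrals tend to their
    integrands at the corner, and [v (q_o, C (s, 0))] leaves [v (q_o, 1)] with slope
    [- v_y / 2] because [C (s, 0)] leaves 1 with slope [- 1/2]. *)
Lemma nec_H : beta * (nu1 b 1 - nu1 b qo ^ 2 / nu1 b (qs ^ 2)) = (w1 * nu1 b 1 + a2) / 2.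
Proof.
set (l1 := w1 * nu1 b 1 + a2).
(* the difference quotient of v at y = 1, extended by continuity *)
set (g := fun y => if Req_EM_T y 1 then l1 else (v qo y - v qo 1) / (y - 1)).
assert (Cg : continuous g 1).
{ intros P [e He]. unfold g at 1 in He. destruct (Req_EM_T 1 1) as [_|]; [|tauto].
  destruct (proj1 (is_derive_Reals (v qo) 1 l1) (Hvy 1 in_disk_1) e (cond_pos e)) as [d Hd].
  exists d. intros y Hy. apply He, (proj2 (ball_R _ _ _)). apply ball_Rabs in Hy. unfold g.
  destruct (Req_EM_T y 1) as [->|Hne].
  - rewrite Rminus_diag, Rabs_R0. apply cond_pos.
  - replace y with (1 + (y - 1)) at 1 by ring. apply Hd; auto. lra. }
assert (Hg : forall y, v qo y - v qo 1 = g y * (y - 1)).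
{ intros y. unfold g. destruct (Req_EM_T y 1) as [->|]; [ring|]. field. lra. }
assert (Hg1 : g 1 = l1) by (unfold g; destruct Req_EM_T; tauto).
assert (H0 : dH D 0 = v qo 1).
{ rewrite EH by lra. rewrite RInt_pt, L_0, Hq, nec_C00 by lra. ring. }
assert (Hl : lim0 (fun s => beta * (RInt (fun u => dR D s u * nu1 b (dC D s u)) 0 s / s)
  - beta * nu1 b (dq D s) * (dL b qs D s / s) + g (dC D s 0) * ((dC D s 0 - 1) / s))
  (beta * (1 * nu1 b 1) - beta * nu1 b qo * (/ nu1 b (qs ^ 2) * (1 * nu1 b qo)) + l1 * (- (1 / 2)))).
{ lim.
  - apply (limtri_mean (fun s u => dR D s u * nu1 b (dC D s u))).
    + apply limtri_mult; [apply lim_R|apply lim_nu1C].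
    + intros s Hs. now apply (ex_int2 b D nec_reg).
  - apply lim_Lmean.
  - rewrite <- Hg1. apply (lim0_comp (fun s => dC D s 0) g); [apply lim_Cs|auto].
  - apply nec_slope. }
assert (H2 := lim0_unique _ _ 0 Hl).
assert (H3 : beta * (1 * nu1 b 1) - beta * nu1 b qo * (/ nu1 b (qs ^ 2) * (1 * nu1 b qo)) + l1 * - (1 / 2) = 0).
{ apply H2. apply (lim0_ext (fun _ => 0)); [|apply lim0_const]. intros s Hs.
  assert (E := EH s (Rlt_le _ _ Hs)). rewrite HH, H0, !Hq in E by lra.
  assert (Hgs := Hg (dC D s 0)). rewrite Hq by lra.
  apply Rmult_eq_reg_r with s; [|lra]. rewrite Rmult_0_l.
  symmetry.
  transitivity (beta * RInt (fun u => dR D s u * nu1 b (dC D s u)) 0 s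
     - beta * nu1 b qo * dL b qs D s + g (dC D s 0) * (dC D s 0 - 1)).
  - field. lra.
  - rewrite <- Hgs. lra. }
apply Rminus_diag_uniq. rewrite <- H3. unfold l1, Rdiv. ring.
Qed.
End Necessity.

(** * The linear system for the weights of v *)

(** ** The matrix equations as systems of scalar equations *)

Lemma col4_eq (a1 a2 a3 a4 e1 e2 e3 e4 : R) :
  ([[a1],[a2],[a3],[a4]] : matrix 4 1) = [[e1],[e2],[e3],[e4]] <->
  a1 = e1 /\ a2 = e2 /\ a3 = e3 /\ a4 = e4.
Proof.
split.
- intros H; injection H; auto.
- intros [-> [-> [-> ->]]]; reflexivity.
Qed.

Lemma col3_eq (a1 a2 a3 e1 e2 e3 : R) :
  ([[a1],[a2],[a3]] : matrix 3 1) = [[e1],[e2],[e3]] <-> a1 = e1 /\ a2 = e2 /\ a3 = e3.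
Proof.
split.
- intros H; injection H; auto.
- intros [-> [-> ->]]; reflexivity.
Qed.

Lemma image_eqs (b : nat -> R) (beta qs al : R) (V : params) :
  in_image (stat_matrix b qs al) (stat_vector beta b qs al V) <->
  exists x1 x2,
    nu b (al * qs) * x1 + al * qs * nu1 b (al * qs) * x2 =
      pE V - 2 * beta * (nu b 1 - (1 - al ^ 2) * nu1 b (al * qs) * b_alpha b qs al) /\
    nu b (qs ^ 2) * x1 + qs ^ 2 * nu1 b (qs ^ 2) * x2 = pEs V - 2 * beta * nu b (al * qs) /\
    qs * nu1 b (qs ^ 2) * x1 + qs * psi b (qs ^ 2) * x2 =
      qs * pGs V - 2 * beta * al * nu1 b (al * qs) /\
    qs * nu1 b (al * qs) * x1 + qs * psi b (al * qs) * x2 =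
      al / (2 * beta * (1 - al ^ 2))
      - 2 * beta * b_alpha b qs al * (al * psi b (al * qs) - qs * nu2 b (al * qs)).
Proof.
assert (E : forall x1 x2, Mmult (T := R_Ring) (stat_matrix b qs al) ([[x1],[x2]] : matrix 2 1) =
  [[nu b (al * qs) * x1 + al * qs * nu1 b (al * qs) * x2],
   [nu b (qs ^ 2) * x1 + qs ^ 2 * nu1 b (qs ^ 2) * x2],
   [qs * nu1 b (qs ^ 2) * x1 + qs * psi b (qs ^ 2) * x2],
   [qs * nu1 b (al * qs) * x1 + qs * psi b (al * qs) * x2]]).
{ intros x1 x2. unfold stat_matrix, Mmult, mk_matrix, coeff_mat; simpl.
  rewrite !sum_Sn, !sum_O. reflexivity. }
unfold in_image, stat_vector. split.
- intros [[[x1 []] [[x2 []] []]] H]. exists x1, x2. now rewrite E, col4_eq in H.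
- intros [x1 [x2 H]]. exists ([[x1],[x2]] : matrix 2 1). now rewrite E, col4_eq.
Qed.

Definition sigma_sys (b : nat -> R) (qs qo w1 w2 w3 w4 e1 e2 e3 e4 : R) : Prop :=
  nu b 1 * w1 + nu b qo * w2 + qo / qs ^ 2 * nu1 b qo * w3
    + sqrt (qs ^ 2 - qo ^ 2) / qs ^ 2 * nu1 b qo * w4 = e1 /\
  nu b qo * w1 + nu b (qs ^ 2) * w2 + nu1 b (qs ^ 2) * w3 = e2 /\
  qo / qs ^ 2 * nu1 b qo * w1 + nu1 b (qs ^ 2) * w2 + psi b (qs ^ 2) / qs ^ 2 * w3 = e3 /\
  sqrt (qs ^ 2 - qo ^ 2) / qs ^ 2 * nu1 b qo * w1 + nu1 b (qs ^ 2) / qs ^ 2 * w4 = e4.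

Definition full_sys (b : nat -> R) (qs : R) (V : params) (w1 w2 w3 w4 : R) : Prop :=
  sigma_sys b qs (pqo V) w1 w2 w3 w4 (pE V) (pEs V) (pGs V) 0.

Lemma Sigma_eqs (b : nat -> R) (qs qo w1 w2 w3 w4 e1 e2 e3 e4 : R) :
  Mmult (Sigma b qs qo) ([[w1],[w2],[w3],[w4]] : matrix 4 1) = [[e1],[e2],[e3],[e4]] <->
  sigma_sys b qs qo w1 w2 w3 w4 e1 e2 e3 e4.
Proof.
assert (E : Mmult (Sigma b qs qo) ([[w1],[w2],[w3],[w4]] : matrix 4 1) =
 [[nu b 1 * w1 + nu b qo * w2 + qo / qs ^ 2 * nu1 b qo * w3
    + sqrt (qs ^ 2 - qo ^ 2) / qs ^ 2 * nu1 b qo * w4],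
  [nu b qo * w1 + nu b (qs ^ 2) * w2 + nu1 b (qs ^ 2) * w3 + 0 * w4],
  [qo / qs ^ 2 * nu1 b qo * w1 + nu1 b (qs ^ 2) * w2 + psi b (qs ^ 2) / qs ^ 2 * w3 + 0 * w4],
  [sqrt (qs ^ 2 - qo ^ 2) / qs ^ 2 * nu1 b qo * w1 + 0 * w2 + 0 * w3 + nu1 b (qs ^ 2) / qs ^ 2 * w4]]).
{ unfold Sigma, Mmult, mk_matrix, coeff_mat; simpl.
  rewrite !sum_Sn, !sum_O. reflexivity. }
rewrite E, col4_eq. rewrite !Rmult_0_l, !Rplus_0_r. unfold sigma_sys. tauto.
Qed.

Lemma Sigma_pure_eqs (b : nat -> R) (qs qo w1 w2 w4 e1 e2 e4 : R) :
  Mmult (Sigma_pure b qs qo) ([[w1],[w2],[w4]] : matrix 3 1) = [[e1],[e2],[e4]] <->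
  nu b 1 * w1 + nu b qo * w2 + sqrt (qs ^ 2 - qo ^ 2) / qs ^ 2 * nu1 b qo * w4 = e1 /\
  nu b qo * w1 + nu b (qs ^ 2) * w2 = e2 /\
  sqrt (qs ^ 2 - qo ^ 2) / qs ^ 2 * nu1 b qo * w1 + nu1 b (qs ^ 2) / qs ^ 2 * w4 = e4.
Proof.
assert (E : Mmult (Sigma_pure b qs qo) ([[w1],[w2],[w4]] : matrix 3 1) =
 [[nu b 1 * w1 + nu b qo * w2 + sqrt (qs ^ 2 - qo ^ 2) / qs ^ 2 * nu1 b qo * w4],
  [nu b qo * w1 + nu b (qs ^ 2) * w2 + 0 * w4],
  [sqrt (qs ^ 2 - qo ^ 2) / qs ^ 2 * nu1 b qo * w1 + 0 * w2 + nu1 b (qs ^ 2) / qs ^ 2 * w4]]).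
{ unfold Sigma_pure, Mmult, mk_matrix, coeff_mat; simpl.
  rewrite !sum_Sn, !sum_O. reflexivity. }
rewrite E, col3_eq. rewrite !Rmult_0_l, !Rplus_0_r. tauto.
Qed.

(** ** Pure p-spins *)

(** [nu] is homogeneous of degree p: these are Euler's identities. *)
Lemma pure_nu (b : nat -> R) (p : nat) (x : R) : pure_spins b p -> in_disk b x ->
  x * nu1 b x = INR p * nu b x.
Proof.
intros [_ Hp] Hx.
assert (H := series_lin _ _ _ _ 1 (- INR p) (series_xnu1 b x Hx) (series_nu b x Hx)).
assert (H0 : 1 * (x * nu1 b x) + - INR p * nu b x = 0); [|lra].
apply series_zero_sum. eapply is_series_ext; [|apply H].
intros n; cbv beta. destruct (Nat.eq_dec n p) as [->|Hne]; [rring|]. rewrite (Hp n Hne). rring.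
Qed.

Lemma pure_psi (b : nat -> R) (p : nat) (x : R) : pure_spins b p -> in_disk b x ->
  psi b x = INR p * nu1 b x.
Proof.
intros [_ Hp] Hx.
assert (H := series_lin _ _ _ _ 1 (- INR p) (series_psi b x Hx) (series_nu1 b x Hx)).
assert (H0 : 1 * psi b x + - INR p * nu1 b x = 0); [|lra].
apply series_zero_sum. eapply is_series_ext; [|apply H].
intros n; cbv beta. destruct (Nat.eq_dec n p) as [->|Hne]; [rring|]. rewrite (Hp n Hne). rring.
Qed.

Lemma series_single (u : nat -> R) (p : nat) : (forall n, n <> p -> u n = 0) -> is_series u (u p).
Proof.
intros H.
assert (Hs : forall n, (p <= n)%nat -> sum_n u n = u p).
{ induction 1 as [|n Hn IH].
  - destruct p; [apply sum_O|]. rewrite sum_Sn.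
    assert (Hz : sum_n u p = 0); [|rewrite Hz; unfold plus; simpl; ring].
    clear -H. assert (G : forall k, (k <= p)%nat -> sum_n u k = 0).
    { induction k as [|k IH]; intros Hk.
      - rewrite sum_O. apply H; lia.
      - rewrite sum_Sn, IH by lia. rewrite H by lia. unfold plus; simpl; ring. }
    apply G; lia.
  - rewrite sum_Sn, IH, (H (S n)) by lia. unfold plus; simpl; ring. }
apply (is_lim_seq_ext_loc (fun _ => u p) (sum_n u) (u p)).
- exists p; intros n Hn; now rewrite Hs.
- apply is_lim_seq_const.
Qed.

Lemma pure_nu1 (b : nat -> R) (p : nat) (x : R) : pure_spins b p -> in_disk b x ->
  nu1 b x = b p ^ 2 * (INR p * x ^ (pred p)).
Proof.
intros [_ Hp] Hx. rewrite <- (is_series_unique _ _ (series_nu1 b x Hx)).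
apply is_series_unique.
apply (series_single (fun p => b p ^ 2 * (INR p * x ^ (pred p)))).
intros n Hn. rewrite (Hp n Hn). ring.
Qed.

(** ** Nondegeneracy of Sigma for |alpha| < 1 *)

Lemma gap_pos (a : R) (n : nat) : 0 <= a < 1 -> 0 < 1 - a ^ (S (S n)) - INR (S (S n)) * (1 - a) * a ^ (S n).
Proof.
intros Ha. induction n as [|n IH].
- simpl. nra.
- assert (0 <= a ^ S n) by (apply pow_le; lra).
  assert (0 <= INR (S (S n))) by apply pos_INR.
  replace (1 - a ^ S (S (S n)) - INR (S (S (S n))) * (1 - a) * a ^ S (S n)) with
    ((1 - a ^ S (S n) - INR (S (S n)) * (1 - a) * a ^ S n) +
     (INR (S (S n)) * a ^ S n) * ((1 - a) * (1 - a))).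
  + assert (0 <= (INR (S (S n)) * a ^ S n) * ((1 - a) * (1 - a))); [|lra].
    apply Rmult_le_pos; [now apply Rmult_le_pos|nra].
  + rewrite (S_INR (S (S n))).
    replace (a ^ S (S (S n))) with (a * a * a ^ S n) by (simpl; ring).
    replace (a ^ S (S n)) with (a * a ^ S n) by (simpl; ring). ring.
Qed.

Lemma al2_lt (al : R) : Rabs al < 1 -> 0 <= al ^ 2 < 1.
Proof. intros H. apply Rabs_lt_between in H. nra. Qed.

Lemma in_disk_qo (b : nat -> R) (qs al : R) : mixture b -> 0 < qs <= 1 -> Rabs al <= 1 -> in_disk b (al * qs).
Proof.
intros Hb Hqs Hal. apply in_disk_le1; auto. rewrite Rabs_mult, (Rabs_right qs) by lra.
generalize (Rabs_pos al); nra.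
Qed.

Lemma in_disk_qs2 (b : nat -> R) (qs : R) : mixture b -> 0 < qs <= 1 -> in_disk b (qs ^ 2).
Proof. intros Hb Hqs. apply in_disk_01; auto. nra. Qed.

Lemma sigma_sq (qs al : R) : 0 < qs -> Rabs al < 1 ->
  sqrt (qs ^ 2 - (al * qs) ^ 2) ^ 2 = qs ^ 2 * (1 - al ^ 2) /\ 0 < sqrt (qs ^ 2 - (al * qs) ^ 2).
Proof.
intros Hqs Hal. assert (H := al2_lt al Hal).
assert (0 < qs ^ 2) by (apply pow_lt; auto).
assert (Hp : 0 < qs ^ 2 - (al * qs) ^ 2) by (replace ((al * qs) ^ 2) with (al ^ 2 * qs ^ 2) by ring; nra).
split; [rewrite pow2_sqrt; [ring|lra]|now apply sqrt_lt_R0].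
Qed.

(** The quadratic form of Sigma is the sum over the mixture of [b_p^2] times
    nonnegative multiples of two squares and of [d1^2], the last one positive by
    [gap_pos] at [alpha^2]; on a null vector each term vanishes.  This forces [d1 = d4 = 0], and leaves one equation on [(d2, d3)]
    for each p with [b_p <> 0], so that Sigma is invertible unless the mixture is
    pure. *)
Lemma hom_zero (b : nat -> R) (qs al d1 d2 d3 d4 : R) : mixture b -> 0 < qs <= 1 -> Rabs al < 1 ->
  sigma_sys b qs (al * qs) d1 d2 d3 d4 0 0 0 0 ->
  d1 = 0 /\ d4 = 0 /\ forall p, b p <> 0 -> d2 + INR p * (d3 / qs ^ 2) = 0.
Proof.
intros Hb Hqs Hal [e1 [e2 [e3 e4]]].
assert (Ha := al2_lt al Hal).
destruct (sigma_sq qs al) as [Hs2 Hs0]; try lra.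
set (sg := sqrt (qs ^ 2 - (al * qs) ^ 2)) in *.
set (f3 := d3 / qs ^ 2) in *.
assert (Hd3 : d3 = f3 * qs ^ 2) by (unfold f3; field; lra).
set (qo := al * qs) in *.
assert (I1 : in_disk b 1) by (apply in_disk_01; auto; lra).
assert (Iq : in_disk b qo) by (apply in_disk_qo; auto; lra).
assert (Is : in_disk b (qs ^ 2)) by now apply in_disk_qs2.
(* d^T Sigma d, expanded along the mixture *)
set (Q := fun p => d1 ^ 2 + 2 * d1 * d2 * qo ^ p + 2 * d1 * f3 * (INR p * qo ^ p)
  + 2 * d1 * d4 * (sg / qs ^ 2) * (INR p * qo ^ (pred p)) + d2 ^ 2 * (qs ^ 2) ^ p
  + 2 * d2 * f3 * (INR p * (qs ^ 2) ^ p) + f3 ^ 2 * (INR p ^ 2 * (qs ^ 2) ^ p)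
  + d4 ^ 2 / qs ^ 2 * (INR p * (qs ^ 2) ^ (pred p))).
assert (HQ : is_series (fun p => b p ^ 2 * Q p) 0).
{ assert (H1 := series_lin _ _ _ _ (d1 ^ 2) (2 * d1 * d2) (series_nu b _ I1) (series_nu b _ Iq)).
  assert (H2 := series_lin _ _ _ _ (2 * d1 * f3) (2 * d1 * d4 * (sg / qs ^ 2))
    (series_xnu1 b _ Iq) (series_nu1 b _ Iq)).
  assert (H3 := series_lin _ _ _ _ (d2 ^ 2) (2 * d2 * f3) (series_nu b _ Is) (series_xnu1 b _ Is)).
  assert (H4 := series_lin _ _ _ _ (f3 ^ 2) (d4 ^ 2 / qs ^ 2) (series_xpsi b _ Is) (series_nu1 b _ Is)).
  assert (H5 := series_lin _ _ _ _ 1 1 (series_lin _ _ _ _ 1 1 H1 H2) (series_lin _ _ _ _ 1 1 H3 H4)).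
  cbv beta in H5.
  match type of H5 with is_series _ ?l => replace l with 0 in H5 end.
  - eapply is_series_ext; [|apply H5]. intros p. unfold Q; cbv beta. rewrite pow1. rring.
  - transitivity (d1 * 0 + d2 * 0 + d3 * 0 + d4 * 0); [ring|].
    rewrite <- e1 at 1. rewrite <- e2 at 1. rewrite <- e3 at 1. rewrite <- e4 at 1.
    rewrite Hd3. field. lra. }
assert (HQp : forall n, Q (S (S n)) =
  (d1 * al * al ^ S n + (d2 + INR (S (S n)) * f3) * qs * qs ^ S n) ^ 2
  + INR (S (S n)) * (d4 * qs ^ S n / qs + d1 * (sg / qs) * al ^ S n) ^ 2
  + d1 ^ 2 * (1 - (al ^ 2) ^ S (S n) - INR (S (S n)) * (1 - al ^ 2) * (al ^ 2) ^ S n)).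
{ intros n. unfold Q. simpl pred.
  replace (qo ^ S (S n)) with (al * qs * (al ^ S n * qs ^ S n))
    by (unfold qo; rewrite <- Rpow_mult_distr; simpl; ring).
  replace (qo ^ S n) with (al ^ S n * qs ^ S n) by (unfold qo; now rewrite Rpow_mult_distr).
  replace ((qs ^ 2) ^ S (S n)) with (qs ^ 2 * (qs ^ S n * qs ^ S n))
    by (rewrite <- !pow_mult, <- !pow_add; f_equal; lia).
  replace ((qs ^ 2) ^ S n) with (qs ^ S n * qs ^ S n)
    by (rewrite <- !pow_mult, <- !pow_add; f_equal; lia).
  replace ((al ^ 2) ^ S (S n)) with (al ^ 2 * (al ^ S n * al ^ S n))
    by (rewrite <- !pow_mult, <- !pow_add; f_equal; lia).
  replace ((al ^ 2) ^ S n) with (al ^ S n * al ^ S n)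
    by (rewrite <- !pow_mult, <- !pow_add; f_equal; lia).
  generalize (INR (S (S n))) (al ^ S n) (qs ^ S n); intros P x y.
  assert (E : d1 ^ 2 * (P * (1 - al ^ 2) * (x * x)) = P * (d1 * (sg / qs) * x) ^ 2).
  { replace (P * (d1 * (sg / qs) * x) ^ 2) with (P * d1 ^ 2 * x ^ 2 * sg ^ 2 / qs ^ 2) by (field; lra).
    rewrite Hs2. field. lra. }
  replace (d1 ^ 2 * (1 - al ^ 2 * (x * x) - P * (1 - al ^ 2) * (x * x))) with
    (d1 ^ 2 * (1 - al ^ 2 * (x * x)) - d1 ^ 2 * (P * (1 - al ^ 2) * (x * x))) by ring.
  rewrite E. field. lra. }
assert (HQ0 : forall p, 0 <= b p ^ 2 * Q p).
{ intros p. assert (Hb2 := Hb). destruct Hb2 as [B0 [B1 _]].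
  destruct p as [|[|n]].
  - rewrite B0. simpl; lra.
  - rewrite B1. simpl; lra.
  - apply Rmult_le_pos; [apply pow2_ge_0|]. rewrite HQp.
    assert (G := gap_pos (al ^ 2) n Ha).
    assert (0 <= INR (S (S n))) by apply pos_INR.
    apply Rplus_le_le_0_compat; [apply Rplus_le_le_0_compat|].
    + apply pow2_ge_0.
    + apply Rmult_le_pos; auto. apply pow2_ge_0.
    + apply Rmult_le_pos; [apply pow2_ge_0|lra]. }
assert (Hzero := series_zero _ _ HQ0 HQ eq_refl).
assert (Hterm : forall p, b p <> 0 -> d1 = 0 /\ d4 = 0 /\ d2 + INR p * f3 = 0).
{ intros p Hp. assert (Hb2 := Hb). destruct Hb2 as [B0 [B1 _]].
  destruct p as [|[|n]]; [contradiction|contradiction|].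
  assert (Hz := Hzero (S (S n))). apply Rmult_integral in Hz.
  destruct Hz as [Hz|Hz]; [generalize (sq_pos_of b _ Hp); lra|].
  rewrite HQp in Hz.
  assert (G := gap_pos (al ^ 2) n Ha).
  assert (HP : 0 < INR (S (S n))) by (apply lt_0_INR; lia).
  set (P := INR (S (S n))) in *.
  set (U := d1 * al * al ^ S n + (d2 + P * f3) * qs * qs ^ S n) in *.
  set (W := d4 * qs ^ S n / qs + d1 * (sg / qs) * al ^ S n) in *.
  set (g := 1 - (al ^ 2) ^ S (S n) - P * (1 - al ^ 2) * (al ^ 2) ^ S n) in *.
  assert (Y : 0 < qs ^ S n) by (apply pow_lt; lra).
  assert (U2 := pow2_ge_0 U). assert (W2 := pow2_ge_0 W). assert (D2 := pow2_ge_0 d1).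
  assert (PW : 0 <= P * W ^ 2) by (apply Rmult_le_pos; lra).
  assert (GD : 0 <= d1 ^ 2 * g) by (apply Rmult_le_pos; lra).
  assert (Z1 : d1 ^ 2 * g = 0) by lra.
  assert (Z2 : P * W ^ 2 = 0) by lra.
  assert (Z3 : U ^ 2 = 0) by lra.
  assert (sq0 : forall z, z ^ 2 = 0 -> z = 0).
  { intros z Hz2. simpl in Hz2. rewrite Rmult_1_r in Hz2. apply Rmult_integral in Hz2. tauto. }
  assert (d10 : d1 = 0) by (apply sq0; apply Rmult_integral in Z1; destruct Z1; auto; lra).
  assert (W0 : W = 0) by (apply sq0; apply Rmult_integral in Z2; destruct Z2; auto; lra).
  assert (U0 : U = 0) by now apply sq0.
  unfold W in W0. unfold U in U0. rewrite d10 in W0, U0.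
  split; auto. split.
  - assert (E : d4 * qs ^ S n = 0).
    { apply Rmult_eq_reg_r with (/ qs); [|apply Rinv_neq_0_compat; lra]. lra. }
    apply Rmult_integral in E. destruct E; auto; lra.
  - assert (E : (d2 + P * f3) * (qs * qs ^ S n) = 0) by lra.
    apply Rmult_integral in E. destruct E as [|E]; auto.
    exfalso. assert (0 < qs * qs ^ S n) by (apply Rmult_lt_0_compat; lra). lra. }
destruct (mixture_supp b Hb) as [p [_ Hp]].
destruct (Hterm p ltac:(lra)) as [-> [-> _]]. repeat split; auto.
intros q Hq. now apply Hterm.
Qed.

Lemma not_pure_two (b : nat -> R) : mixture b -> ~ pure b ->
  exists p q, p <> q /\ b p <> 0 /\ b q <> 0.
Proof.
intros Hb Hn. destruct (mixture_supp b Hb) as [p [_ Hp]].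
destruct (classic (exists q, q <> p /\ b q <> 0)) as [[q [H1 H2]]|H].
- exists p, q. repeat split; auto; lra.
- exfalso; apply Hn. exists p. split; [lra|]. intros k Hk.
  destruct (Req_dec (b k) 0); auto. exfalso; apply H; exists k; auto.
Qed.

(** ** The weights and the function v *)

Lemma qo_lt (qs al : R) : 0 < qs -> Rabs al < 1 -> Rabs (al * qs) < qs.
Proof. intros Hq Ha. rewrite Rabs_mult, (Rabs_right qs) by lra. nra. Qed.

(** For pure p-spins, the equation removed from the system follows from the
    constraint on [G_star], so all cases obey the full system. *)
Lemma is_v_sys (b : nat -> R) (qs al : R) (V : params) (v : R -> R -> R) : mixture b ->
  0 < qs <= 1 -> Rabs al < 1 -> allowed b qs V -> pqo V = al * qs -> is_v b qs V v ->
  exists w1 w2 w3 w4, full_sys b qs V w1 w2 w3 w4 /\ (pure b -> w3 = 0) /\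
    v = v_of b qs (pqo V) w1 w2 w3 w4.
Proof.
intros Hb Hqs Hal [_ [_ Hall]] Hqo.
assert (Ext : forall w : R -> R -> R, (forall x y, v x y = w x y) -> v = w)
  by (intros; do 2 (apply functional_extensionality; intros); auto).
intros [[p [_ [H _]]]|[[Hp [_ [w1 [w2 [w4 [H Hv]]]]]]|[Hp [w1 [w2 [w3 [w4 [H Hv]]]]]]]];
 try apply Ext in Hv.
- exfalso. rewrite Hqo in H. generalize (qo_lt qs al ltac:(lra) Hal); lra.
- exists w1, w2, 0, w4. split; auto. apply Sigma_pure_eqs in H. destruct H as [h1 [h2 h4]].
  assert (Iq : in_disk b (pqo V)) by (rewrite Hqo; apply in_disk_qo; auto; lra).
  assert (Is : in_disk b (qs ^ 2)) by now apply in_disk_qs2.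
  destruct Hp as [p Hp]. destruct (Hall p Hp) as [hG _].
  assert (P1 := pure_nu b p _ Hp Iq). assert (P2 := pure_nu b p _ Hp Is).
  unfold full_sys, sigma_sys. repeat split; auto.
  + rewrite <- h1. ring.
  + rewrite <- h2. ring.
  + rewrite hG, <- h2.
    apply Rmult_eq_reg_r with (qs ^ 2); [|apply pow_nonzero; lra].
    replace (INR p * (nu b (pqo V) * w1 + nu b (qs ^ 2) * w2) / qs ^ 2 * qs ^ 2) with
      ((INR p * nu b (pqo V)) * w1 + (INR p * nu b (qs ^ 2)) * w2) by (field; lra).
    rewrite <- P1, <- P2. field. lra.
- exists w1, w2, w3, w4. apply Sigma_eqs in H. split; [exact H|]. split; auto. tauto.
Qed.

Lemma sys_is_v (b : nat -> R) (qs al : R) (V : params) (w1 w2 w3 w4 : R) : mixture b ->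
  0 < qs <= 1 -> Rabs al < 1 -> pqo V = al * qs ->
  full_sys b qs V w1 w2 w3 w4 -> (pure b -> w3 = 0) ->
  is_v b qs V (v_of b qs (pqo V) w1 w2 w3 w4).
Proof.
intros Hb Hqs Hal Hqo Hs H3.
destruct (classic (pure b)) as [Hp|Hp].
- right; left. split; auto. split; [rewrite Hqo; apply qo_lt; auto; lra|].
  exists w1, w2, w4. rewrite (H3 Hp) in *. destruct Hs as [h1 [h2 [h3 h4]]]. split; auto.
  apply Sigma_pure_eqs. repeat split; auto; [rewrite <- h1|rewrite <- h2]; ring.
- right; right. split; auto. exists w1, w2, w3, w4. split; auto. now apply Sigma_eqs.
Qed.

Lemma sys_unique (b : nat -> R) (qs al : R) (V : params) (w1 w2 w3 w4 u1 u2 u3 u4 : R) : mixture b ->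
  0 < qs <= 1 -> Rabs al < 1 -> pqo V = al * qs ->
  full_sys b qs V w1 w2 w3 w4 -> full_sys b qs V u1 u2 u3 u4 ->
  (pure b -> w3 = 0) -> (pure b -> u3 = 0) -> w1 = u1 /\ w2 = u2 /\ w3 = u3 /\ w4 = u4.
Proof.
intros Hb Hqs Hal Hqo [a1 [a2 [a3 a4]]] [c1 [c2 [c3 c4]]] Hw Hu. rewrite Hqo in *.
destruct (hom_zero b qs al (w1 - u1) (w2 - u2) (w3 - u3) (w4 - u4)) as [d1 [d4 d23]]; auto.
{ repeat split; lra. }
assert (H3 : w3 - u3 = 0).
{ destruct (classic (pure b)) as [Hp|Hp]; [rewrite Hw, Hu; auto; ring|].
  destruct (not_pure_two b Hb Hp) as [p [q [Hpq [Bp Bq]]]].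
  assert (E : (INR p - INR q) * ((w3 - u3) / qs ^ 2) = 0) by (generalize (d23 p Bp) (d23 q Bq); lra).
  apply Rmult_integral in E. destruct E as [E|E].
  - exfalso. apply Hpq, INR_eq. lra.
  - apply Rmult_eq_reg_r with (/ qs ^ 2); [|apply Rinv_neq_0_compat, pow_nonzero; lra].
    unfold Rdiv in E. lra. }
destruct (mixture_supp b Hb) as [p [_ Hp]].
assert (H2 := d23 p ltac:(lra)). rewrite H3 in H2. unfold Rdiv in H2. rewrite Rmult_0_l, Rmult_0_r in H2.
repeat split; lra.
Qed.

(** * Stationary dynamics and the constraint on the parameters *)

Lemma nu1_qs2_pos (b : nat -> R) (qs : R) : mixture b -> 0 < qs <= 1 -> 0 < nu1 b (qs ^ 2).
Proof.
intros Hb Hqs. apply nu1_pos; auto; [now apply in_disk_qs2|apply pow_lt; lra].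
Qed.

Lemma w4_of_sys (b : nat -> R) (qs al : R) (V : params) (w1 w2 w3 w4 : R) : mixture b ->
  0 < qs <= 1 -> Rabs al < 1 -> pqo V = al * qs -> full_sys b qs V w1 w2 w3 w4 ->
  w4 = - (w1 * b_alpha b qs al) * sqrt (qs ^ 2 - (al * qs) ^ 2).
Proof.
intros Hb Hqs Hal Hqo [_ [_ [_ h4]]]. rewrite Hqo in h4.
assert (Hn := nu1_qs2_pos b qs Hb Hqs).
assert (Hq2 : 0 < qs ^ 2) by (apply pow_lt; lra).
unfold b_alpha.
apply Rmult_eq_reg_l with (nu1 b (qs ^ 2) / qs ^ 2); [|apply Rgt_not_eq, Rdiv_lt_0_compat; auto].
transitivity (- (sqrt (qs ^ 2 - (al * qs) ^ 2) / qs ^ 2 * nu1 b (al * qs) * w1)); [lra|].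
field. split; lra.
Qed.

Lemma zc_lt (qs al : R) : 0 < qs -> Rabs al < 1 ->
  zc qs (al * qs) = / sqrt (qs ^ 2 - (al * qs) ^ 2).
Proof.
intros Hq Ha. unfold zc. destruct Rlt_dec as [|H]; auto. exfalso; apply H. now apply qo_lt.
Qed.

Lemma k_of_sys (b : nat -> R) (qs al : R) (V : params) (w1 w2 w3 w4 : R) : mixture b ->
  0 < qs <= 1 -> Rabs al < 1 -> pqo V = al * qs -> full_sys b qs V w1 w2 w3 w4 ->
  w4 * zc qs (al * qs) = - (w1 * b_alpha b qs al).
Proof.
intros Hb Hqs Hal Hqo Hs. rewrite zc_lt by (auto; lra).
destruct (sigma_sq qs al) as [_ H]; try lra.
rewrite (w4_of_sys b qs al V w1 w2 w3 w4) by auto. field. lra.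
Qed.

(** With [w1 = 2 beta], the first three rows of the system are the first three
    constraints on the parameters, with [(w2, w3 / q_star^2)] as preimage; the fourth
    constraint prescribes [v_x (q_o, 1)]. *)
Lemma image_of_sys (b : nat -> R) (beta qs al : R) (V : params) (w2 w3 w4 : R) : mixture b ->
  0 < beta -> 0 < qs <= 1 -> Rabs al < 1 -> pqo V = al * qs -> full_sys b qs V (2 * beta) w2 w3 w4 ->
  vx_val b qs (al * qs) w2 w3 (- (2 * beta * b_alpha b qs al)) (al * qs) 1 =
    al / (2 * beta * qs * (1 - al ^ 2)) ->
  in_image (stat_matrix b qs al) (stat_vector beta b qs al V).
Proof.
intros Hb Hbeta Hqs Hal Hqo Hs HV. apply image_eqs. exists w2, (w3 / qs ^ 2).
assert (H4 := w4_of_sys b qs al V _ _ _ _ Hb Hqs Hal Hqo Hs).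
destruct Hs as [h1 [h2 [h3 _]]]. rewrite Hqo in h1, h2, h3.
destruct (sigma_sq qs al) as [Hsq _]; try lra.
set (sg := sqrt (qs ^ 2 - (al * qs) ^ 2)) in *.
assert (Ha := al2_lt al Hal).
split; [|split; [|split]].
- rewrite <- h1, H4.
  replace (sg / qs ^ 2 * nu1 b (al * qs) * (- (2 * beta * b_alpha b qs al) * sg)) with
    (sg ^ 2 * (- (2 * beta * b_alpha b qs al)) * nu1 b (al * qs) / qs ^ 2) by (field; lra).
  rewrite Hsq. field. lra.
- rewrite <- h2. field. lra.
- rewrite <- h3. field. lra.
- unfold vx_val in HV.
  assert (E : qs * (al / (2 * beta * qs * (1 - al ^ 2))) = al / (2 * beta * (1 - al ^ 2)))
    by (field; repeat split; lra).
  rewrite <- E, <- HV. unfold psi. field. lra.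
Qed.

Lemma sys_of_image (b : nat -> R) (beta qs al : R) (V : params) : mixture b ->
  0 < beta -> 0 < qs <= 1 -> Rabs al < 1 -> allowed b qs V -> pqo V = al * qs ->
  in_image (stat_matrix b qs al) (stat_vector beta b qs al V) ->
  exists w2 w3 w4, full_sys b qs V (2 * beta) w2 w3 w4 /\ (pure b -> w3 = 0) /\
  vx_val b qs (al * qs) w2 w3 (- (2 * beta * b_alpha b qs al)) (al * qs) 1 =
    al / (2 * beta * qs * (1 - al ^ 2)).
Proof.
intros Hb Hbeta Hqs Hal HA Hqo Him. apply image_eqs in Him.
assert (Iq : in_disk b (al * qs)) by (apply in_disk_qo; auto; lra).
assert (Is : in_disk b (qs ^ 2)) by now apply in_disk_qs2.
assert (Hn := nu1_qs2_pos b qs Hb Hqs).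
(* for pure p-spins the two columns of the matrix are proportional *)
assert (Him2 : exists x1 x2, (pure b -> x2 = 0) /\
  nu b (al * qs) * x1 + al * qs * nu1 b (al * qs) * x2 =
      pE V - 2 * beta * (nu b 1 - (1 - al ^ 2) * nu1 b (al * qs) * b_alpha b qs al) /\
    nu b (qs ^ 2) * x1 + qs ^ 2 * nu1 b (qs ^ 2) * x2 = pEs V - 2 * beta * nu b (al * qs) /\
    qs * nu1 b (qs ^ 2) * x1 + qs * psi b (qs ^ 2) * x2 =
      qs * pGs V - 2 * beta * al * nu1 b (al * qs) /\
    qs * nu1 b (al * qs) * x1 + qs * psi b (al * qs) * x2 =
      al / (2 * beta * (1 - al ^ 2))
      - 2 * beta * b_alpha b qs al * (al * psi b (al * qs) - qs * nu2 b (al * qs))).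
{ destruct Him as [x1 [x2 [m1 [m2 [m3 m4]]]]].
  destruct (classic (pure b)) as [[p Hp]|Hp].
  - exists (x1 + INR p * x2), 0. split; auto.
    rewrite <- m1, <- m2, <- m3, <- m4, (pure_psi b p _ Hp Iq), (pure_psi b p _ Hp Is).
    rewrite (pure_nu b p _ Hp Iq), (pure_nu b p _ Hp Is).
    repeat split; ring.
  - exists x1, x2. split; [tauto|]. auto. }
destruct Him2 as [x1 [x2 [Hx2 [m1 [m2 [m3 m4]]]]]].
destruct (sigma_sq qs al) as [Hsq _]; try lra.
set (sg := sqrt (qs ^ 2 - (al * qs) ^ 2)) in *.
assert (Ha := al2_lt al Hal).
exists x1, (qs ^ 2 * x2), (- (2 * beta * b_alpha b qs al) * sg).
split; [|split].
- unfold full_sys, sigma_sys. rewrite Hqo. fold sg. repeat split.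
  + replace (sg / qs ^ 2 * nu1 b (al * qs) * (- (2 * beta * b_alpha b qs al) * sg)) with
    (sg ^ 2 * (- (2 * beta * b_alpha b qs al)) * nu1 b (al * qs) / qs ^ 2) by (field; lra).
    rewrite Hsq.
    replace (pE V) with (nu b (al * qs) * x1 + al * qs * nu1 b (al * qs) * x2 +
      2 * beta * (nu b 1 - (1 - al ^ 2) * nu1 b (al * qs) * b_alpha b qs al)) by (rewrite m1; ring).
    field. lra.
  + replace (pEs V) with (nu b (qs ^ 2) * x1 + qs ^ 2 * nu1 b (qs ^ 2) * x2
      + 2 * beta * nu b (al * qs)) by (rewrite m2; ring). ring.
  + apply Rmult_eq_reg_l with qs; [|lra].
    replace (qs * pGs V) with (qs * nu1 b (qs ^ 2) * x1 + qs * psi b (qs ^ 2) * x2 +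
      2 * beta * al * nu1 b (al * qs)) by (rewrite m3; ring). field. lra.
  + unfold b_alpha. field. split; lra.
- intros Hp. rewrite Hx2 by auto. ring.
- unfold vx_val.
  apply Rmult_eq_reg_l with qs; [|lra].
  replace (qs * (al / (2 * beta * qs * (1 - al ^ 2)))) with (al / (2 * beta * (1 - al ^ 2)))
    by (field; repeat split; lra).
  replace (al / (2 * beta * (1 - al ^ 2))) with (qs * nu1 b (al * qs) * x1 + qs * psi b (al * qs) * x2
    + 2 * beta * b_alpha b qs al * (al * psi b (al * qs) - qs * nu2 b (al * qs))) by (rewrite m4; ring).
  unfold psi. field. lra.
Qed.

(** By Cauchy-Schwarz, [phi (alpha^2) >= 1 / (2 (1 - alpha^2))]: so [alpha^2] is a barrier
    for the solution of the FDT equation. *)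
Lemma gamma_star_ok (b : nat -> R) (beta qs al : R) : mixture b -> 0 < qs <= 1 -> Rabs al < 1 ->
  1 / 2 <= phi (gamma_star beta b qs al) beta b (al ^ 2) * (1 - al ^ 2).
Proof.
intros Hb Hqs Hal. assert (Ha := al2_lt al Hal).
destruct (cs_nu1 b al qs Hb (Rlt_le _ _ Hal) Hqs) as [H _].
unfold phi, gamma_star.
set (X := nu1 b (al * qs) ^ 2 / nu1 b (qs ^ 2)) in *.
replace ((1 / (2 * (1 - al ^ 2)) - 2 * beta ^ 2 * X + 2 * beta ^ 2 * nu1 b (al ^ 2)) * (1 - al ^ 2))
  with (1 / 2 + (2 * beta ^ 2 * (nu1 b (al ^ 2) - X)) * (1 - al ^ 2)) by (field; lra).
assert (0 <= (2 * beta ^ 2 * (nu1 b (al ^ 2) - X)) * (1 - al ^ 2)); [|lra].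
apply Rmult_le_pos; [|lra]. apply Rmult_le_pos; [generalize (pow2_ge_0 beta); lra|lra].
Qed.

Definition star_relaxation (b : nat -> R) (beta qs al : R) (c h h' : R -> R) : Prop :=
  relaxation (phi (gamma_star beta b qs al) beta b) (fun x => 2 * beta ^ 2 * nu2 b x) (al ^ 2) c h h'.

Lemma c_gamma_star (b : nat -> R) (beta qs al : R) : mixture b -> 0 < qs <= 1 -> Rabs al < 1 ->
  exists c h h', star_relaxation b beta qs al c h h' /\
    is_c_gamma beta b (gamma_star beta b qs al) c (fun t => - h t) /\
    C1_on_halfline (fun t => - h t) (fun t => - h' t).
Proof.
intros Hb Hqs Hal. assert (Ha := al2_lt al Hal).
destruct (fdt_exists b beta (gamma_star beta b qs al) (al ^ 2) Hb Ha) as [c [h [h' HR]]].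
{ now apply gamma_star_ok. }
exists c, h, h'. split; [exact HR|]. now apply (fdt_is_c_gamma b beta _ (al ^ 2) c h h').
Qed.

(** A stationary dynamics solves the system by construction; by uniqueness it is the
    dynamics with these parameters. *)
Lemma construct (b : nat -> R) (beta qs al : R) (V : params) (c h h' : R -> R) : mixture b ->
  0 < beta -> 0 < qs <= 1 -> Rabs al < 1 -> allowed b qs V -> pqo V = al * qs ->
  in_image (stat_matrix b qs al) (stat_vector beta b qs al V) ->
  star_relaxation b beta qs al c h h' ->
  exists H0, let D := stat_dynamics c h (al * qs) H0 in
    is_Usp beta b qs V D /\ stationary D /\ has_profile D c (fun t => - 2 * - h t).
Proof.
intros Hb Hbeta Hqs Hal HA Hqo Him HR.
destruct (sys_of_image b beta qs al V Hb Hbeta Hqs Hal HA Hqo Him) as [w2 [w3 [w4 [Hs [Hp HV]]]]].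
assert (Hk := k_of_sys b qs al V _ _ _ _ Hb Hqs Hal Hqo Hs).
assert (Hiv := sys_is_v b qs al V _ _ _ _ Hb Hqs Hal Hqo Hs Hp).
set (v := v_of b qs (pqo V) (2 * beta) w2 w3 w4) in *.
set (H0 := 2 * beta * nu b 1 + w2 * nu b (al * qs) + w3 * (al * qs * nu1 b (al * qs) / qs ^ 2)
  + - (2 * beta * b_alpha b qs al) * (1 - al ^ 2) * nu1 b (al * qs)).
exists H0. intros D.
assert (SD : solves_v beta b qs (pqo V) v D).
{ unfold v, D. rewrite Hqo.
  apply (D_solves b beta (gamma_star beta b qs al) (al ^ 2) c h h'); auto.
  generalize (al2_lt al Hal); lra. }
split; [split|split].
- exists v. split; [exact Hiv|]. exact SD.
- intros D' [v' [Hiv' SD']].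
  destruct (is_v_sys b qs al V v' Hb Hqs Hal HA Hqo Hiv') as [u1 [u2 [u3 [u4 [Hu [Hpu ->]]]]]].
  destruct (sys_unique b qs al V _ _ _ _ _ _ _ _ Hb Hqs Hal Hqo Hs Hu Hp Hpu) as [<- [<- [<- <-]]].
  now apply (solves_v_unique b beta qs (pqo V) (2 * beta) w2 w3 w4).
- apply D_stationary; auto.
- apply D_profile.
Qed.

Lemma eq_dynamics_profile (D D' : dynamics) (c r : R -> R) :
  eq_dynamics D D' -> has_profile D c r -> has_profile D' c r.
Proof.
intros [H _] Hp s t Hst. destruct (H s t) as [a [a' _]]; try lra.
rewrite <- a, <- a'. now apply Hp.
Qed.

(** Along [x = q_o], [v_x] is affine in [y] and [v_y] is affine in [nu' y]. *)
Lemma v_of_shape (b : nat -> R) (qs qo w1 w2 w3 w4 : R) : in_disk b qo ->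
  let v := v_of b qs qo w1 w2 w3 w4 in let k := w4 * zc qs qo in
  (forall y, in_disk b y -> v_x v qo y = vx_val b qs qo w2 w3 k qo 0 + k * nu2 b qo * y) /\
  (forall y, in_disk b y -> is_derive (v qo) y (w1 * nu1 b y + k * nu1 b qo)).
Proof.
intros Hq v k. split; intros y Hy.
- unfold v; rewrite v_x_of by auto. fold k. unfold vx_val. ring.
- apply (is_derive_v_y b qs qo w1 w2 w3 w4 qo y Hy).
Qed.

Lemma is_v_shape (b : nat -> R) (qs : R) (V : params) (v : R -> R -> R) :
  in_disk b (pqo V) -> is_v b qs V v -> exists w1 a0 a1 a2,
  (forall y, in_disk b y -> v_x v (pqo V) y = a0 + a1 * y) /\
  (forall y, in_disk b y -> is_derive (v (pqo V)) y (w1 * nu1 b y + a2)).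
Proof.
intros Hq.
assert (G : forall w1 w2 w3 w4, (forall x y, v x y = v_of b qs (pqo V) w1 w2 w3 w4 x y) ->
  exists w1 a0 a1 a2,
  (forall y, in_disk b y -> v_x v (pqo V) y = a0 + a1 * y) /\
  (forall y, in_disk b y -> is_derive (v (pqo V)) y (w1 * nu1 b y + a2))).
{ intros w1 w2 w3 w4 Hv.
  replace v with (v_of b qs (pqo V) w1 w2 w3 w4).
  - do 4 eexists. now apply v_of_shape.
  - now do 2 (apply functional_extensionality; intros). }
intros [[p [Hp [_ Hv]]]|[[_ [_ [w1 [w2 [w4 [_ Hv]]]]]]|[_ [w1 [w2 [w3 [w4 [_ Hv]]]]]]]]; eauto.
exists (pE V / b p ^ 2), 0, 0, 0. split; intros y Hy.
- unfold v_x. rewrite (Derive_ext _ (fun _ => pE V * y ^ p)) by (intros; apply Hv).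
  rewrite Derive_const. ring.
- apply (is_derive_ext (fun y => pE V * y ^ p)); [intros; symmetry; apply Hv|].
  rewrite (pure_nu1 b p y Hp Hy). auto_derive; auto.
  assert (0 < b p ^ 2) by (apply sq_pos_of, Hp). field. intros E; rewrite E in H; simpl in H; lra.
Qed.

(** For [|alpha| = 1], [nec_q] gives [q_o = 0], which is absurd.  Otherwise [nec_H] forces
    [w1 = 2 beta], and [nec_q] is then the fourth constraint on the parameters. *)
Lemma necessity (b : nat -> R) (beta qs al : R) (V : params) (D : dynamics) : mixture b ->
  0 < beta -> 0 < qs <= 1 -> Rabs al <= 1 -> allowed b qs V -> pqo V = al * qs ->
  solves_sp beta b qs V D -> stationary D ->
  Rabs al < 1 /\ in_image (stat_matrix b qs al) (stat_vector beta b qs al V).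
Proof.
intros Hb Hbeta Hqs Hal HA Hqo [v [Hiv [SC [Q [SQ SH]]]]] [_ Hst].
assert (Hq : forall s, 0 <= s -> dq D s = pqo V) by (intros; rewrite <- Q; now apply Hst).
assert (HH : forall s, 0 <= s -> dH D s = dH D 0) by (intros; now apply Hst).
assert (Iq : in_disk b (pqo V)) by (rewrite Hqo; apply in_disk_qo; auto).
assert (Hlt : Rabs al < 1).
{ destruct Hal as [|Hal]; auto. exfalso.
  destruct (is_v_shape b qs V v Iq Hiv) as [w1 [a0 [a1 [a2 [Hx Hy]]]]].
  assert (E := nec_q b beta qs (pqo V) v D w1 a0 a1 a2 Hb SC Hq SQ Hx Hy).
  rewrite Hqo in E.
  assert (Ha : al ^ 2 = 1) by (rewrite <- pow2_abs, Hal; ring).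
  replace (qs ^ 2 - (al * qs) ^ 2) with (qs ^ 2 * (1 - al ^ 2)) in E by ring.
  rewrite Ha in E. assert (E2 : al * qs = 0) by lra.
  apply Rmult_integral in E2. destruct E2 as [E2|E2]; [rewrite E2 in Ha; simpl in Ha; lra|lra]. }
split; auto.
destruct (is_v_sys b qs al V v Hb Hqs Hlt HA Hqo Hiv) as [w1 [w2 [w3 [w4 [Hs [_ Hv]]]]]].
assert (Hk := k_of_sys b qs al V _ _ _ _ Hb Hqs Hlt Hqo Hs).
rewrite <- Hqo in Hk.
set (k := w4 * zc qs (pqo V)) in *.
assert (Hxy := v_of_shape b qs (pqo V) w1 w2 w3 w4 Iq). rewrite <- Hv in Hxy.
destruct Hxy as [Hx Hy]. fold k in Hx, Hy.
assert (E1 := nec_q b beta qs (pqo V) v D w1 _ _ _ Hb SC Hq SQ Hx Hy).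
assert (E2 := nec_H b beta qs (pqo V) v D w1 _ _ _ Hb SC Hq Hx Hy HH SH).
assert (Ha := al2_lt al Hlt).
assert (Hn := nu1_qs2_pos b qs Hb Hqs).
(* nec_H reads (2 beta - w1) (nu' 1 - X) = 0, and X <= nu' (alpha^2) < nu' 1 *)
assert (Hw1 : w1 = 2 * beta).
{ destruct (cs_nu1 b al qs Hb (Rlt_le _ _ Hlt) Hqs) as [CS _].
  assert (ST := nu1_strict b (al ^ 2) Hb Ha).
  rewrite Hk, Hqo in E2. unfold b_alpha in E2.
  set (X := nu1 b (al * qs) ^ 2 / nu1 b (qs ^ 2)) in *.
  assert (EX : - (w1 * (nu1 b (al * qs) / nu1 b (qs ^ 2))) * nu1 b (al * qs) = - (w1 * X))
    by (unfold X; field; lra).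
  rewrite EX in E2.
  assert (E3 : (nu1 b 1 - X) * (2 * beta - w1) = 0) by lra.
  apply Rmult_integral in E3. destruct E3; lra. }
subst w1.
apply (image_of_sys b beta qs al V w2 w3 w4); auto.
rewrite <- Hk, <- Hqo.
assert (E3 : vx_val b qs (pqo V) w2 w3 k (pqo V) 1 =
  vx_val b qs (pqo V) w2 w3 k (pqo V) 0 + k * nu2 b (pqo V)) by (unfold vx_val; ring).
rewrite E3.
apply Rmult_eq_reg_l with (beta * (qs ^ 2 - pqo V ^ 2)).
- rewrite E1. rewrite Hqo. field. repeat split; lra.
- rewrite Hqo. replace (qs ^ 2 - (al * qs) ^ 2) with (qs ^ 2 * (1 - al ^ 2)) by ring.
  apply Rmult_integral_contrapositive_currified; [lra|].
  apply Rmult_integral_contrapositive_currified; [apply pow_nonzero; lra|lra].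
Qed.

(** * The limit of c and the equality case *)

(** The derivative of [g_beta] on [0, 1). *)
Definition dgv (beta : R) (b : nat -> R) (x : R) : R :=
  2 * beta ^ 2 * nu1 b x + 1 / 2 - 1 / (2 * (1 - x)).

Lemma dg_val (beta : R) (b : nat -> R) (x : R) : mixture b -> 0 <= x < 1 ->
  dg_beta beta b x = Finite (dgv beta b x).
Proof.
intros Hb Hx. unfold dg_beta. destruct Req_EM_T as [E|_]; [lra|]. f_equal.
apply is_derive_unique. unfold g_beta.
assert (Hd := is_derive_nu b x (in_disk_01 b x Hb ltac:(lra))).
auto_derive.
- repeat split; [eexists; eauto|lra].
- change (Derive (fun x0 => nu b x0) x) with (nu1 b x). unfold dgv. field. lra.
Qed.

Lemma dg_1 (beta : R) (b : nat -> R) : dg_beta beta b 1 = m_infty.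
Proof. unfold dg_beta. destruct Req_EM_T; tauto. Qed.

Lemma c_inf_set_iff (beta : R) (b : nat -> R) (gamma x : R) : mixture b ->
  c_inf_set beta b gamma x <-> 0 <= x < 1 /\ 1 / 2 - gamma <= dgv beta b x.
Proof.
intros Hb. unfold c_inf_set. split.
- intros [Hx Hle]. destruct (Req_dec x 1) as [->|Hne].
  + rewrite dg_1 in Hle. contradiction.
  + split; [lra|]. rewrite dg_val in Hle by (auto; lra). exact Hle.
- intros [Hx Hle]. split; [lra|]. rewrite dg_val by auto. exact Hle.
Qed.

Lemma c_inf_lub (beta : R) (b : nat -> R) (gamma x M : R) : mixture b ->
  c_inf_set beta b gamma x -> (forall y, c_inf_set beta b gamma y -> y <= M) ->
  x <= c_inf beta b gamma <= M.
Proof.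
intros Hb Hx HM. unfold c_inf.
destruct (Lub_Rbar_correct (c_inf_set beta b gamma)) as [H1 H2].
assert (Hx' := H1 x Hx). assert (HM' := H2 (Finite M) HM).
destruct (Lub_Rbar (c_inf_set beta b gamma)); simpl in *; try contradiction. lra.
Qed.

Lemma gamma_star_in (b : nat -> R) (beta qs al : R) : mixture b -> 0 < qs <= 1 -> Rabs al < 1 ->
  dgv beta b (al ^ 2) - (1 / 2 - gamma_star beta b qs al) =
  2 * beta ^ 2 * (nu1 b (al ^ 2) - nu1 b (al * qs) ^ 2 / nu1 b (qs ^ 2)).
Proof. intros. unfold dgv, gamma_star. ring. Qed.

Lemma al2_in_set (b : nat -> R) (beta qs al : R) : mixture b -> 0 < qs <= 1 -> Rabs al < 1 ->
  c_inf_set beta b (gamma_star beta b qs al) (al ^ 2).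
Proof.
intros Hb Hqs Hal. apply c_inf_set_iff; auto. split; [now apply al2_lt|].
assert (E := gamma_star_in b beta qs al Hb Hqs Hal).
destruct (cs_nu1 b al qs Hb (Rlt_le _ _ Hal) Hqs) as [H _].
assert (0 <= 2 * beta ^ 2 * (nu1 b (al ^ 2) - nu1 b (al * qs) ^ 2 / nu1 b (qs ^ 2))).
{ apply Rmult_le_pos; [generalize (pow2_ge_0 beta)|]; lra. }
lra.
Qed.

Lemma continuous_dgv (beta : R) (b : nat -> R) (x : R) : mixture b -> 0 <= x < 1 ->
  continuous (dgv beta b) x.
Proof.
intros Hb Hx.
assert (Hd := is_derive_nu1 b x (in_disk_01 b x Hb ltac:(lra))).
apply (ex_derive_continuous (K := R_AbsRing) (V := R_NormedModule)). unfold dgv. auto_derive.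
repeat split; [eexists; eauto|lra].
Qed.

(** ** Even and odd mixtures *)

Lemma is_derive_reflect (f : R -> R) (x l : R) :
  is_derive f (- x) l -> is_derive (fun y => f (- y)) x (- l).
Proof.
intros H. replace (- l) with (-1 * l) by ring.
apply (deriv_comp f (fun y => - y)); auto. auto_derive; auto; ring.
Qed.

Lemma nu1_opp_even (b : nat -> R) (x : R) : nu_even b -> in_disk b x -> nu1 b (- x) = - nu1 b x.
Proof.
intros He Hx. assert (H : nu1 b x = - nu1 b (- x)); [|rewrite H; ring].
apply (is_derive_unique (nu b)). apply (is_derive_ext (fun y => nu b (- y))); [apply He|].
apply is_derive_reflect, is_derive_nu, in_disk_opp, Hx.
Qed.

Lemma nu1_opp_odd (b : nat -> R) (x : R) : nu_odd b -> in_disk b x -> nu1 b (- x) = nu1 b x.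
Proof.
intros He Hx. symmetry; apply (is_derive_unique (nu b)).
apply (is_derive_ext (fun y => - nu b (- y))); [intros; rewrite He; rring|].
rewrite <- (Ropp_involutive (nu1 b (- x))).
apply deriv_opp, is_derive_reflect, is_derive_nu, in_disk_opp, Hx.
Qed.

Lemma nu2_opp_even (b : nat -> R) (x : R) : nu_even b -> in_disk b x -> nu2 b (- x) = nu2 b x.
Proof.
intros He Hx. symmetry; apply (is_derive_unique (nu1 b)).
apply (is_derive_ext_loc (fun y => - nu1 b (- y))).
{ eapply filter_imp; [|apply in_disk_locally, Hx]. intros y Hy; simpl.
  rewrite nu1_opp_even by auto. ring. }
rewrite <- (Ropp_involutive (nu2 b (- x))).
apply deriv_opp, is_derive_reflect, is_derive_nu1, in_disk_opp, Hx.
Qed.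

Lemma psi_opp_even (b : nat -> R) (x : R) : nu_even b -> in_disk b x -> psi b (- x) = - psi b x.
Proof. intros He Hx. unfold psi. rewrite nu1_opp_even, nu2_opp_even by auto. ring. Qed.

Lemma nu1_sq_parity (b : nat -> R) (x : R) : nu_even b \/ nu_odd b -> in_disk b x ->
  nu1 b (- x) ^ 2 = nu1 b x ^ 2.
Proof.
intros [H|H] Hx; [rewrite nu1_opp_even by auto; ring|now rewrite nu1_opp_odd].
Qed.

Lemma gamma_star_opp (b : nat -> R) (beta qs : R) : mixture b -> 0 < qs <= 1 ->
  nu_even b \/ nu_odd b -> gamma_star beta b qs (- qs) = gamma_star beta b qs qs.
Proof.
intros Hb Hqs Hp. unfold gamma_star.
replace (- qs * qs) with (- (qs * qs)) by ring.
rewrite nu1_sq_parity; auto.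
- replace ((- qs) ^ 2) with (qs ^ 2) by ring. reflexivity.
- apply in_disk_01; auto; nra.
Qed.

Lemma parity_nu (b : nat -> R) :
  (forall p, b p <> 0 -> (-1) ^ p = 1) \/ (forall p, b p <> 0 -> (-1) ^ p = -1) ->
  nu_even b \/ nu_odd b.
Proof.
intros [H|H]; [left|right]; intros r; unfold nu, PSeries.
- apply Series_ext. intros p. destruct (Req_dec (b p) 0) as [->|Hne]; [ring|].
  replace (- r) with ((-1) * r) by ring. rewrite Rpow_mult_distr, (H p Hne). ring.
- rewrite <- Series_opp. apply Series_ext. intros p. destruct (Req_dec (b p) 0) as [->|Hne]; [ring|].
  replace (- r) with ((-1) * r) by ring. rewrite Rpow_mult_distr, (H p Hne). ring.
Qed.

Lemma pow_eq_01 (x : R) (m n : nat) : 0 <= x -> (0 < m)%nat -> (m < n)%nat -> x ^ m = x ^ n -> x = 0 \/ x = 1.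
Proof.
intros Hx Hm Hmn E. replace n with (m + (n - m))%nat in E by lia. rewrite pow_add in E.
destruct (Req_dec (x ^ m) 0) as [Z|NZ].
- left. destruct (Req_dec x 0); auto. exfalso. apply (pow_nonzero x m); auto.
- right. assert (E1 : x ^ (n - m) = 1).
  { apply Rmult_eq_reg_l with (x ^ m); auto. lra. }
  destruct (Rtotal_order x 1) as [L|[L|L]]; auto; exfalso.
  + assert (x ^ (n - m) < 1) by (apply pow_lt_1_compat; [lra|lia]). lra.
  + assert (1 < x ^ (n - m)) by (apply Rlt_pow_R1; [lra|lia]). lra.
Qed.

(** ** The equality case *)

(** Equality in Cauchy-Schwarz means that [(alpha / q_star)^(p-1)] is the same for all
    p in the mixture.  With two different p, the ratio [alpha / q_star] is then 0, 1
    or -1, and for -1 all the p have the same parity. *)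
Lemma cs_equality (b : nat -> R) (qs al : R) : mixture b -> 0 < qs <= 1 -> Rabs al < 1 ->
  nu1 b (al * qs) ^ 2 / nu1 b (qs ^ 2) = nu1 b (al ^ 2) <->
  pure b \/ al = qs \/ (al = - qs /\ (nu_even b \/ nu_odd b)) \/ al = 0.
Proof.
intros Hb Hqs Hal.
destruct (cs_nu1 b al qs Hb (Rlt_le _ _ Hal) Hqs) as [_ CS].
assert (Hn := nu1_qs2_pos b qs Hb Hqs).
split.
- intros E. destruct (classic (pure b)) as [Hp|Hp]; [now left|right].
  assert (HE := proj1 CS E). set (l := nu1 b (al * qs) / nu1 b (qs ^ 2)) in *.
  set (rho := al / qs).
  assert (Hrho : forall p, b p <> 0 -> rho ^ pred p = l).
  { intros p Hbp. unfold rho, Rdiv. rewrite Rpow_mult_distr, (HE p Hbp), pow_inv.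
    field. apply pow_nonzero; lra. }
  assert (Hge : forall p, b p <> 0 -> (2 <= p)%nat).
  { intros p Hbp. destruct Hb as [B0 [B1 _]]. destruct p as [|[|p]]; try contradiction; lia. }
  assert (H01 : Rabs rho = 0 \/ Rabs rho = 1).
  { destruct (not_pure_two b Hb Hp) as [p [q [Hpq [Bp Bq]]]].
    assert (G : forall p q, (p < q)%nat -> b p <> 0 -> b q <> 0 -> Rabs rho = 0 \/ Rabs rho = 1).
    { clear p q Hpq Bp Bq. intros p q Hpq Bp Bq. generalize (Hge p Bp) (Hge q Bq); intros.
      apply (pow_eq_01 _ (pred p) (pred q)); [apply Rabs_pos|lia|lia|].
      rewrite !RPow_abs. now rewrite (Hrho p), (Hrho q). }
    destruct (Nat.lt_total p q) as [L|[L|L]]; [now apply (G p q)|contradiction|now apply (G q p)]. }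
  assert (Ealrho : al = rho * qs) by (unfold rho; field; lra).
  destruct H01 as [Z|O].
  + right; right. apply Rabs_eq_0 in Z. rewrite Ealrho, Z. ring.
  + unfold Rabs in O. destruct Rcase_abs as [Neg|Pos].
    * right; left. assert (Er : rho = -1) by lra. split; [rewrite Ealrho, Er; ring|].
      apply parity_nu. rewrite Er in Hrho.
      destruct (mixture_supp b Hb) as [p0 [Hp0 Bp0]].
      assert (Hall : forall p, b p <> 0 -> (-1) ^ p = (-1) ^ p0).
      { intros p Bp. assert (Bp0' : b p0 <> 0) by lra.
        assert (E1 := Hrho p Bp). assert (E2 := Hrho p0 Bp0').
        generalize (Hge p Bp); intros.
        destruct p as [|p]; [lia|]. destruct p0 as [|p0]; [lia|]. simpl pred in *. simpl.
        rewrite E1, E2. reflexivity. }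
      assert (G : forall n, (-1) ^ n = 1 \/ (-1) ^ n = -1).
      { induction n as [|n [IH|IH]]; [now left|right|left]; simpl; rewrite IH; ring. }
      destruct (G p0) as [G0|G0]; [left|right]; intros p Bp; rewrite Hall; auto.
    * left. assert (Er : rho = 1) by lra. rewrite Ealrho, Er. ring.
- intros H. destruct H as [[p Hp] | [-> | [[-> Hpar] | ->]]].
  + apply CS. intros k Bk. destruct (Nat.eq_dec k p) as [->|Hne]; [|exfalso; apply Bk; now apply Hp].
    assert (E1 := pure_nu1 b p (al * qs) Hp ltac:(apply in_disk_qo; auto; lra)).
    assert (E2 := pure_nu1 b p (qs ^ 2) Hp ltac:(now apply in_disk_qs2)).
    rewrite E1, E2. rewrite E2 in Hn.
    rewrite Rpow_mult_distr, <- pow_mult, (Nat.mul_comm 2), pow_mult in *.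
    assert (Y : 0 < qs ^ pred p) by (apply pow_lt; lra).
    assert (B2 : b p <> 0) by exact Bk.
    assert (IP : INR p <> 0) by (intros Z; rewrite Z in Hn; lra).
    field. repeat split; auto; lra.
  + replace (qs * qs) with (qs ^ 2) by ring. field. lra.
  + replace (- qs * qs) with (- (qs ^ 2)) by ring. rewrite nu1_sq_parity; auto; [|now apply in_disk_qs2].
    replace ((- qs) ^ 2) with (qs ^ 2) by ring. field. lra.
  + replace (0 ^ 2) with 0 by ring. rewrite Rmult_0_l, nu1_0 by auto. field. lra.
Qed.

(** To the right of [c_inf], [g_beta'] stays below [1/2 - gamma].  If [c_inf = alpha^2]
    then by continuity [g_beta' (alpha^2)] cannot exceed [1/2 - gamma_star], and
    their difference is [2 beta^2] times the defect in Cauchy-Schwarz. *)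
Lemma c_inf_eq (b : nat -> R) (beta qs al : R) : mixture b -> 0 < beta -> 0 < qs <= 1 -> Rabs al < 1 ->
  (c_inf beta b (gamma_star beta b qs al) = al ^ 2 <->
   (forall x, al ^ 2 < x <= 1 -> Rbar_lt (dg_beta beta b x) (dg_beta beta b (al ^ 2))) /\
   (pure b \/ al = qs \/ (al = - qs /\ (nu_even b \/ nu_odd b)) \/ al = 0)).
Proof.
intros Hb Hbeta Hqs Hal. assert (Ha := al2_lt al Hal).
set (g := gamma_star beta b qs al).
assert (Hin := al2_in_set b beta qs al Hb Hqs Hal). fold g in Hin.
assert (Hg := gamma_star_in b beta qs al Hb Hqs Hal). fold g in Hg.
assert (Hle1 : forall y, c_inf_set beta b g y -> y <= 1) by (intros y [Hy _]; lra).
destruct (cs_nu1 b al qs Hb (Rlt_le _ _ Hal) Hqs) as [CS _].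
rewrite <- (cs_equality b qs al) by auto.
assert (Hb2 : 0 < 2 * beta ^ 2) by (assert (0 < beta ^ 2) by (apply pow_lt; auto); lra).
split.
- intros E.
  assert (Hout : forall x, al ^ 2 < x < 1 -> dgv beta b x < 1 / 2 - g).
  { intros x Hx. destruct (Rlt_dec (dgv beta b x) (1 / 2 - g)) as [|Hn]; auto. exfalso.
    assert (Hs : c_inf_set beta b g x) by (apply c_inf_set_iff; auto; lra).
    generalize (c_inf_lub beta b g x 1 Hb Hs Hle1); lra. }
  assert (Heq : nu1 b (al * qs) ^ 2 / nu1 b (qs ^ 2) = nu1 b (al ^ 2)).
  { destruct CS as [CS|]; auto. exfalso.
    assert (Hp : 0 < dgv beta b (al ^ 2) - (1 / 2 - g)).
    { rewrite Hg. apply Rmult_lt_0_compat; lra. }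
    destruct (continuous_pos (fun x => dgv beta b x - (1 / 2 - g)) (al ^ 2)) as [d [Hd Hdp]]; auto.
    { apply cont_minus; [now apply continuous_dgv|apply continuous_const]. }
    set (x := Rmin (al ^ 2 + d / 2) ((1 + al ^ 2) / 2)).
    assert (Hx1 : al ^ 2 < x) by (apply Rmin_glb_lt; lra).
    assert (Hx2 : x <= al ^ 2 + d / 2) by apply Rmin_l.
    assert (Hx3 : x <= (1 + al ^ 2) / 2) by apply Rmin_r.
    assert (H1 := Hout x ltac:(lra)).
    assert (H2 := Hdp x ltac:(rewrite Rabs_right; lra)). lra. }
  split; auto.
  intros x Hx. rewrite (dg_val beta b (al ^ 2)) by auto.
  destruct (Req_dec x 1) as [->|Hne]; [rewrite dg_1; exact I|].
  rewrite dg_val by (auto; lra). simpl.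
  assert (H1 := Hout x ltac:(lra)). rewrite Heq in Hg. simpl in *. lra.
- intros [Hlt Heq]. rewrite Heq in Hg.
  assert (H : al ^ 2 <= c_inf beta b g <= al ^ 2); [|lra].
  apply c_inf_lub; auto. intros y Hy. destruct (Rle_dec y (al ^ 2)) as [|Hn]; auto. exfalso.
  apply c_inf_set_iff in Hy; auto. destruct Hy as [Hy1 Hy2].
  assert (H1 := Hlt y ltac:(lra)). rewrite !dg_val in H1 by (auto; lra). simpl in H1, Hg. lra.
Qed.

(** ** The constraint for alpha = q_star and alpha = - q_star *)

(** The determinant is the Gram determinant of 1 and p in the space of sequences with
    weights [b_p^2 x^p], so it vanishes only if a single p carries weight. *)
Lemma nu_det_pos (b : nat -> R) (x : R) : mixture b -> ~ pure b -> in_disk b x -> 0 < x ->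
  nu b x * (x * psi b x) - (x * nu1 b x) ^ 2 <> 0.
Proof.
intros Hb Hn Hx H0 HE.
destruct (not_pure_two b Hb Hn) as [p [q [Hpq [Hp Hq]]]].
assert (Hnu := nu_pos b x Hb Hx H0).
set (l := x * nu1 b x / nu b x).
assert (H := series_lin _ _ _ _ 1 1 (series_lin _ _ _ _ 1 (- (2 * l)) (series_xpsi b x Hx) (series_xnu1 b x Hx))
  (series_lin _ _ _ _ (l ^ 2) 0 (series_nu b x Hx) (series_nu b x Hx))).
cbv beta in H.
match type of H with is_series _ ?e => replace e with 0 in H end.
2: { assert (El : x * psi b x = l ^ 2 * nu b x).
     { apply Rmult_eq_reg_l with (nu b x); [|lra].
       replace (nu b x * (l ^ 2 * nu b x)) with ((x * nu1 b x) ^ 2) by (unfold l; field; lra). lra. }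
     rewrite El. unfold l. field. lra. }
assert (Hs : is_series (fun n => b n ^ 2 * x ^ n * (INR n - l) ^ 2) 0).
{ eapply is_series_ext; [|apply H]. intros n; cbv beta; rring. }
assert (Hnn : forall n, 0 <= b n ^ 2 * x ^ n * (INR n - l) ^ 2).
{ intros n. apply Rmult_le_pos; [|apply pow2_ge_0]. apply Rmult_le_pos; [apply pow2_ge_0|apply pow_le; lra]. }
assert (Hl : forall n, b n <> 0 -> INR n = l).
{ intros n Hne. assert (Hz := series_zero _ _ Hnn Hs eq_refl n).
  assert (0 < b n ^ 2 * x ^ n).
  { apply Rmult_lt_0_compat; [now apply sq_pos_of|now apply pow_lt]. }
  apply Rmult_integral in Hz. destruct Hz as [Hz|Hz]; [lra|].
  simpl in Hz. rewrite Rmult_1_r in Hz. apply Rmult_integral in Hz. lra. }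
apply Hpq, INR_eq. rewrite (Hl p), (Hl q); auto.
Qed.

(** For [|alpha| = q_star] the first and fourth rows of the matrix repeat the second
    and third, up to sign.  This gives the two conditions; conversely they suffice,
    as the second and third rows are independent unless the mixture is pure, and
    then the constraint on [G_star] makes these two equations compatible. *)
Lemma diag_constraint (b : nat -> R) (beta qs al : R) (V : params) : mixture b -> 0 < beta -> 0 < qs <= 1 ->
  al = qs \/ (nu_even b /\ al = - qs) -> allowed b qs V -> pqo V = al * qs ->
  ((Rabs al < 1 /\ in_image (stat_matrix b qs al) (stat_vector beta b qs al V)) <->
   pGs V = 1 / (2 * beta * (1 - qs ^ 2)) + 2 * beta * (1 - qs ^ 2) * nu2 b (qs ^ 2) /\
   pE V - pEs V = 2 * beta * (nu b 1 - (1 - qs ^ 2) * nu1 b (qs ^ 2) - nu b (qs ^ 2))).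
Proof.
intros Hb Hbeta Hqs Hal [_ [HA1 HA2]] Hqo.
assert (Is : in_disk b (qs ^ 2)) by now apply in_disk_qs2.
assert (Hn := nu1_qs2_pos b qs Hb Hqs).
assert (Hq2 : 0 < qs ^ 2) by (apply pow_lt; lra).
assert (Hnu := nu_pos b (qs ^ 2) Hb Is Hq2).
assert (Hsg : exists sg, sg * sg = 1 /\ al = sg * qs /\ nu b (al * qs) = nu b (qs ^ 2) /\
  nu1 b (al * qs) = sg * nu1 b (qs ^ 2) /\ nu2 b (al * qs) = nu2 b (qs ^ 2) /\
  psi b (al * qs) = sg * psi b (qs ^ 2)).
{ destruct Hal as [->|[He ->]].
  - exists 1. replace (qs * qs) with (qs ^ 2) by ring. repeat split; ring.
  - exists (-1). replace (- qs * qs) with (- qs ^ 2) by ring.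
    rewrite nu1_opp_even, nu2_opp_even, psi_opp_even, He by auto. repeat split; ring. }
destruct Hsg as [sg [S1 [S2 [E0 [E1 [E2 E3]]]]]].
assert (Hal2 : al ^ 2 = qs ^ 2).
{ rewrite S2. replace ((sg * qs) ^ 2) with (sg * sg * qs ^ 2) by ring. rewrite S1. ring. }
assert (Hlt : Rabs al < 1).
{ rewrite Hqo, Rabs_mult, (Rabs_right qs) in HA1 by lra.
  assert (Eab : Rabs al = qs).
  { apply Rsqr_inj; [apply Rabs_pos|lra|]. rewrite <- Rsqr_abs. unfold Rsqr.
    replace (al * al) with (al ^ 2) by ring. rewrite Hal2. ring. }
  rewrite Eab in *. nra. }
assert (Ha := al2_lt al Hlt).
assert (Eb : b_alpha b qs al = sg) by (unfold b_alpha; rewrite E1; field; lra).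
rewrite image_eqs, E0, E1, E2, E3, Eb, Hal2.
set (N := nu b (qs ^ 2)) in *. set (N1 := nu1 b (qs ^ 2)) in *. set (N2 := nu2 b (qs ^ 2)) in *.
assert (EPsi : psi b (qs ^ 2) = qs ^ 2 * N2 + N1) by reflexivity.
set (Psi := psi b (qs ^ 2)) in *.
assert (Hs0 : sg <> 0) by (intros Z; rewrite Z in S1; lra).
assert (Hd : 2 * beta * (1 - qs ^ 2) <> 0).
{ rewrite Hal2 in Ha. apply Rmult_integral_contrapositive_currified; lra. }
assert (Hd1 : 1 - qs ^ 2 <> 0) by (rewrite Hal2 in Ha; lra).
set (G := 1 / (2 * beta * (1 - qs ^ 2))) in *.
assert (EG : al / (2 * beta * (1 - qs ^ 2)) = sg * qs * G) by (unfold G; rewrite S2; field; split; lra).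
rewrite EG.
split.
- intros [_ [x1 [x2 [m1 [m2 [m3 m4]]]]]].
  rewrite S2 in m1, m3, m4.
  assert (m4' : qs * N1 * x1 + qs * Psi * x2 = qs * G - 2 * beta * qs * (Psi - N2)).
  { apply Rmult_eq_reg_l with sg; auto.
    transitivity (qs * (sg * N1) * x1 + qs * (sg * Psi) * x2); [ring|]. rewrite m4.
    replace (2 * beta * sg * (sg * qs * (sg * Psi) - qs * N2)) with
      (sg * (2 * beta * qs * (sg * sg * Psi - N2))) by ring. rewrite S1. ring. }
  split.
  + apply Rmult_eq_reg_l with qs; [|lra].
    replace (2 * beta * (sg * qs) * (sg * N1)) with (2 * beta * qs * N1 * (sg * sg)) in m3 by ring.
    rewrite S1 in m3. rewrite EPsi in m3, m4'. lra.
  + replace (sg * qs * qs * (sg * N1) * x2) with (qs ^ 2 * N1 * x2 * (sg * sg)) in m1 by ring.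
    replace ((1 - qs ^ 2) * (sg * N1) * sg) with ((1 - qs ^ 2) * N1 * (sg * sg)) in m1 by ring.
    rewrite S1 in m1. lra.
- intros [HG HE]. split; auto.
  assert (Hx : exists x1 x2, N * x1 + qs ^ 2 * N1 * x2 = pEs V - 2 * beta * N /\
    N1 * x1 + Psi * x2 = pGs V - 2 * beta * N1).
  { destruct (classic (pure b)) as [[p Hp]|Hp].
    - destruct (HA2 p Hp) as [HGp _].
      assert (Hpn := pure_nu b p _ Hp Is). fold N N1 in Hpn.
      exists ((pEs V - 2 * beta * N) / N), 0. split; [field; lra|].
      rewrite HGp.
      assert (EN1 : N1 = INR p * N / qs ^ 2) by (rewrite <- Hpn; field; lra).
      rewrite EN1. field. split; lra.
    - assert (Hdet := nu_det_pos b (qs ^ 2) Hb Hp Is Hq2). fold N N1 Psi in Hdet.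
      set (A := pEs V - 2 * beta * N). set (B := pGs V - 2 * beta * N1).
      assert (Hdet' : N * Psi - qs ^ 2 * N1 * N1 <> 0).
      { intros Z. apply Hdet. transitivity (qs ^ 2 * (N * Psi - qs ^ 2 * N1 * N1)); [ring|].
        rewrite Z; ring. }
      exists ((A * Psi - B * (qs ^ 2 * N1)) / (N * Psi - qs ^ 2 * N1 * N1)),
             ((N * B - N1 * A) / (N * Psi - qs ^ 2 * N1 * N1)).
      split; field; auto. }
  destruct Hx as [x1 [x2 [X1 X2]]]. exists x1, x2. rewrite S2.
  assert (m4' : qs * N1 * x1 + qs * Psi * x2 = qs * G - 2 * beta * qs * (Psi - N2)).
  { transitivity (qs * (N1 * x1 + Psi * x2)); [ring|]. rewrite X2, HG, EPsi. ring. }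
  split; [|split; [|split]].
  + replace (sg * qs * qs * (sg * N1) * x2) with (qs ^ 2 * N1 * x2 * (sg * sg)) by ring.
    replace ((1 - qs ^ 2) * (sg * N1) * sg) with ((1 - qs ^ 2) * N1 * (sg * sg)) by ring.
    rewrite S1. lra.
  + exact X1.
  + replace (2 * beta * (sg * qs) * (sg * N1)) with (2 * beta * qs * N1 * (sg * sg)) by ring.
    rewrite S1. transitivity (qs * (N1 * x1 + Psi * x2)); [ring|]. rewrite X2. ring.
  + transitivity (sg * (qs * N1 * x1 + qs * Psi * x2)); [ring|]. rewrite m4'.
    replace (2 * beta * sg * (sg * qs * (sg * Psi) - qs * N2)) with
      (sg * (2 * beta * qs * (sg * sg * Psi - N2))) by ring. rewrite S1. ring.
Qed.

Lemma CR_system_ext (beta : R) (b : nat -> R) (A A' : R -> R -> R) (D : dynamics) :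
  (forall s t, 0 <= s -> 0 <= t -> A s t = A' s t) -> CR_system beta b A D -> CR_system beta b A' D.
Proof.
intros HA [H1 [H2 [H3 [H4 [H5 [H6 [H7 H8]]]]]]].
repeat (split; [assumption|]). split.
- intros s t Ht. rewrite <- HA by lra. now apply H7.
- intros s t Ht. rewrite <- !HA by lra. now apply H8.
Qed.

(** ** Reflection of q for even mixtures *)

Definition flip (D : dynamics) : dynamics :=
  Dynamics (dC D) (dR D) (dchi D) (fun s => - dq D s) (dH D).

Lemma flip_regular (b : nat -> R) (D : dynamics) : regular b D -> regular b (flip D).
Proof.
intros [h1 [h2 [h3 [h4 [[M h5] [h6 [h7 [h8 h9]]]]]]]].
split; [exact h1|]. split; [exact h2|].
split.
{ now apply continuous_on_opp. }
split; [exact h4|]. split.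
{ exists M. intros s t Hs Ht. simpl. rewrite Rabs_Ropp. now apply h5. }
split.
{ intros s t Hs Ht. simpl. rewrite Rabs_Ropp. now apply h6. }
split; [exact h7|]. split; [|exact h9].
intros s Hs. destruct (h8 s Hs) as [a c]. simpl. split.
- apply (ex_derive_opp (K := R_AbsRing) (V := R_NormedModule)); auto.
- apply (continuous_ext (fun x => - Derive (dq D) x)).
  + intros x; symmetry; apply Derive_opp.
  + apply cont_opp; auto.
Qed.

Lemma zc_opp (qs qo : R) : zc qs (- qo) = zc qs qo.
Proof. unfold zc. rewrite Rabs_Ropp. replace ((- qo) ^ 2) with (qo ^ 2) by ring. reflexivity. Qed.

(** Changing the signs of [q_o] and [w4] preserves the system and turns [v (x, y)] into
    [v (- x, y)]. *)
Lemma flip_v (b : nat -> R) (qs E Es Gs qo : R) (v : R -> R -> R) : nu_even b -> in_disk b qo ->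
  is_v b qs (Params E Es Gs qo) v -> exists v',
  is_v b qs (Params E Es Gs (- qo)) v' /\
  forall x y, in_disk b x -> in_disk b y -> v' (- x) y = v x y /\ v_x v' (- x) y = - v_x v x y /\
    v_y v' (- x) y = v_y v x y.
Proof.
intros He Hq Hv.
assert (G : forall w1 w2 w3 w4, (forall x y, v x y = v_of b qs qo w1 w2 w3 w4 x y) ->
  forall x y, in_disk b x -> in_disk b y ->
  v_of b qs (- qo) w1 w2 w3 (- w4) (- x) y = v x y /\
  v_x (v_of b qs (- qo) w1 w2 w3 (- w4)) (- x) y = - v_x v x y /\
  v_y (v_of b qs (- qo) w1 w2 w3 (- w4)) (- x) y = v_y v x y).
{ intros w1 w2 w3 w4 Hv' x y Hx Hy.
  replace v with (v_of b qs qo w1 w2 w3 w4)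
    by now do 2 (apply functional_extensionality; intros).
  rewrite !v_x_of, !v_y_of by (auto; now apply in_disk_opp).
  unfold v_of, vx_val, vy_val. rewrite !zvar_lin, zc_opp, He, nu1_opp_even, nu2_opp_even, psi_opp_even by auto.
  unfold Rdiv. repeat split; ring. }
destruct Hv as [[p [Hp [H Hv]]]|[[Hp [H [w1 [w2 [w4 [Hs Hv]]]]]]|[Hp [w1 [w2 [w3 [w4 [Hs Hv]]]]]]]]; simpl in *.
- exists v. split.
  + left. exists p. simpl. rewrite Rabs_Ropp. auto.
  + intros x y _ _. split; [now rewrite !Hv|]. split.
    * unfold v_x. rewrite !(Derive_ext (fun x' => v x' y) (fun _ => E * y ^ p)) by (intros; apply Hv).
      rewrite !Derive_const. ring.
    * unfold v_y. apply Derive_ext. intros; now rewrite !Hv.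
- exists (v_of b qs (- qo) w1 w2 0 (- w4)). split; [|now apply G].
  right; left. simpl. rewrite Rabs_Ropp. split; auto. split; auto. exists w1, w2, (- w4). split; auto.
  apply Sigma_pure_eqs in Hs. apply Sigma_pure_eqs.
  replace ((- qo) ^ 2) with (qo ^ 2) by ring. rewrite He, nu1_opp_even by auto.
  destruct Hs as [h1 [h2 h3]]. repeat split; [rewrite <- h1; ring|exact h2|].
  transitivity (- (sqrt (qs ^ 2 - qo ^ 2) / qs ^ 2 * nu1 b qo * w1 + nu1 b (qs ^ 2) / qs ^ 2 * w4)); [ring|].
  rewrite h3; ring.
- exists (v_of b qs (- qo) w1 w2 w3 (- w4)). split; [|now apply G].
  right; right. split; auto. exists w1, w2, w3, (- w4). split; auto. simpl.
  apply Sigma_eqs in Hs. apply Sigma_eqs. unfold sigma_sys in *.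
  replace ((- qo) ^ 2) with (qo ^ 2) by ring. rewrite He, nu1_opp_even by auto.
  destruct Hs as [h1 [h2 [h3 h4]]]. repeat split; [rewrite <- h1; unfold Rdiv; ring|exact h2| |].
  + rewrite <- h3. unfold Rdiv; ring.
  + transitivity (- (sqrt (qs ^ 2 - qo ^ 2) / qs ^ 2 * nu1 b qo * w1 + nu1 b (qs ^ 2) / qs ^ 2 * w4)); [ring|].
    rewrite h4; ring.
Qed.

Lemma flip_L (b : nat -> R) (qs : R) (D : dynamics) (s : R) : nu_even b -> regular b D -> 0 <= s ->
  dL b qs (flip D) s = - dL b qs D s.
Proof.
intros He HR Hs. unfold dL.
rewrite (RInt_ext_le (fun u => dR (flip D) s u * nu1 b (dq (flip D) u))
  (fun u => - (dR D s u * nu1 b (dq D u)))); auto.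
- rewrite RInt_Ropp by (now apply (ex_int3 b D HR)).
  simpl. ring.
- intros u Hu. simpl. rewrite nu1_opp_even by (auto; apply (reg_disk_q b D HR); lra).
  simpl. ring.
Qed.

Lemma flip_solves (b : nat -> R) (beta qs E Es Gs qo : R) (D : dynamics) : nu_even b ->
  solves_sp beta b qs (Params E Es Gs qo) D -> solves_sp beta b qs (Params E Es Gs (- qo)) (flip D).
Proof.
intros He [v [Hv [SC [Q [SQ SH]]]]].
assert (HR : regular b D) by apply SC.
assert (Iq : in_disk b qo) by (simpl in Q; rewrite <- Q; apply reg_disk_q; [auto|lra]).
destruct (flip_v b qs E Es Gs qo v He Iq Hv) as [v' [Hv' Hvv]].
assert (IQ : forall s, 0 <= s -> in_disk b (dq D s)) by (intros; now apply (reg_disk_q b D HR)).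
assert (IC : forall s, 0 <= s -> in_disk b (dC D s 0)) by (intros; apply (reg_disk_C b D HR); lra).
assert (EA : forall s t, 0 <= s -> 0 <= t -> A_C beta b qs v D s t = A_C beta b qs v' (flip D) s t).
{ intros s t Hs Ht. unfold A_C. rewrite !flip_L by auto.
  destruct (Hvv (dq D s) (dC D s 0)) as [_ [X Y]]; auto. simpl. rewrite X, Y.
  rewrite nu1_opp_even, nu2_opp_even by auto. ring. }
exists v'. split; [exact Hv'|]. split; [|split; [|split]].
- apply (CR_system_ext _ _ _ _ _ EA). destruct SC as [_ SC].
  split; [now apply flip_regular|exact SC].
- simpl in *. now rewrite Q.
- intros s Hs. rewrite <- EA by lra. simpl.
  assert (EAq : A_q beta b qs (- qo) v' (flip D) s = - A_q beta b qs qo v D s).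
  { unfold A_q. rewrite flip_L by (auto; lra).
    destruct (Hvv (dq D s) (dC D s 0)) as [_ [X Y]]; [apply IQ; lra|apply IC; lra|]. simpl. rewrite X, Y.
    rewrite nu2_opp_even by (auto; apply IQ; lra).
    rewrite (RInt_ext_le (fun u => dR D s u * - dq D u * nu2 b (dC D s u))
      (fun u => - (dR D s u * dq D u * nu2 b (dC D s u)))); [|lra|intros; simpl; ring].
    rewrite RInt_Ropp by (apply (ex_int4 b D HR); lra).
    simpl. ring. }
  rewrite EAq.
  evar_last; [apply deriv_opp, SQ; auto|].
  simpl. ring.
- intros s Hs. rewrite flip_L by auto.
  destruct (Hvv (dq D s) (dC D s 0)) as [X _]; [apply IQ; lra|apply IC; lra|]. simpl. rewrite X.
  rewrite nu1_opp_even by auto. rewrite (SH s Hs). ring.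
Qed.

Lemma flip_Usp (b : nat -> R) (beta qs E Es Gs qo : R) (D : dynamics) : nu_even b ->
  is_Usp beta b qs (Params E Es Gs qo) D -> is_Usp beta b qs (Params E Es Gs (- qo)) (flip D).
Proof.
intros He [S U]. split; [now apply flip_solves|].
intros D' S'. apply flip_solves in S'; auto. rewrite Ropp_involutive in S'.
destruct (U _ S') as [U1 U2]. split; [exact U1|].
intros s Hs. destruct (U2 s Hs) as [a c]. simpl in *. split; auto. lra.
Qed.

(** ** The case q_star = 0 *)

(** It coincides with the case [q_star = 1], [q_o = 0], [E_star = G_star = 0], where
    [q = 0], the terms with [nu'] of [q] vanish, and [v (x, y) = E nu y / nu 1]. *)
Lemma v0_of (b : nat -> R) (E x y : R) : v_of b 1 0 (E / nu b 1) 0 0 0 x y = E * nu b y / nu b 1.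
Proof. unfold v_of, Rdiv. ring. Qed.

Lemma full_sys0 (b : nat -> R) (E : R) : mixture b -> full_sys b 1 (Params E 0 0 0) (E / nu b 1) 0 0 0.
Proof.
intros Hb. assert (H1 : 0 < nu b 1) by (apply nu_pos; auto; [apply in_disk_01; auto|]; lra).
unfold full_sys, sigma_sys; simpl. rewrite nu_0, nu1_0 by auto. repeat split; field; lra.
Qed.

Lemma A_C0_eq (b : nat -> R) (beta E : R) (v : R -> R -> R) (D : dynamics) (s t : R) : mixture b ->
  (forall x y, v x y = E * nu b y / nu b 1) -> (forall s, 0 <= s -> dq D s = 0) -> 0 <= s -> 0 <= t ->
  A_C beta b 1 v D s t = A_C0 beta b (fun y => E * nu b y / nu b 1) D s t.
Proof.
intros Hb Hv Hq Hs Ht. unfold A_C, A_C0. rewrite !Hq, nu1_0 by auto.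
unfold v_y. rewrite (Derive_ext (fun y' => v 0 y') (fun y => E * nu b y / nu b 1)) by (intros; apply Hv).
ring.
Qed.

Lemma A_q0 (b : nat -> R) (beta E : R) (v : R -> R -> R) (D : dynamics) (s : R) : mixture b ->
  (forall x y, v x y = E * nu b y / nu b 1) -> (forall s, 0 <= s -> dq D s = 0) -> 0 <= s ->
  A_q beta b 1 0 v D s = 0.
Proof.
intros Hb Hv Hq Hs. unfold A_q, dL.
rewrite !RInt_zero; auto.
- unfold v_x. rewrite (Derive_ext (fun x' => v x' (dC D s 0)) (fun _ => E * nu b (dC D s 0) / nu b 1))
    by (intros; apply Hv).
  rewrite Derive_const. ring.
- intros u Hu. rewrite Hq, nu1_0 by (auto; lra). ring.
- intros u Hu. rewrite Hq by lra. ring.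
Qed.

Lemma sp0_sp (b : nat -> R) (beta E : R) (D : dynamics) : mixture b ->
  solves_sp0 beta b E D -> solves_sp beta b 1 (Params E 0 0 0) D.
Proof.
intros Hb [SC [Hq SH]].
exists (v_of b 1 0 (E / nu b 1) 0 0 0).
assert (Hv := v0_of b E).
split; [|split; [|split; [|split]]].
- apply (sys_is_v b 1 0 (Params E 0 0 0)); auto; simpl; try lra.
  + rewrite Rabs_R0; lra.
  + now apply full_sys0.
- eapply CR_system_ext; [|exact SC]. intros s t Hs Ht. symmetry. now apply A_C0_eq.
- simpl. apply Hq; lra.
- intros s Hs. simpl. rewrite (A_q0 b beta E) by (auto; lra). rewrite Hq by lra.
  apply (is_derive_ext_loc (fun _ => 0)).
  + exists (mkposreal s Hs). intros y Hy. apply ball_Rabs, Rabs_lt_between in Hy; simpl in Hy.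
    symmetry; apply Hq; lra.
  + auto_derive; auto. ring.
- intros s Hs. rewrite SH by auto.
  rewrite (Hq s Hs), nu1_0, Hv by auto. ring.
Qed.

Lemma sp_sp0 (b : nat -> R) (beta E : R) (D : dynamics) : mixture b ->
  solves_sp beta b 1 (Params E 0 0 0) D -> (forall s, 0 <= s -> dq D s = 0) -> solves_sp0 beta b E D.
Proof.
intros Hb [v [Hiv [SC [Q [SQ SH]]]]] Hq.
assert (HA : allowed b 1 (Params E 0 0 0)).
{ split; [|split]; simpl; rewrite ?Rabs_R0; try lra. intros p Hp. split; [field|].
  intros Z; exfalso; lra. }
assert (Hal : Rabs 0 < 1) by (rewrite Rabs_R0; lra).
assert (Hqo : pqo (Params E 0 0 0) = 0 * 1) by (simpl; ring).
assert (H1 : 0 < 1 <= 1) by lra.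
destruct (is_v_sys b 1 0 _ v Hb H1 Hal HA Hqo Hiv) as [w1 [w2 [w3 [w4 [Hs [Hp ->]]]]]].
destruct (sys_unique b 1 0 _ _ _ _ _ _ _ _ _ Hb H1 Hal Hqo Hs (full_sys0 b E Hb) Hp (fun _ => eq_refl))
  as [-> [-> [-> ->]]].
split; [|split]; auto.
- eapply CR_system_ext; [|exact SC]. intros s t Hs' Ht. apply A_C0_eq; auto. apply v0_of.
- intros s Hs'. rewrite SH by auto.
  rewrite (Hq s Hs'), nu1_0, v0_of by auto. ring.
Qed.

Lemma image0 (b : nat -> R) (beta E : R) : mixture b ->
  in_image (stat_matrix b 1 0) (stat_vector beta b 1 0 (Params E 0 0 0)) <-> E = 2 * beta * nu b 1.
Proof.
intros Hb. rewrite image_eqs. unfold b_alpha. rewrite !Rmult_0_l, nu_0, nu1_0 by auto. simpl. split.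
- intros [x1 [x2 [m1 _]]]. lra.
- intros ->. exists 0, 0. repeat split; unfold Rdiv; ring.
Qed.

Lemma gamma_star_0 (b : nat -> R) (beta : R) : mixture b -> gamma_star beta b 1 0 = 1 / 2.
Proof.
intros Hb. unfold gamma_star. rewrite Rmult_0_l, nu1_0 by auto.
replace (0 ^ 2) with 0 by ring. unfold Rdiv. rewrite Rmult_0_l, Rmult_0_r, !Rminus_0_r, Rmult_1_r. reflexivity.
Qed.

(** ** Existence of stationary dynamics *)

(** Any weights [(x1, x2)] that solve the fourth constraint determine the parameters from
    the other three. *)
Lemma stationary_exists (b : nat -> R) (beta qs al : R) : mixture b -> 0 < beta -> 0 < qs <= 1 -> Rabs al < 1 ->
  al = 0 \/ nu1 b (al * qs) <> 0 \/ psi b (al * qs) <> 0 ->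
  exists V D, allowed b qs V /\ pqo V = al * qs /\ is_Usp beta b qs V D /\ stationary D.
Proof.
intros Hb Hbeta Hqs Hal Hc.
assert (Iq : in_disk b (al * qs)) by (apply in_disk_qo; auto; lra).
assert (Is : in_disk b (qs ^ 2)) by now apply in_disk_qs2.
set (m := al / (2 * beta * (1 - al ^ 2))
      - 2 * beta * b_alpha b qs al * (al * psi b (al * qs) - qs * nu2 b (al * qs))).
assert (Hx : exists x1 x2, qs * nu1 b (al * qs) * x1 + qs * psi b (al * qs) * x2 = m).
{ destruct Hc as [Hc|[Hc|Hc]].
  - exists 0, 0. unfold m, b_alpha. rewrite Hc, Rmult_0_l, nu1_0 by auto. unfold Rdiv. ring.
  - exists (m / (qs * nu1 b (al * qs))), 0. field. split; auto; lra.
  - exists 0, (m / (qs * psi b (al * qs))). field. split; auto; lra. }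
destruct Hx as [x1 [x2 Hx]].
set (V := Params
  (nu b (al * qs) * x1 + al * qs * nu1 b (al * qs) * x2
    + 2 * beta * (nu b 1 - (1 - al ^ 2) * nu1 b (al * qs) * b_alpha b qs al))
  (nu b (qs ^ 2) * x1 + qs ^ 2 * nu1 b (qs ^ 2) * x2 + 2 * beta * nu b (al * qs))
  ((qs * nu1 b (qs ^ 2) * x1 + qs * psi b (qs ^ 2) * x2 + 2 * beta * al * nu1 b (al * qs)) / qs)
  (al * qs)).
assert (Hlt := qo_lt qs al (proj1 Hqs) Hal).
assert (HA : allowed b qs V).
{ split; [simpl; lra|]. split; [simpl; lra|]. intros p Hp. simpl. split; [|intros; exfalso; lra].
  change (qs * (qs * 1)) with (qs ^ 2).
  assert (E1 := pure_nu b p _ Hp Iq). assert (E2 := pure_nu b p _ Hp Is).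
  rewrite (pure_psi b p _ Hp Is).
  transitivity (((qs ^ 2 * nu1 b (qs ^ 2)) * (x1 + INR p * x2) + 2 * beta * (al * qs * nu1 b (al * qs))) / qs ^ 2);
    [field; lra|].
  replace (qs ^ 2 * nu1 b (qs ^ 2) * x2) with (INR p * nu b (qs ^ 2) * x2) by (rewrite <- E2; ring).
  rewrite E1, E2. field. lra. }
assert (Him : in_image (stat_matrix b qs al) (stat_vector beta b qs al V)).
{ apply image_eqs. exists x1, x2. unfold V; cbn [pE pEs pGs]. repeat split; try ring; [field; lra|exact Hx]. }
destruct (c_gamma_star b beta qs al Hb Hqs Hal) as [c [h [h' [FD _]]]].
destruct (construct b beta qs al V c h h' Hb Hbeta Hqs Hal HA eq_refl Him FD) as [H0 [U [S _]]].
exists V, (stat_dynamics c h (al * qs) H0). auto.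
Qed.

Theorem proposition1p14 (b : nat -> R) (beta : R)
  (Hb : mixture b) (Hbeta : 0 < beta) :
  (* (1) *)
  ((forall qs alpha : R, 0 < qs <= 1 -> Rabs alpha <= 1 ->
      (forall V D, allowed b qs V -> pqo V = alpha * qs ->
         is_Usp beta b qs V D -> stationary D -> Rabs alpha < 1) /\
      (Rabs alpha < 1 ->
         let gs := gamma_star beta b qs alpha in
         gamma_ok beta b gs /\
         (exists c c' c'' : R -> R,
            is_c_gamma beta b gs c c' /\ C1_on_halfline c' c'' /\
            (forall V D, allowed b qs V -> pqo V = alpha * qs ->
               is_Usp beta b qs V D -> stationary D ->
               has_profile D c (fun tau => - 2 * c' tau))) /\
         (alpha = 0 \/ nu1 b (alpha * qs) <> 0 \/ psi b (alpha * qs) <> 0 ->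
            exists V D, allowed b qs V /\ pqo V = alpha * qs /\
              is_Usp beta b qs V D /\ stationary D) /\
         alpha ^ 2 <= c_inf beta b gs /\
         (c_inf beta b gs = alpha ^ 2 <->
            (forall x, alpha ^ 2 < x <= 1 ->
               Rbar_lt (dg_beta beta b x) (dg_beta beta b (alpha ^ 2))) /\
            (pure b \/ alpha = qs \/
             (alpha = - qs /\ (nu_even b \/ nu_odd b)) \/ alpha = 0)))) /\
   (forall qs : R, 0 < qs <= 1 -> nu_even b \/ nu_odd b ->
      gamma_star beta b qs (- qs) = gamma_star beta b qs qs /\
      (forall c c' : R -> R,
         is_c_gamma beta b (gamma_star beta b qs (- qs)) c c' <->
         is_c_gamma beta b (gamma_star beta b qs qs) c c'))) /\
  (* (2) *)
  (forall qs : R, 0 < qs <= 1 ->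
     (forall alpha V, Rabs alpha <= 1 -> allowed b qs V ->
        pqo V = alpha * qs ->
        ((exists D, is_Usp beta b qs V D /\ stationary D) <->
         Rabs alpha < 1 /\
         in_image (stat_matrix b qs alpha) (stat_vector beta b qs alpha V))) /\
     (forall alpha V, alpha = qs \/ (nu_even b /\ alpha = - qs) ->
        allowed b qs V -> pqo V = alpha * qs ->
        ((Rabs alpha < 1 /\
          in_image (stat_matrix b qs alpha) (stat_vector beta b qs alpha V)) <->
         pGs V = 1 / (2 * beta * (1 - qs ^ 2))
                 + 2 * beta * (1 - qs ^ 2) * nu2 b (qs ^ 2) /\
         pE V - pEs V
         = 2 * beta * (nu b 1 - (1 - qs ^ 2) * nu1 b (qs ^ 2) - nu b (qs ^ 2)))) /\
     (nu_even b ->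
        forall E Es Gs, allowed b qs (Params E Es Gs (qs * qs)) ->
        forall C chi H,
          (exists r q, is_Usp beta b qs (Params E Es Gs (qs * qs))
                         (Dynamics C r chi q H)) <->
          (exists r q, is_Usp beta b qs (Params E Es Gs (- qs * qs))
                         (Dynamics C r chi q H)))) /\
  (* (3) *)
  (gamma_ok beta b (1 / 2) /\
   (exists c c' : R -> R,
      is_c_gamma beta b (1 / 2) c c' /\
      (forall E D, is_Usp0 beta b E D -> stationary D ->
         has_profile D c (fun tau => - 2 * c' tau))) /\
   (forall E, (exists D, is_Usp0 beta b E D /\ stationary D) <->
      E = 2 * beta * nu b 1)).
Proof.
split; [split|split].
- intros qs al Hqs Hal. split.
  + intros V D HA Hqo [HS _] Hst. now apply (necessity b beta qs al V D).
  + intros Hlt gs.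
    destruct (c_gamma_star b beta qs al Hb Hqs Hlt) as [c [h [h' [FD [HC HC1]]]]].
    split; [|split; [|split; [|split]]].
    * exists (al ^ 2). now apply al2_in_set.
    * exists c, (fun t => - h t), (fun t => - h' t). split; [exact HC|]. split; [exact HC1|].
      intros V D HA Hqo [HS HU] Hst.
      destruct (necessity b beta qs al V D) as [_ Him]; auto.
      destruct (construct b beta qs al V c h h' Hb Hbeta Hqs Hlt HA Hqo Him FD) as [H0 [U [_ P]]].
      apply (eq_dynamics_profile (stat_dynamics c h (al * qs) H0)); auto. apply HU, U.
    * now apply stationary_exists.
    * apply (c_inf_lub beta b gs (al ^ 2) 1 Hb).
      -- now apply al2_in_set.
      -- intros y [Hy _]; lra.
    * now apply c_inf_eq.
- intros qs Hqs Hp. assert (E := gamma_star_opp b beta qs Hb Hqs Hp). split; auto.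
  intros c c'. rewrite E. tauto.
- intros qs Hqs. split; [|split].
  + intros al V Hal HA Hqo. split.
    * intros [D [[HS _] Hst]]. now apply (necessity b beta qs al V D).
    * intros [Hlt Him].
      destruct (c_gamma_star b beta qs al Hb Hqs Hlt) as [c [h [h' [FD _]]]].
      destruct (construct b beta qs al V c h h' Hb Hbeta Hqs Hlt HA Hqo Him FD) as [H0 [U [S _]]].
      exists (stat_dynamics c h (al * qs) H0). auto.
  + intros al V Hal HA Hqo. now apply diag_constraint.
  + intros He E Es Gs _ C chi H. split; intros [r [q HU]]; exists r, (fun s => - q s).
    * replace (- qs * qs) with (- (qs * qs)) by ring. exact (flip_Usp b beta qs E Es Gs _ _ He HU).
    * replace (qs * qs) with (- (- qs * qs)) by ring. exact (flip_Usp b beta qs E Es Gs _ _ He HU).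
- assert (H01 : 0 < 1 <= 1) by lra.
  assert (Hal : Rabs 0 < 1) by (rewrite Rabs_R0; lra).
  assert (Hg := gamma_star_0 b beta Hb).
  assert (HA : forall E, allowed b 1 (Params E 0 0 0)).
  { intros E. split; [|split]; simpl; rewrite ?Rabs_R0; try lra. intros p Hp. split; [field|].
    intros Z; exfalso; lra. }
  assert (Hqo : forall E, pqo (Params E 0 0 0) = 0 * 1) by (intros; simpl; ring).
  destruct (c_gamma_star b beta 1 0 Hb H01 Hal) as [c [h [h' [FD [HC _]]]]].
  assert (Hnec : forall E D, solves_sp0 beta b E D -> stationary D -> E = 2 * beta * nu b 1).
  { intros E D HS Hst. apply (image0 b beta E Hb).
    apply (necessity b beta 1 0 (Params E 0 0 0) D); auto; [lra|]. now apply sp0_sp. }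
  assert (Hcon : exists D0, solves_sp0 beta b (2 * beta * nu b 1) D0 /\ stationary D0 /\
    has_profile D0 c (fun t => - 2 * - h t) /\
    forall D', solves_sp0 beta b (2 * beta * nu b 1) D' -> eq_dynamics D' D0).
  { set (E := 2 * beta * nu b 1).
    assert (Him := proj2 (image0 b beta E Hb) eq_refl).
    destruct (construct b beta 1 0 (Params E 0 0 0) c h h' Hb Hbeta H01 Hal (HA E) (Hqo E) Him FD)
      as [H0 [[S U] [St P]]].
    exists (stat_dynamics c h (0 * 1) H0). split; [|split; [exact St|split; [exact P|]]].
    - apply sp_sp0; auto. intros; simpl; ring.
    - intros D' S'. apply U. now apply sp0_sp. }
  destruct Hcon as [D0 [S0 [St0 [P0 U0]]]].
  split; [|split].
  + exists (0 ^ 2). rewrite <- Hg. now apply al2_in_set.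
  + exists c, (fun t => - h t). rewrite <- Hg. split; [exact HC|].
    intros E D [HS HU] Hst. rewrite (Hnec E D HS Hst) in *.
    apply (eq_dynamics_profile D0); auto.
  + intros E. split.
    * intros [D [[HS _] Hst]]. now apply (Hnec E D).
    * intros ->. exists D0. split; [split|]; auto.
Qed.
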